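(* Let $L$ be an integral $\mathbb{Z}$-lattice on a positive-definite quadratic space $(V,Q)$ over $\mathbb{Q}$ and let $\bm u\in L$ be a primitive vector with $Q(\bm u)\neq0$. Let $c$ be a positive odd integer such that there is no prime $p\mid c$ for which $L_p$ is not unimodular and $Q(\bm u)\in p\mathbb{Z}_p$. Then \[\frac{m^+\left(L+\frac{\bm u}{c}\right)}{m^+(L)}=\frac{2m\left(L+\frac{\bm u}{c}\right)}{m^+(L)}\ \ge\ \prod_{p\mid c}\frac{r\left(Q;\bm u,p^{c_p}\right)}{2}.\]
   Context: $B(\bm x,\bm y)=Q(\bm x+\bm y)-Q(\bm x)-Q(\bm y)$; $L$ integral means $\tfrac12B(L,L)\subseteq\mathbb{Z}$; $L_p=L\otimes\mathbb{Z}_p$, unimodular if the Gram matrix $(\tfrac12 B(\bm e_i,\bm e_j))$ of a basis has determinant in $\mathbb{Z}_p^\times$. $\bm u$ primitive: $\bm u\notin pL$ for all primes $p$. $c_p=\mathrm{ord}_p(c)$. $r(Q;\bm u,p^k)=\#\{\bm x\in L_p/p^kL_p:\bm x\notin pL_p,\ Q(\bm x)\equiv Q(\bm u)\pmod{p^k}\}$. For a shifted lattice $K+\bm w$ ($K\subset V$ a lattice, $\bm w\in V$), $O(K+\bm w)$ (resp. $SO(K+\bm w)$) is the group of isometries (resp. of determinant $1$) of $V$ mapping $K+\bm w$ onto itself. Two shifted lattices are in the same class (resp. proper class) if an isometry (resp. determinant-one isometry) of $V$ maps one onto the other, and in the same genus (resp. proper genus) if for every prime $p$ such a map exists in $O(V_p)$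 (resp. $SO(V_p)$) between the localizations $K_p+\bm w$. The mass $m(K+\bm w)=\sum 1/\#O(K'+\bm w')$ over class representatives of the genus, and the proper mass $m^+(K+\bm w)=\sum 1/\#SO(K'+\bm w')$ over proper class representatives of the proper genus; $m(L),m^+(L)$ are the case $\bm w=0$.
   Formalization: The equality m⁺(L+u/c)=2m(L+u/c) is proved for rank n≥3, for n=1 only if c=1, and for n=2 only if no prime p|c has Q(u)∈pZ_p; it fails otherwise (e.g. L=Z, Q=x², u=1, c=3). The lower bound is proved for both ratios in every rank. *)

(* Defs.v *)
From HB Require Import structures.
From mathcomp Require Import all_boot all_order all_algebra.
From mathcomp Require Import finmap.
From mathcomp Require Import mathcomp_extra boolp classical_sets functions.
From mathcomp Require Import cardinality fsbigop.
Set Implicit Arguments.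
Unset Strict Implicit.
Unset Printing Implicit Defensive.
Import Order.TTheory GRing.Theory Num.Theory.
Local Open Scope classical_set_scope.
Local Open Scope ring_scope.

(* Bundled, so that Z_p and Q_p below are total functions of p. *)
Record prime_nat := PrimeNat { prime_val :> nat; prime_valP : prime prime_val }.
HB.instance Definition _ := [isSub for prime_val].
HB.instance Definition _ := [Choice of prime_nat by <:].

Definition prime_divisors (c : nat) : seq prime_nat := pmap insub (primes c).

Section PadicIntegers.
Variable p : prime_nat.

(* Z_p = lim Z/p^k: the component f k is the representative of the class
   modulo p^k in [0, p^k); the bound follows from the compatibility. *)
Record padic_int := PadicInt {
  padic_fun :> nat -> nat;
  padic_compat : `[< forall k, padic_fun k = (padic_fun k.+1 %% p ^ k)%N >] }.
HB.instance Definition _ := [isSub for padic_fun].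
HB.instance Definition _ := [Choice of padic_int by <:].

Lemma padicE (f : padic_int) k : f k = (f k.+1 %% p ^ k)%N.
Proof. by move: (padic_compat f) => /asboolP. Qed.

Lemma padic_mod (f : padic_int) k : (f k %% p ^ k)%N = f k.
Proof. by rewrite padicE modn_mod. Qed.

Lemma padic_ext (f g : padic_int) : (forall k, f k = g k) -> f = g.
Proof. by move=> fg; apply: val_inj; apply: funext. Qed.

Let dvd_pS k : (p ^ k %| p ^ k.+1)%N.
Proof. by rewrite dvdn_exp2l. Qed.

Lemma padic_of_subproof (h : nat -> nat) :
  (forall k, h k.+1 = h k %[mod p ^ k]) ->
  `[< forall k, (h k %% p ^ k = (h k.+1 %% p ^ k.+1) %% p ^ k)%N >].
Proof. by move=> hh; apply/asboolP => k; rewrite modn_dvdm// hh. Qed.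
Definition padic_of h hh := PadicInt (@padic_of_subproof h hh).

Lemma padicS (f : padic_int) k : f k.+1 = f k %[mod p ^ k].
Proof. by rewrite [in RHS]padicE modn_mod. Qed.

Lemma padic_const_subproof (m k : nat) : m = m %[mod p ^ k]. Proof. by []. Qed.
Definition padic_nat m := padic_of (padic_const_subproof m).

Lemma padic_add_subproof (f g : padic_int) k :
  (f k.+1 + g k.+1 = f k + g k %[mod p ^ k])%N.
Proof. by rewrite -modnDm !padicS modnDm. Qed.
Definition padic_add f g := padic_of (padic_add_subproof f g).

Lemma padic_mul_subproof (f g : padic_int) k :
  (f k.+1 * g k.+1 = f k * g k %[mod p ^ k])%N.
Proof. by rewrite -modnMm !padicS modnMm. Qed.
Definition padic_mul f g := padic_of (padic_mul_subproof f g).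

(* - f is computed as (p ^ k - 1) * f to stay within nat. *)
Lemma padic_opp_subproof (f : padic_int) k :
  ((p ^ k.+1).-1 * f k.+1 = (p ^ k).-1 * f k %[mod p ^ k])%N.
Proof.
have p_gt0 := prime_gt0 (prime_valP p).
apply/eqP; rewrite -(eqn_modDr (f k.+1)) -mulSnr prednK ?expn_gt0 ?p_gt0//.
rewrite -[X in _ == X](modnDmr) padicS modnDmr -mulSnr prednK ?expn_gt0 ?p_gt0//.
by rewrite expnS -mulnA mulnCA !modnMr.
Qed.
Definition padic_opp f := padic_of (padic_opp_subproof f).

Lemma padic_addA : associative padic_add.
Proof. by move=> f g h; apply: padic_ext => k /=; rewrite modnDmr modnDml addnA. Qed.
Lemma padic_addC : commutative padic_add.
Proof. by move=> f g; apply: padic_ext => k /=; rewrite addnC. Qed.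
Lemma padic_add0 : left_id (padic_nat 0) padic_add.
Proof. by move=> f; apply: padic_ext => k /=; rewrite mod0n add0n padic_mod. Qed.
Lemma padic_addN : left_inverse (padic_nat 0) padic_opp padic_add.
Proof.
move=> f; apply: padic_ext => k /=.
rewrite modnDml -mulSnr prednK ?expn_gt0 ?(prime_gt0 (prime_valP p))//.
by rewrite modnMr mod0n.
Qed.
HB.instance Definition _ :=
  GRing.isZmodule.Build padic_int padic_addA padic_addC padic_add0 padic_addN.

Lemma padic_mulA : associative padic_mul.
Proof. by move=> f g h; apply: padic_ext => k /=; rewrite modnMmr modnMml mulnA. Qed.
Lemma padic_mulC : commutative padic_mul.
Proof. by move=> f g; apply: padic_ext => k /=; rewrite mulnC. Qed.
Lemma padic_mul1 : left_id (padic_nat 1) padic_mul.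
Proof. by move=> f; apply: padic_ext => k /=; rewrite modnMml mul1n padic_mod. Qed.
Lemma padic_mulDl : left_distributive padic_mul padic_add.
Proof.
by move=> f g h; apply: padic_ext => k /=; rewrite modnMml modnDm mulnDl.
Qed.
Lemma padic_1neq0 : padic_nat 1 != padic_nat 0.
Proof.
apply/eqP => /(congr1 (fun f : padic_int => f 1%N)) /=.
by rewrite expn1 mod0n modn_small // prime_gt1 ?prime_valP.
Qed.
HB.instance Definition _ := GRing.Zmodule_isComNzRing.Build padic_int
  padic_mulA padic_mulC padic_mul1 padic_mulDl padic_1neq0.

Definition padic_unit : {pred padic_int} := fun f => `[< exists g, g * f = 1 >].
Definition padic_inv (f : padic_int) : padic_int :=
  if padic_unit f then xget 0 [set g | g * f = 1] else f.

Lemma padic_mulVx : {in padic_unit, left_inverse 1 padic_inv *%R}.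
Proof.
move=> f uf; rewrite /padic_inv [padic_unit f]uf.
by have /asboolP := uf => fg; exact: (xgetPex 0 fg).
Qed.
Lemma padic_unitPl f g : g * f = 1 -> padic_unit f.
Proof. by move=> gf; apply/asboolP; exists g. Qed.
Lemma padic_inv_out : {in [predC padic_unit], padic_inv =1 id}.
Proof.
move=> f; rewrite inE /= => nuf.
by rewrite /padic_inv; case: ifPn => // uf; rewrite [f \in _]uf in nuf.
Qed.
HB.instance Definition _ := GRing.ComNzRing_hasMulInverse.Build padic_int
  padic_mulVx padic_unitPl padic_inv_out.

Lemma padic_modD (f : padic_int) i j : (f (i + j) %% p ^ i)%N = f i.
Proof.
elim: j => [|j IH]; first by rewrite addn0 padic_mod.
by rewrite addnS -IH [in RHS]padicE modn_dvdm// dvdn_exp2l// leq_addr.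
Qed.

Lemma padic_idomain (f g : padic_int) : f * g = 0 -> (f == 0) || (g == 0).
Proof.
move=> fg0; apply: contrapT => /negP; rewrite negb_or => /andP[f0 g0].
have nz (h : padic_int) : h != 0 -> exists i, h i != 0%N.
  move=> /eqP h0; apply: contrapT => hi; apply: h0; apply: padic_ext => k.
  rewrite [RHS]mod0n; apply/eqP/negPn/negP => hk.
  by apply: hi; exists k.
have [i fi] := nz _ f0; have [j gj] := nz _ g0.
have pp := prime_valP p.
have val (h : padic_int) k l : h k != 0%N ->
    (0 < h (k + l))%N && (logn p (h (k + l)) < k)%N.
  move=> hk; have ndvd : ~~ (p ^ k %| h (k + l))%N.
    by rewrite /dvdn padic_modD.
  have h_gt0 : (0 < h (k + l))%N.
    by rewrite lt0n; apply: contraNneq ndvd => ->; rewrite dvdn0.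
  by rewrite h_gt0 /= ltnNge -pfactor_dvdn.
have /andP[f_gt0 vf] := val f i j fi.
have := val g j i gj; rewrite addnC => /andP[g_gt0 vg].
have : (p ^ (i + j) %| f (i + j) * g (i + j))%N.
  have := congr1 (fun h : padic_int => h (i + j)%N) fg0.
  by rewrite [X in _ = X]mod0n => /eqP.
rewrite pfactor_dvdn ?muln_gt0 ?f_gt0// lognM// leqNgt.
have -> : (logn p (f (i + j)) + logn p (g (i + j)) < i + j)%N.
  by rewrite -addnS leq_add // ltnW.
by [].
Qed.
HB.instance Definition _ :=
  GRing.ComUnitRing_isIntegral.Build padic_int padic_idomain.

End PadicIntegers.

Notation padic p := {fraction (padic_int p)}.

(* Z_p as a subset of Q_p. *)
Definition Zp_in (p : prime_nat) : set (padic p) :=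
  range (@FracField.tofrac (padic_int p)).
Arguments Zp_in : clear implicits.
Definition Zp_unit (p : prime_nat) : set (padic p) :=
  [set @FracField.tofrac _ x | x in [set x : padic_int p | x \is a GRing.unit]].
Arguments Zp_unit : clear implicits.
Definition Zp_multiples (p : prime_nat) (k : nat) : set (padic p) :=
  [set p%:R ^+ k * z | z in Zp_in p].
Arguments Zp_multiples : clear implicits.

(* Quadratic spaces F^n of row vectors, given by the symmetric Gram matrix A
   of the bilinear form B/2. *)
Section QuadraticSpace.
Variables (F : fieldType) (n : nat) (A : 'M[F]_n).
Implicit Types (x y : 'rV[F]_n) (X Y : set 'rV[F]_n) (G : set 'M[F]_n).

Definition quad x : F := (x *m A *m x^T) 0 0.
Definition polar x y : F := quad (x + y) - quad x - quad y.

Definition gram (M : 'M[F]_n) : 'M[F]_n :=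
  \matrix_(i, j) (2^-1 * polar (row i M) (row j M)).

Definition isometries : set 'M[F]_n :=
  [set g | g \in unitmx /\ forall x, quad (x *m g) = quad x].
Definition proper_isometries : set 'M[F]_n :=
  isometries `&` [set g | \det g = 1].

Definition maps_onto X Y : set 'M[F]_n := [set g | [set x *m g | x in X] = Y].

(* S is the subring of coefficients: Z in rat, or Z_p in Q_p. *)
Definition row_span (S : set F) (M : 'M[F]_n) : set 'rV[F]_n :=
  [set a *m M | a in [set a : 'rV[F]_n | forall i, S (a 0 i)]].

Definition scale_set (t : F) X : set 'rV[F]_n := [set t *: x | x in X].
Definition translate X w : set 'rV[F]_n := [set x + w | x in X].

End QuadraticSpace.

Definition pos_def n (A : 'M[rat]_n) :=
  A^T = A /\ forall x : 'rV[rat]_n, x != 0 -> 0 < quad A x.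

(* A lattice is given by a basis, the rows of an invertible matrix; a shifted
   lattice (K, w) stands for K + w. *)
Definition zlattice n := {M : 'M[rat]_n | M \in unitmx}.
Definition shifted_lattice n : Type := (zlattice n * 'rV[rat]_n)%type.

Section Lattices.
Variable n : nat.
Implicit Types (A : 'M[rat]_n) (L : zlattice n) (S T : shifted_lattice n).
Implicit Types (x u : 'rV[rat]_n) (p : prime_nat).

Definition mem_lattice L : set 'rV[rat]_n :=
  row_span [set z : rat | z \is a Num.int] (val L).
Definition mem_shifted S : set 'rV[rat]_n := translate (mem_lattice S.1) S.2.

Definition loc p x : 'rV[padic p]_n := map_mx ratr x.
Definition loc_form p A : 'M[padic p]_n := map_mx ratr A.
Definition loc_lattice p L : set 'rV[padic p]_n :=
  row_span (Zp_in p) (map_mx ratr (val L)).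
Arguments loc_lattice : clear implicits.
Definition loc_shifted p S : set 'rV[padic p]_n :=
  translate (loc_lattice p S.1) (loc p S.2).
Arguments loc_shifted : clear implicits.

Definition integral_lattice A L := forall x y,
  mem_lattice L x -> mem_lattice L y -> 2^-1 * polar A x y \is a Num.int.

Definition primitive L u := mem_lattice L u /\
  forall p, ~ scale_set (prime_val p)%:R (mem_lattice L) u.

Definition unimodular_at p A L :=
  Zp_unit p (\det (gram (loc_form p A) (map_mx ratr (val L)))).

(* Classes and genera are sets of pairs (basis, shift). All pairs describing
   the same subset of V are in the same class, through the identity of V. *)
Definition in_class A S : set (shifted_lattice n) := [set T |
  isometries A `&` maps_onto (mem_shifted S) (mem_shifted T) !=set0].
Definition in_proper_class A S : set (shifted_lattice n) := [set T |
  proper_isometries A `&` maps_onto (mem_shifted S) (mem_shifted T) !=set0].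
Definition genus A S : set (shifted_lattice n) := [set T | forall p,
  isometries (loc_form p A)
    `&` maps_onto (loc_shifted p S) (loc_shifted p T) !=set0].
Definition proper_genus A S : set (shifted_lattice n) := [set T | forall p,
  proper_isometries (loc_form p A)
    `&` maps_onto (loc_shifted p S) (loc_shifted p T) !=set0].

Definition orth_group A S : set 'M[rat]_n :=
  isometries A `&` maps_onto (mem_shifted S) (mem_shifted S).
Definition sorth_group A S : set 'M[rat]_n :=
  proper_isometries A `&` maps_onto (mem_shifted S) (mem_shifted S).

Definition card_set (T : choiceType) (X : set T) : nat := #|` fset_set X |.

(* C runs over the classes of the genus of S, and xget S C is a representative
   of C. Pitfall: fset_set and the sum over a set default to 0 on infinite data;
   for A positive definite a genus has finitely many classes and the groups are
   finite, so the default is never used. *)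
Definition mass A S : rat :=
  \sum_(C \in [set in_class A T | T in genus A S])
    ((card_set (orth_group A (xget S C)))%:R^-1 : rat).
Definition proper_mass A S : rat :=
  \sum_(C \in [set in_proper_class A T | T in proper_genus A S])
    ((card_set (sorth_group A (xget S C)))%:R^-1 : rat).

(* r(Q; u, p^k), counting the cosets x + p^k L_p. *)
Definition rep_count p A L u (k : nat) : nat :=
  card_set [set translate (scale_set (p%:R ^+ k) (loc_lattice p L)) x
    | x in [set x | [/\ loc_lattice p L x,
        ~ scale_set p%:R (loc_lattice p L) x &
        Zp_multiples p k (quad (loc_form p A) x - quad (loc_form p A) (loc p u))]]].

End Lattices.
Arguments loc_lattice {n} p L.
Arguments loc_shifted {n} p S.

(* Main.v *)
Require Import Defs.
From HB Require Import structures.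
From mathcomp Require Import all_boot all_order all_algebra.
From mathcomp Require Import fingroup perm.
From mathcomp Require Import finmap.
From mathcomp Require Import mathcomp_extra boolp classical_sets functions.
From mathcomp Require Import cardinality fsbigop.
From mathcomp Require Import ring lra zify.
Set Implicit Arguments.
Unset Strict Implicit.
Unset Printing Implicit Defensive.
Import Order.TTheory GRing.Theory Num.Theory.
Local Open Scope classical_set_scope.
Local Open Scope ring_scope.

(** The isometries of a shifted lattice K + w preserve K, because K consists of
    the differences of its elements. Hence the map from the proper genus of
    L + u/c to that of L which forgets the shift is equivariant, and by
    orbit-stabilizer the mass of L + u/c dominates that of L times the number of
    cosets K + a/c which are locally properly isometric to L + u/c. By the Chinese
    remainder theorem this number is at least the product over p | c of the sizes
    of the SO(L_p)-orbits of u modulo p^(c_p) L_p. Such an orbit contains at least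
    half of the vectors counted by r(Q; u, p^(c_p)): by Hensel's lemma each of them
    is congruent to a vector of norm exactly Q(u), and compositions of reflections
    carry u to all such vectors.

    Finiteness of the class number, without which the masses would be 0, follows
    from Hermite reduction. Over Q each class splits into one or two proper
    classes, of total weight 2/#O; the proper genus is the whole genus as soon as
    every localization of L + u/c has an isometry of determinant -1. *)

(** * Symmetric bilinear forms and reflections *)

Section Forms.
Variables (F : fieldType) (n : nat) (A : 'M[F]_n).
Implicit Types (x y : 'rV[F]_n) (g h : 'M[F]_n).

(** Oddness of c makes 2 a unit at every p | c, as Hensel's lemma and the reflections require there.
    The condition on c leaves two cases: either Q(u) is a unit, or L_p is unimodular and every
    primitive vector pairs to a unit with some lattice vector. The halves in the product arise
    because an isometry carrying u to a given vector may have determinant -1; the vectors reached in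
    this way lie in the image of the proper orbit under one fixed improper isometry.

    The equality of the two quotients rests on an improper isometry of L_p + u/c at every p, and two
    cases lack one. In rank 1 with p | c the only candidate is -1, which moves the coset. In rank 2
    with p | c and p | Q(u), L_p is a hyperbolic plane, each improper isometry exchanges its two
    isotropic lines modulo p, and u modulo p spans one of them. The equality is asserted outside
    these cases. The two inequalities hold in every rank: the bound is proved for the proper mass,
    which never exceeds twice the mass. *)

Definition bil x y : F := (x *m A *m y^T) 0 0.

Lemma bilDl x y z : bil (x + y) z = bil x z + bil y z.
Proof. by rewrite /bil !mulmxDl mxE. Qed.
Lemma bilDr x y z : bil x (y + z) = bil x y + bil x z.
Proof. by rewrite /bil linearD /= mulmxDr mxE. Qed.
Lemma bilZl a x y : bil (a *: x) y = a * bil x y.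
Proof. by rewrite /bil -!scalemxAl mxE. Qed.
Lemma bilZr a x y : bil x (a *: y) = a * bil x y.
Proof. by rewrite /bil linearZ /= -scalemxAr mxE. Qed.
Lemma bilNl x y : bil (- x) y = - bil x y.
Proof. by rewrite -scaleN1r bilZl mulN1r. Qed.
Lemma bilNr x y : bil x (- y) = - bil x y.
Proof. by rewrite -scaleN1r bilZr mulN1r. Qed.
Lemma bilBl x y z : bil (x - y) z = bil x z - bil y z.
Proof. by rewrite bilDl bilNl. Qed.
Lemma bilBr x y z : bil x (y - z) = bil x y - bil x z.
Proof. by rewrite bilDr bilNr. Qed.
Lemma bil0l x : bil 0 x = 0.
Proof. by rewrite /bil !mul0mx mxE. Qed.

Lemma quadE x : quad A x = bil x x. Proof. by []. Qed.
Lemma quadZ a x : quad A (a *: x) = a ^+ 2 * quad A x.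
Proof. by rewrite !quadE bilZl bilZr mulrA. Qed.

Hypothesis Asym : A^T = A.
Hypothesis two_neq0 : (2 : F) != 0.

Lemma bilC x y : bil x y = bil y x.
Proof.
rewrite /bil -[LHS](mxE trmx_key (fun i j => (x *m A *m y^T) j i)).
by rewrite -/(trmx _) !trmx_mul trmxK Asym mulmxA.
Qed.

Lemma quadD x y : quad A (x + y) = quad A x + quad A y + 2 * bil x y.
Proof. by rewrite !quadE bilDl !bilDr (bilC y x); ring. Qed.

Lemma half_polar x y : 2^-1 * polar A x y = bil x y.
Proof. by rewrite /polar quadD; field. Qed.

Lemma gramE (M : 'M[F]_n) : gram A M = M *m A *m M^T.
Proof.
apply/matrixP => i j; rewrite !mxE half_polar /bil mxE.
apply: eq_bigr => k _; rewrite !mxE; congr (_ * _).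
by apply: eq_bigr => l _; rewrite !mxE.
Qed.

Lemma isom_bil g x y : isometries A g -> bil (x *m g) (y *m g) = bil x y.
Proof.
move=> [_ gQ]; have := gQ (x + y); rewrite mulmxDl !quadD !gQ.
by move=> /addrI /(mulfI two_neq0).
Qed.

Lemma isom_mx g : isometries A g -> g *m A *m g^T = A.
Proof.
move=> gi; apply/matrixP => i j.
have := isom_bil (delta_mx 0 i) (delta_mx 0 j) gi.
have E (h k : 'I_n) (B : 'M[F]_n) : ((delta_mx 0 h : 'rV_n) *m B *m (delta_mx 0 k : 'rV_n)^T) 0 0 = B h k.
  rewrite -rowE mxE (bigD1 k)//= big1 ?addr0 => [|l /negPf nl]; rewrite !mxE ?eqxx ?mulr1//.
  by rewrite nl mulr0.
rewrite /bil E => <-; rewrite -E; congr (fun_of_matrix _ 0 0).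
by rewrite trmx_mul !mulmxA.
Qed.

Lemma mx_isom g : g *m A *m g^T = A -> g \in unitmx -> isometries A g.
Proof.
move=> gA gU; split => // x.
by rewrite /quad trmx_mul !mulmxA -[x *m g *m A]mulmxA -[x *m _ *m g^T]mulmxA gA.
Qed.

Lemma isom1 : isometries A 1%:M.
Proof. by split; [exact: unitmx1 | move=> x; rewrite mulmx1]. Qed.

Lemma isomM g h : isometries A g -> isometries A h -> isometries A (g *m h).
Proof.
move=> [gU gQ] [hU hQ]; split; first by rewrite unitmx_mul gU.
by move=> x; rewrite mulmxA hQ gQ.
Qed.

Lemma isomV g : isometries A g -> isometries A (invmx g).
Proof.
move=> [gU gQ]; split; first by rewrite unitmx_inv.
by move=> x; rewrite -gQ mulmxKV.
Qed.

Lemma proper_isom1 : proper_isometries A 1%:M.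
Proof. by split; [exact: isom1 | rewrite /= det1]. Qed.
Lemma proper_isomM g h : proper_isometries A g -> proper_isometries A h ->
  proper_isometries A (g *m h).
Proof.
by move=> [? /= dg] [? /= dh]; split; [exact: isomM|rewrite /= det_mulmx dg dh mulr1].
Qed.
Lemma proper_isomV g : proper_isometries A g -> proper_isometries A (invmx g).
Proof.
by move=> [? /= dg]; split; [exact: isomV|rewrite /= det_inv dg invr1].
Qed.

Lemma isom_det g : A \in unitmx -> isometries A g -> \det g = 1 \/ \det g = -1.
Proof.
move=> AU /isom_mx /(congr1 (fun B => \det B)); rewrite !det_mulmx det_tr => E.
have dA : \det A != 0 by rewrite -unitfE -unitmxE.
have /eqP : (\det g) ^+ 2 = 1.
  by apply: (mulIf dA); rewrite mul1r -[RHS]E expr2; ring.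
by rewrite sqrf_eq1 => /orP[]/eqP->; [left|right].
Qed.

(** The block matrix with rows (1, a) and (b, 1) has two block-triangular factorizations; comparing
    their determinants gives the identity. *)
Lemma det_rank1_update (a : 'rV[F]_n) (b : 'cV[F]_n) :
  \det (1%:M - b *m a) = 1 - (a *m b) 0 0.
Proof.
have E1 : block_mx (1%:M : 'M_1) a b 1%:M =
    block_mx (1%:M : 'M_1) 0 b 1%:M *m block_mx 1%:M a 0 (1%:M - b *m a).
  rewrite mulmx_block ?mulmx1 ?mul1mx ?mul0mx ?mulmx0 ?mulmx1 ?addr0.
  by rewrite addrCA subrr addr0.
have E2 : block_mx (1%:M : 'M_1) a b 1%:M =
    block_mx (1%:M : 'M_1) a 0 1%:M *m block_mx (1%:M - a *m b) 0 b 1%:M.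
  rewrite mulmx_block ?mulmx1 ?mul1mx ?mul0mx ?mulmx0 ?add0r.
  by rewrite subrK.
have := congr1 (fun B => \det B) (etrans (esym E1) E2).
rewrite !det_mulmx !det_lblock !det_ublock !det1 !mul1r !mulr1 => ->.
by rewrite det_mx11 !mxE eqxx.
Qed.

(** Written as a rank-one update of the identity, so that [det_rank1_update] yields its determinant;
    [reflectionE] recovers the usual formula. *)
Definition reflection y : 'M[F]_n := 1%:M - (A *m y^T) *m ((2 / quad A y) *: y).

Lemma reflectionE y x : x *m reflection y = x - (2 * bil x y / quad A y) *: y.
Proof.
rewrite mulmxBr mulmx1 !mulmxA [x *m A *m y^T]mx11_scalar -/(bil x y).
rewrite mul_scalar_mx scalerA; congr (_ - _ *: _).
by rewrite mulrCA mulrA.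
Qed.

Lemma reflectionK y : quad A y != 0 -> reflection y *m reflection y = 1%:M.
Proof.
move=> y0; apply/row_matrixP => i; rewrite rowE mulmxA !reflectionE !rowE mulmx1.
rewrite bilBl bilZl -quadE.
rewrite -addrA -opprD -scalerDl [X in X *: y](_ : _ = 0) ?scale0r ?subr0//.
by field.
Qed.

Lemma reflection_isom y : quad A y != 0 -> isometries A (reflection y).
Proof.
move=> y0; split; first by have [] := mulmx1_unit (reflectionK y0).
move=> x; rewrite reflectionE quadE bilBl !bilBr !bilZl !bilZr (bilC y x) -!quadE.
by field.
Qed.

Lemma det_reflection y : quad A y != 0 -> \det (reflection y) = -1.
Proof.
move=> y0; rewrite /reflection det_rank1_update mulmxA -!scalemxAl mxE -/(bil y y) -quadE.
by field.
Qed.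

End Forms.

(** * Lattices as spans over a subring of coefficients *)

Section Spans.
Variables (F : fieldType) (n : nat).
Implicit Types (x y : 'rV[F]_n) (g M N : 'M[F]_n) (S : set F) (X Y : set 'rV[F]_n).

(** A predicate on sets, so that [Zint] in Q and [Zp_in p] in Q_p are served by the same lemmas. *)
Record subring S : Prop := Subring {
  sub_1 : S 1; sub_B : forall a b, S a -> S b -> S (a - b);
  sub_M : forall a b, S a -> S b -> S (a * b) }.

Lemma sub_0 S : subring S -> S 0.
Proof. by move=> sS; rewrite -(subrr 1); apply: (sub_B sS); apply: sub_1. Qed.
Lemma sub_N S a : subring S -> S a -> S (- a).
Proof. by move=> sS Sa; rewrite -sub0r; apply: (sub_B sS) => //; apply: sub_0. Qed.
Lemma sub_D S a b : subring S -> S a -> S b -> S (a + b).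
Proof. by move=> sS Sa Sb; rewrite -[b]opprK; apply: (sub_B sS) => //; apply: sub_N. Qed.
Lemma sub_sum S (I : Type) (r : seq I) (P : pred I) (f : I -> F) : subring S ->
  (forall i, P i -> S (f i)) -> S (\sum_(i <- r | P i) f i).
Proof.
by move=> sS Sf; elim/big_rec: _ => [|i a Pi Sa]; [exact: sub_0|exact: sub_D (Sf _ Pi) Sa].
Qed.
Lemma sub_prod S (I : Type) (r : seq I) (P : pred I) (f : I -> F) : subring S ->
  (forall i, P i -> S (f i)) -> S (\prod_(i <- r | P i) f i).
Proof.
by move=> sS Sf; elim/big_rec: _ => [|i a Pi Sa]; [exact: sub_1|exact: (sub_M sS) (Sf _ Pi) Sa].
Qed.
Lemma sub_nat S m : subring S -> S m%:R.
Proof.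
by move=> sS; elim: m => [|m IH]; [exact: sub_0|rewrite -natr1; apply: sub_D => //; exact: sub_1].
Qed.
Lemma sub_int S (z : int) : subring S -> S z%:~R.
Proof.
move=> sS; case: z => m; first exact: sub_nat.
by rewrite NegzE mulrNz; apply: sub_N => //; apply: sub_nat.
Qed.
Lemma sub_X S a m : subring S -> S a -> S (a ^+ m).
Proof.
by move=> sS Sa; elim: m => [|m IH]; [exact: sub_1|rewrite exprS; exact: (sub_M sS)].
Qed.
Lemma sub_mulmx S m p q (B : 'M[F]_(m, p)) (C : 'M[F]_(p, q)) : subring S ->
  (forall i j, S (B i j)) -> (forall i j, S (C i j)) ->
  forall i j, S ((B *m C) i j).
Proof.
by move=> sS SB SC i j; rewrite mxE; apply: sub_sum => // k _; apply: (sub_M sS).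
Qed.
Lemma sub_det S m (B : 'M[F]_m) : subring S -> (forall i j, S (B i j)) -> S (\det B).
Proof.
move=> sS SB; apply: sub_sum => // s _; apply: (sub_M sS).
  by apply: sub_X => //; apply: sub_N => //; apply: sub_1.
exact: sub_prod.
Qed.
Lemma sub_invmx S m (B : 'M[F]_m) : subring S -> (forall i j, S (B i j)) ->
  S (\det B)^-1 -> B \in unitmx -> forall i j, S (invmx B i j).
Proof.
move=> sS SB Sd BU i j; rewrite /invmx BU !mxE /cofactor.
apply: (sub_M sS) => //; apply: (sub_M sS).
  by apply: sub_X => //; apply: sub_N => //; apply: sub_1.
by apply: sub_det => // k l; rewrite !mxE.
Qed.

Lemma row_spanP S M x : M \in unitmx ->
  row_span S M x <-> forall i, S ((x *m invmx M) 0 i).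
Proof.
move=> MU; split; first by case=> a /= Sa <- i; rewrite mulmxK.
by move=> H; exists (x *m invmx M) => //=; rewrite mulmxKV.
Qed.

Definition zsubmod X := X 0 /\ forall x y, X x -> X y -> X (x - y).

Lemma zsubmodN X x : zsubmod X -> X x -> X (- x).
Proof. by move=> [X0 XB] Xx; rewrite -sub0r; apply: XB. Qed.
Lemma zsubmodD X x y : zsubmod X -> X x -> X y -> X (x + y).
Proof. by move=> sX Xx Xy; rewrite -[y]opprK; apply: sX.2 => //; apply: zsubmodN. Qed.

Lemma row_span0 S M : subring S -> row_span S M 0.
Proof. by move=> sS; exists 0; rewrite ?mul0mx// => i /=; rewrite mxE; apply: sub_0. Qed.
Lemma row_spanB S M x y : subring S ->
  row_span S M x -> row_span S M y -> row_span S M (x - y).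
Proof.
move=> sS [a /= Sa <-] [b /= Sb <-]; exists (a - b); last by rewrite mulmxBl.
by move=> i; rewrite !mxE; apply: (sub_B sS).
Qed.
Lemma row_span_zsub S M : subring S -> zsubmod (row_span S M).
Proof. by move=> sS; split; [exact: row_span0|move=> x y; exact: row_spanB]. Qed.
Lemma row_spanD S M x y : subring S ->
  row_span S M x -> row_span S M y -> row_span S M (x + y).
Proof. by move=> sS; apply: zsubmodD; apply: row_span_zsub. Qed.
Lemma row_spanZ S M t x : subring S ->
  S t -> row_span S M x -> row_span S M (t *: x).
Proof.
move=> sS St [a /= Sa <-]; exists (t *: a); last by rewrite -scalemxAl.
by move=> i; rewrite !mxE; apply: (sub_M sS).
Qed.
Lemma row_span_row S M i : subring S -> row_span S M (row i M).
Proof.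
move=> sS; exists (delta_mx 0 i); last by rewrite -rowE.
by move=> j /=; rewrite !mxE; apply: sub_nat.
Qed.

(** Every statement about isometries of shifted lattices is reduced by this to an isometry of the
    lattices and one congruence for the shifts. *)
Lemma maps_translate X Y w v g : zsubmod X -> zsubmod Y -> g \in unitmx ->
  maps_onto (translate X w) (translate Y v) g <->
  (forall x, X x <-> Y (x *m g)) /\ Y (w *m g - v).
Proof.
move=> sX sY gU; split.
  move=> E.
  have t x : X x -> Y (x *m g + w *m g - v).
    move=> Xx; have : translate Y v ((x + w) *m g).
      by rewrite -E; exists (x + w) => //; exists x.
    by case=> y Yy e; rewrite -mulmxDl -e addrK.
  have t0 : Y (w *m g - v) by have := t 0 sX.1; rewrite mul0mx add0r.
  split=> // x; split=> [Xx|Yx].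
    rewrite -[x *m g](_ : x *m g + w *m g - v - (w *m g - v) = _).
      exact: sY.2 (t _ Xx) t0.
    by rewrite opprB addrA subrK addrK.
  have : translate Y v (x *m g + (w *m g - v) + v).
    by exists (x *m g + (w *m g - v)) => //; apply: zsubmodD.
  rewrite -E => -[_ [z Xz <-]].
  rewrite addrA subrK -mulmxDl => /(can_inj (mulmxK gU)) /addIr <- //.
move=> [H H0]; rewrite /maps_onto /=; apply/seteqP; split.
  move=> _ [_ [x Xx <-] <-]; exists (x *m g + (w *m g - v)).
    by apply: zsubmodD => //; apply/H.
  by rewrite addrA subrK mulmxDl.
move=> _ [y Yy <-]; exists ((y + v) *m invmx g); last by rewrite mulmxKV.
exists ((y + v) *m invmx g - w); last by rewrite subrK.
apply/H; rewrite mulmxBl mulmxKV//.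
by rewrite -addrA -opprB; apply: sY.2.
Qed.

(** The base change matrices in both directions have coefficients in S. In this form the condition
    survives localization, bounds automorphisms and can be fed to determinants. *)
Lemma row_span_maps S M N g : subring S -> M \in unitmx -> N \in unitmx ->
  g \in unitmx ->
  (forall x, row_span S M x <-> row_span S N (x *m g)) <->
  ((forall i j, S ((M *m g *m invmx N) i j)) /\
   (forall i j, S ((N *m invmx g *m invmx M) i j))).
Proof.
move=> sS MU NU gU; split.
  move=> H; split=> i j.
    have /H /(row_spanP _ _ NU) := row_span_row M i sS.
    by move=> /(_ j); rewrite -!mulmxA -row_mul mxE.
  have : row_span S M (row i N *m invmx g).
    by apply/H; rewrite mulmxKV//; apply: row_span_row.
  by move=> /(row_spanP _ _ MU) /(_ j); rewrite -!mulmxA -row_mul mxE.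
move=> [H1 H2] x; split.
  move=> /(row_spanP _ _ MU) Hx; apply/(row_spanP _ _ NU) => i.
  have -> : x *m g *m invmx N = (x *m invmx M) *m (M *m g *m invmx N).
    by rewrite !mulmxA mulmxKV.
  by apply: sub_mulmx => // k l; rewrite (ord1 k).
move=> /(row_spanP _ _ NU) Hx; apply/(row_spanP _ _ MU) => i.
have -> : x *m invmx M = (x *m g *m invmx N) *m (N *m invmx g *m invmx M).
  by rewrite !mulmxA mulmxKV// mulmxK.
by apply: sub_mulmx => // k l; rewrite (ord1 k).
Qed.

Lemma row_span_maps_det S M N g : subring S -> M \in unitmx -> N \in unitmx ->
  g \in unitmx -> \det g = 1 \/ \det g = -1 ->
  (forall x, row_span S M x <-> row_span S N (x *m g)) ->
  S (\det M / \det N) /\ S (\det N / \det M).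
Proof.
move=> sS MU NU gU pm /(row_span_maps sS MU NU gU)[/(sub_det sS) + /(sub_det sS)].
rewrite !det_mulmx !det_inv; case: pm => ->; first by rewrite invr1 !mulr1.
by rewrite invrN1 !mulrN1 !mulNr => /(sub_N sS) + /(sub_N sS); rewrite !opprK.
Qed.

End Spans.

(** * The p-adic numbers *)

Section PadicIntegers.
Variable p : prime_nat.
Local Notation R := (padic_int p).
Implicit Types f g s t : R.

Lemma prime_nat_gt0 : (0 < p)%N.
Proof. exact: prime_gt0 (prime_valP p). Qed.
Lemma prime_nat_gt1 : (1 < p)%N.
Proof. exact: prime_gt1 (prime_valP p). Qed.
Local Hint Resolve prime_nat_gt0 prime_nat_gt1 : core.

Lemma padicDE f g k : (f + g) k = ((f k + g k) %% p ^ k)%N. Proof. by []. Qed.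
Lemma padicME f g k : (f * g) k = ((f k * g k) %% p ^ k)%N. Proof. by []. Qed.
Lemma padic0E k : (0 : R) k = 0%N. Proof. exact: mod0n. Qed.
Lemma padic_natE m k : (m%:R : R) k = (m %% p ^ k)%N.
Proof.
elim: m => [|m IH]; first by rewrite mod0n padic0E.
rewrite -natr1 padicDE IH -[X in ((_ + X) %% _)%N]/(1 %% p ^ k)%N.
by rewrite modnDm addn1.
Qed.
Lemma padic_lt f k : (f k < p ^ k)%N.
Proof. by rewrite -padic_mod ltn_mod expn_gt0 prime_nat_gt0. Qed.

(** The quotient modulo p^j requires f modulo p^(j + k): its components are [f (j + k) %/ p ^ k]. *)
Lemma padic_dvdP f k : f k = 0%N -> exists g, f = p%:R ^+ k * g.
Proof.
move=> fk0.
have dv j : (p ^ k %| f (j + k))%N by rewrite /dvdn addnC padic_modD fk0.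
have pk0 : (0 < p ^ k)%N by rewrite expn_gt0 prime_nat_gt0.
have hh j : (f (j.+1 + k) %/ p ^ k = f (j + k) %/ p ^ k %[mod p ^ j])%N.
  apply/eqP; rewrite -(eqn_modDr 0) !addn0.
  have : (f (j.+1 + k) == f (j + k) %[mod p ^ (j + k)])%N.
    by rewrite addSn padicS.
  by rewrite expnD mulnC -{1}(divnK (dv j)) -{1}(divnK (dv j.+1))
    ![(_ %/ _ * _)%N]mulnC -!muln_modr eqn_mul2l -[(p ^ k == 0)%N]negbK -lt0n pk0.
exists (padic_of hh); apply: padic_ext => j.
rewrite -natrX padicME padic_natE /= modnMm mulnC divnK//.
by rewrite padic_modD.
Qed.

(* [f k = g k] is congruence modulo p^k, so the hypothesis says that [Phi]
   contracts by a factor 1/p. *)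
Lemma padic_fixpoint (Phi : R -> R) :
  (forall f g k, f k = g k -> (Phi f) k.+1 = (Phi g) k.+1) ->
  exists s, Phi s = s.
Proof.
(* The iterates from 0 stabilize digit by digit: [x j] is correct modulo p^j, so the diagonal
   [(x k) k] defines the fixed point. *)
move=> con; pose x j := iter j Phi 0.
have xS j : (x j.+1) j = (x j) j.
  elim: j => [|j IH]; last exact: con IH.
  have e (f : R) : f 0%N = 0%N by have := padic_lt f 0; case: (f 0%N).
  by rewrite !e.
have hh k : (x k.+1) k.+1 = (x k) k %[mod p ^ k].
  by rewrite padicS xS.
exists (padic_of hh); apply: padic_ext => -[|k].
  by rewrite [LHS]padicE [RHS]padicE !modn1.
rewrite (_ : (Phi (padic_of hh)) k.+1 = (x k.+1) k.+1) /= ?padic_mod//.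
by apply: con; rewrite /= padic_mod.
Qed.

(** Multiplication by p gains one digit; this is what makes the maps passed to [padic_fixpoint]
    contract. *)
Lemma padic_eq_pmul f g k : f k = g k -> (p%:R * f : R) k.+1 = (p%:R * g : R) k.+1.
Proof.
move=> e; rewrite !padicME padic_natE.
have [k0|k0] := posnP k; first by rewrite k0 expn1 modnn !mul0n.
have pk : (p < p ^ k.+1)%N by rewrite -{1}(expn1 p) ltn_exp2l.
by rewrite (modn_small pk) expnS -!muln_modr -!padicE e.
Qed.

Lemma padic_eqD f g f' g' k : f k = g k -> f' k = g' k -> (f + f') k = (g + g') k.
Proof. by move=> e e'; rewrite !padicDE e e'. Qed.
Lemma padic_eqM f g f' g' k : f k = g k -> f' k = g' k -> (f * f') k = (g * g') k.
Proof. by move=> e e'; rewrite !padicME e e'. Qed.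
Lemma padic_eqP f g k : f k = g k <-> exists h, f - g = p%:R ^+ k * h.
Proof.
split=> [e|[h e]].
  apply: padic_dvdP; rewrite -(padic0E k) -(subrr g).
  exact: padic_eqD.
rewrite -[f](subrK g) e -natrX padicDE padicME padic_natE modnn mul0n mod0n.
by rewrite add0n padic_mod.
Qed.

Lemma padic_unitP f : f 1%N != 0%N -> f \is a GRing.unit.
Proof.
move=> f1.
have cop : coprime (f 1%N) p.
  rewrite coprime_sym prime_coprime ?prime_valP// gtnNdvd ?lt0n//.
  by have := padic_lt f 1; rewrite expn1.
have [m mf] : exists m, (m * f 1%N = 1 %[mod p])%N.
  have [[m l] /= ml] := coprimeP p (etrans (lt0n _) f1 : (0 < f 1%N)%N) cop.
  exists m; have -> : (m * f 1%N = l * p + 1)%N.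
    by move: ml; set a := (m * _)%N; set b := (l * _)%N; lia.
  by rewrite modnMDl.
have [g mfg] : exists g, m%:R * f - 1 = p%:R ^+ 1 * g.
  apply/padic_eqP; rewrite padicME padic_natE expn1 modnMml mf.
  by have := padic_natE 1 1; rewrite expn1.
(* With m f = 1 + p g, a fixed point s satisfies s (1 + p g) = 1. *)
have [|s sE] := @padic_fixpoint (fun s => 1 + p%:R * (- g * s)).
  by move=> a b k e; apply: padic_eqD => //; apply: padic_eq_pmul; apply: padic_eqM.
apply/unitrP; exists (s * m%:R).
suff e : s * m%:R * f = 1 by split; rewrite // mulrC.
rewrite -mulrA -[m%:R * f](subrK 1) mfg expr1 mulrDr mulr1 -{2}sE; ring.
Qed.

Lemma padic_local f : f \is a GRing.unit \/ exists g, f = p%:R * g.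
Proof.
have [f1|f1] := eqVneq (f 1%N) 0%N; last by left; apply: padic_unitP.
by right; have [g ->] := padic_dvdP f1; exists g; rewrite expr1.
Qed.

Lemma padic_val f : f != 0 -> exists k e, e \is a GRing.unit /\ f = p%:R ^+ k * e.
Proof.
move=> f0.
have ex : exists k, f k != 0%N.
  apply: contrapT => H; move/eqP: f0; apply; apply: padic_ext => k.
  by rewrite padic0E; apply/eqP/negPn/negP => fk; apply: H; exists k.
(* As [f 0] is always 0, the least index of a nonzero component is the valuation plus one. *)
case: (ex_minnP ex) => -[|k] fk min.
  by have := padic_lt f 0; rewrite expn0; case: (f 0%N) fk.
have /padic_dvdP[e fe] : f k = 0%N.
  by apply/eqP/negPn/negP => /min; rewrite ltnn.
exists k, e; split=> //; have [//|[h eh]] := padic_local e.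
case/eqP: fk; rewrite fe eh mulrA -exprSr -natrX padicME padic_natE modnn mul0n.
by rewrite mod0n.
Qed.

Lemma padic_nat_unit m : ~~ (p %| m)%N -> (m%:R : R) \is a GRing.unit.
Proof. by move=> pm; apply: padic_unitP; rewrite padic_natE expn1. Qed.

Lemma padic_nat_eq0 m : (m%:R == 0 :> R) = (m == 0)%N.
Proof.
apply/eqP/eqP => [/(congr1 (fun f : R => f m))|->//].
by rewrite padic_natE padic0E modn_small// ltn_expl.
Qed.

(** A root is a fixed point of s -> b^-1 t - p b^-1 q s^2, which contracts because of the factor
    p. *)
Lemma padic_hensel (b q t : R) : b \is a GRing.unit ->
  exists s, b * s + p%:R * q * s ^+ 2 = t.
Proof.
move=> bU.
have [|s sE] := @padic_fixpoint (fun s => b^-1 * t + p%:R * (- (b^-1 * q) * (s * s))).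
  move=> a c k e; apply: padic_eqD => //; apply: padic_eq_pmul.
  by apply: padic_eqM => //; apply: padic_eqM.
exists s; have bb : b * b^-1 = 1 by rewrite mulrV.
rewrite -[in b * s]sE (_ : b * _ = b * b^-1 * (t - p%:R * q * s ^+ 2)); last by ring.
by rewrite bb; ring.
Qed.

End PadicIntegers.

(** * The rational numbers in a field of characteristic 0 *)

Section RatrChar0.
Variable F : fieldType.
Hypothesis F0 : forall z : int, (z%:~R == 0 :> F) = (z == 0).

Lemma ratr_eq (q : rat) (a b : int) : b != 0 -> q * b%:~R = a%:~R ->
  ratr q = a%:~R / b%:~R :> F.
Proof.
move=> b0 qb; have E : numq q * b = a * denq q.
  by apply: (@intr_inj rat); rewrite !intrM numqE mulrAC qb.
have bk : (b%:~R : F) != 0 by rewrite F0.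
have dk : ((denq q)%:~R : F) != 0 by rewrite F0 denq_neq0.
by apply: (mulIf bk); rewrite divfK// /ratr mulrAC -intrM E intrM mulfK.
Qed.

Lemma ratr_frac (a b : int) : b != 0 -> ratr (a%:~R / b%:~R : rat) = a%:~R / b%:~R :> F.
Proof. by move=> b0; apply: ratr_eq; rewrite // divfK// intr_eq0. Qed.

Lemma ratr_zmod_char0 : zmod_morphism (@ratr F).
Proof.
move=> x y; rewrite -[in LHS](divq_num_den x) -[in LHS](divq_num_den y).
have dx : denq x != 0 := denq_neq0 x; have dy : denq y != 0 := denq_neq0 y.
rewrite -mulNr addf_div ?intr_eq0// -mulrNz -!intrM -intrD ratr_frac ?mulf_neq0//.
rewrite /ratr -mulNr addf_div ?F0//.
by rewrite intrD !intrM mulrNz.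
Qed.

Lemma ratr_monoid_char0 : monoid_morphism (@ratr F).
Proof.
split=> [|x y]; first by rewrite /ratr divr1.
rewrite -[in LHS](divq_num_den x) -[in LHS](divq_num_den y).
rewrite mulf_div -!intrM ratr_frac ?mulf_neq0 ?denq_neq0//.
by rewrite /ratr mulf_div -!intrM.
Qed.

Lemma ratr_absdenq (q : rat) : ratr q = (numq q)%:~R / (`|denq q|%N)%:R :> F.
Proof. by rewrite /ratr -{1}[denq q]gez0_abs ?denq_ge0. Qed.

Lemma numq_absdenq (q : rat) : (numq q)%:~R = (`|denq q|%N)%:R * ratr q :> F.
Proof.
have d0 : (`|denq q|%N)%:R != 0 :> F.
  by rewrite pmulrn F0 gez0_abs ?denq_ge0 ?denq_neq0.
by rewrite ratr_absdenq mulrC divfK.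
Qed.

End RatrChar0.

(** * Z_p as a valuation ring in Q_p *)

Section PadicField.
Variable p : prime_nat.
Local Notation R := (padic_int p).
Local Notation K := (padic p).
Local Notation tofrac := (@FracField.tofrac (padic_int p)).
Local Notation Zp := (Zp_in p).
Implicit Types x y z : K.

Lemma Zp_subring : subring Zp.
Proof.
split; first by exists 1; rewrite // rmorph1.
  by move=> _ _ [a _ <-] [b _ <-]; exists (a - b); rewrite // rmorphB.
by move=> _ _ [a _ <-] [b _ <-]; exists (a * b); rewrite // rmorphM.
Qed.
Let sZ := Zp_subring.
Local Hint Resolve Zp_subring : core.

Lemma padic_field_char0 m : (m%:R == 0 :> K) = (m == 0)%N.
Proof. by rewrite -(rmorph_nat tofrac) tofrac_eq0 padic_nat_eq0. Qed.

Lemma padic_field_int_eq0 (z : int) : (z%:~R == 0 :> K) = (z == 0).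
Proof.
case: z => m; first exact: padic_field_char0.
by rewrite NegzE mulrNz !oppr_eq0; exact: (padic_field_char0 m.+1).
Qed.

Lemma padic_two_neq0 : (2 : K) != 0. Proof. by rewrite padic_field_char0. Qed.
Lemma padic_p_neq0 : (p%:R : K) != 0.
Proof. by rewrite padic_field_char0 -lt0n prime_nat_gt0. Qed.
Local Hint Resolve padic_p_neq0 : core.

Lemma Zp_multiplesP k z : Zp_multiples p k z <-> Zp (z / p%:R ^+ k).
Proof.
have pk : (p%:R : K) ^+ k != 0 by rewrite expf_neq0.
split=> [[a Za <-]|Zz]; first by rewrite mulrC mulKf.
by exists (z / p%:R ^+ k) => //; rewrite mulrC divfK.
Qed.

Lemma Zp_mult1P z : Zp_multiples p 1 z <-> exists2 a, Zp a & z = p%:R * a.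
Proof. by split=> [[a Za <-]|[a Za ->]]; exists a; rewrite ?expr1. Qed.

Lemma Zp_multB k x y : Zp_multiples p k x -> Zp_multiples p k y -> Zp_multiples p k (x - y).
Proof.
by move=> /Zp_multiplesP ? /Zp_multiplesP ?; apply/Zp_multiplesP; rewrite mulrBl; apply: (sub_B sZ).
Qed.
Lemma Zp_multMl k x y : Zp x -> Zp_multiples p k y -> Zp_multiples p k (x * y).
Proof.
by move=> ? /Zp_multiplesP ?; apply/Zp_multiplesP; rewrite -mulrA; apply: (sub_M sZ).
Qed.
Lemma Zp_multMr k x y : Zp y -> Zp_multiples p k x -> Zp_multiples p k (x * y).
Proof. by rewrite mulrC; apply: Zp_multMl. Qed.

Lemma Zp_unitP z : Zp_unit p z <-> Zp z /\ ~ Zp_multiples p 1 z.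
Proof.
split.
  move=> [a /= aU <-]; split; first by exists a.
  move=> /Zp_mult1P[_ [b _ <-]] /eqP.
  rewrite -(rmorph_nat tofrac) -rmorphM tofrac_eq => /eqP ab; move: aU.
  rewrite ab => /unitrP[c [/(congr1 (fun f : R => f 1%N)) + _]].
  rewrite mulrCA padicME padic_natE expn1 modnn mul0n mod0n.
  by rewrite -[X in _ = X -> _]/(1 %% p ^ 1)%N expn1 modn_small// prime_nat_gt1.
move=> [[a _ <-] H]; exists a => //=; have [//|[b ab]] := padic_local a.
case: H; apply/Zp_mult1P; exists (tofrac b); first by exists b.
by rewrite ab rmorphM rmorph_nat.
Qed.
Lemma Zp_unitV z : Zp_unit p z -> Zp z^-1.
Proof. by move=> [a /= aU <-]; exists a^-1; rewrite ?rmorphV. Qed.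

Lemma Zp_nat_unit m : ~~ (p %| m)%N -> Zp_unit p m%:R.
Proof. by move=> /padic_nat_unit ?; exists m%:R; rewrite ?rmorph_nat. Qed.
Lemma Zp_nat_mult k m : Zp_multiples p k m%:R <-> (p ^ k %| m)%N.
Proof.
split.
  move=> [_ [a _ <-] /eqP].
  rewrite -(rmorph_nat tofrac) -rmorphXn -(rmorph_nat tofrac) -rmorphM tofrac_eq => /eqP.
  move=> /(congr1 (fun f : R => f k)).
  by rewrite -natrX padicME !padic_natE modnn mul0n mod0n => /esym/eqP.
by move=> /dvdnP[q ->]; exists q%:R; [exact: sub_nat|rewrite natrM natrX mulrC].
Qed.
Lemma Zp_two_unit : odd p -> Zp_unit p 2.
Proof.
move=> op; apply: Zp_nat_unit; apply/negP => /dvdn_leq -/(_ isT).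
have := prime_nat_gt1 p; case: (prime_val p) op => [|[|[|]]] //.
Qed.

Lemma Zp_approx k z : Zp z -> exists m, (m < p ^ k)%N /\ Zp_multiples p k (z - m%:R).
Proof.
move=> [a _ <-]; exists (a k); split; first exact: padic_lt.
have /padic_eqP[h e] : a k = ((a k)%:R : R) k by rewrite padic_natE padic_mod.
exists (tofrac h); first by exists h.
by rewrite -(rmorph_nat tofrac (a k)) -rmorphB e rmorphM rmorphXn rmorph_nat.
Qed.

Lemma Zp_hensel b q t : Zp_unit p b -> Zp_multiples p 1 q -> Zp t ->
  exists2 s, Zp s & b * s + q * s ^+ 2 = t.
Proof.
move=> [b' /= b'U <-] /Zp_mult1P[_ [q' _ <-] ->] [t' _ <-].
have [s sE] := padic_hensel q' t' b'U.
exists (tofrac s); first by exists s.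
by rewrite -sE rmorphD !rmorphM rmorph_nat.
Qed.

(** Write z = a/b, where a and b are units times powers of p; the larger of the two exponents
    decides which alternative holds. *)
Lemma Zp_total z : Zp z \/ Zp z^-1.
Proof.
have [->|z0] := eqVneq z 0; first by left; apply: sub_0.
have [a [b [b0 zE]]] : exists a b, b != 0 /\ z = tofrac a / tofrac b.
  elim/quotW: z {z0} => r; exists (\n_r), (\d_r); split; first exact: denom_ratioP.
  have tE (c : R) : tofrac c = (\pi_K (Ratio c 1))%qT by unlock FracField.tofrac.
  have d0 : tofrac \d_r != 0 by rewrite tofrac_eq0 denom_ratioP.
  apply: (mulIf d0); rewrite divfK// !tE -[LHS]FracField.pi_mul.
  apply/eqmodP; rewrite /= FracField.equivfE /FracField.mulf !numden_Ratio ?oner_neq0 ?mulr1 ?denom_ratioP//.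
  by rewrite mulrC.
have a0 : a != 0 by apply: contraNneq z0 => a0; rewrite zE a0 rmorph0 mul0r.
have [k [e [eU ae]]] := padic_val a0; have [l [d [dU bd]]] := padic_val b0.
have H (i j : nat) (c h : R) : (j <= i)%N -> h \is a GRing.unit ->
    Zp (tofrac (p%:R ^+ i * c) / tofrac (p%:R ^+ j * h)).
  move=> ji hU; exists (p%:R ^+ (i - j) * c * h^-1) => //.
  apply/eqP; rewrite eq_sym; apply/eqP; apply: (canLR (mulfK _)).
    rewrite tofrac_eq0 mulf_eq0 negb_or expf_neq0 ?padic_nat_eq0 -?lt0n ?prime_nat_gt0//=.
    by apply: contraTneq hU => ->; rewrite unitr0.
  rewrite -rmorphM -[X in p%:R ^+ X](subnK ji) exprD; congr tofrac.
  have hh : h^-1 * h = 1 by rewrite mulVr.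
  transitivity (p%:R ^+ (i - j) * p%:R ^+ j * c * (h^-1 * h)); last by ring.
  by rewrite hh mulr1.
have [kl|/ltnW kl] := leqP l k; first by left; rewrite zE ae bd; apply: H.
by right; rewrite zE invf_div ae bd; apply: H.
Qed.

(* Unlike [ratr], this has a ring morphism structure: the library provides
   it for [ratr] only when the target is an ordered field. *)
Definition locq : rat -> K := ratr.

Lemma locq_zmod : zmod_morphism locq.
Proof. exact: ratr_zmod_char0 padic_field_int_eq0. Qed.
Lemma locq_monoid : monoid_morphism locq.
Proof. exact: ratr_monoid_char0 padic_field_int_eq0. Qed.

HB.instance Definition _ := GRing.isZmodMorphism.Build rat K locq locq_zmod.
HB.instance Definition _ := GRing.isMonoidMorphism.Build rat K locq locq_monoid.

Lemma locq_int (q : rat) : q \is a Num.int -> Zp (locq q).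
Proof. by move=> /intrP[z ->]; rewrite rmorph_int; apply: sub_int. Qed.

Lemma Zp_locqP (q : rat) : Zp (locq q) <-> ~~ (p %| `|denq q|)%N.
Proof.
set d := `|denq q|%N.
split.
  move=> Zq; apply/negP => pd.
  have nE : (numq q)%:~R = (d%:R : K) * locq q.
    exact: numq_absdenq padic_field_int_eq0 q.
  have Mn : Zp_multiples p 1 (numq q)%:~R.
    by rewrite nE; apply: Zp_multMr => //; apply/Zp_nat_mult; rewrite expn1.
  have pn : (p %| `|numq q|)%N.
    move: Mn; case: (numq q) => m; first by move=> /Zp_nat_mult; rewrite expn1.
    rewrite NegzE mulrNz => /(@Zp_multMl 1 (-1)); rewrite mulN1r opprK => H.
    by rewrite abszN; have /Zp_nat_mult := H (sub_N sZ (sub_1 sZ)); rewrite expn1.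
  have := coprime_num_den q; rewrite /coprime -/d => /eqP g1.
  by have := dvdn_gcd p `|numq q| d; rewrite pn pd g1 dvdn1 gtn_eqF ?prime_nat_gt1.
move=> pd; rewrite /locq ratr_absdenq; apply: (sub_M sZ); first exact: sub_int.
exact/Zp_unitV/Zp_nat_unit.
Qed.

End PadicField.

(** A denominator other than 1 has a prime divisor p, and then q is not in Z_p. Applied to
    coordinates, this makes membership in a lattice a local property. *)
Lemma rat_int_local (q : rat) :
  q \is a Num.int <-> forall p, Zp_in p (locq p q).
Proof.
split=> [qi p|H]; first exact: locq_int.
have d1 : `|denq q|%N = 1%N.
  apply/eqP/negPn/negP => d1.
  have pp : prime (pdiv `|denq q|).
    by rewrite pdiv_prime// ltn_neqAle eq_sym d1 absz_gt0 denq_neq0.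
  by have /Zp_locqP := H (PrimeNat pp); rewrite /= pdiv_dvd.
rewrite Qint_def; apply/eqP.
by rewrite -[denq q]gez0_abs ?denq_ge0// d1.
Qed.

(** * Hermite reduction *)

Definition posdef_int n (G : 'M[int]_n) := G^T = G /\
  forall x : 'rV[int]_n, x != 0 -> 0 < (x *m G *m x^T) 0 0.

Section IntReduction.
Implicit Types n : nat.

Lemma posdef_conj n (G U : 'M[int]_n) : U \in unitmx -> posdef_int G ->
  posdef_int (U *m G *m U^T).
Proof.
move=> UU [Gs Gp]; split; first by rewrite !trmx_mul trmxK Gs mulmxA.
move=> x x0; rewrite !mulmxA -mulmxA -trmx_mul; apply: Gp.
by apply: contraNneq x0 => /(congr1 (mulmx^~ (invmx U))); rewrite mulmxK// mul0mx => ->.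
Qed.

Lemma det_conj n (G U : 'M[int]_n) : U \in unitmx -> \det (U *m G *m U^T) = \det G.
Proof.
rewrite unitmxE => /unitrP[y [_ /(congr1 absz)/eqP]].
rewrite abszM muln_eq1 => /andP[/eqP d1 _]; rewrite !det_mulmx det_tr mulrC mulrA -expr2.
by rewrite -real_normK ?num_real// -abszE d1 expr1n mul1r.
Qed.

Lemma posdef_diag n (G : 'M[int]_n) i : posdef_int G -> 0 < G i i.
Proof.
move=> [_ /(_ (delta_mx 0 i))]; rewrite -rowE trmx_delta -colE !mxE; apply.
by apply/eqP => /matrixP /(_ 0 i); rewrite !mxE !eqxx.
Qed.

Lemma centered_rem (a e : int) : 0 < a -> exists s, `|2 * (a * s + e)| <= a.
Proof.
move=> a0; exists (- ((2 * e + a) %/ (2 * a))%Z).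
have a2 : 2 * a != 0 by lia.
have := divz_eq (2 * e + a) (2 * a); have := modz_ge0 (2 * e + a) a2.
have := ltz_pmod (2 * e + a) (_ : 0 < 2 * a).
set q := (_ %/ _)%Z; set r := (_ %% _)%Z => /(_ ltac:(lia)) r1 r0 E.
have -> : 2 * (a * - q + e) = r - a.
  have -> : 2 * (a * - q + e) = 2 * e + a - q * (2 * a) - a by ring.
  by rewrite E; ring.
by rewrite ler_norml; move: r0 r1; clear; lia.
Qed.

(* Hermite reduction: after minimising the corner entry [a] of the Gram matrix
   [a, b; b^T, D], reduce the projected form [aD - b^T b] by induction, then
   size-reduce [b] so that each [D i i] is at most [2/a] times the corresponding
   projected entry. *)
Lemma hermite_reduction n : exists gam : int, 0 < gam /\
  forall G : 'M[int]_n, posdef_int G ->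
  exists U, U \in unitmx /\ \prod_i (U *m G *m U^T) i i <= gam * \det G.
Proof.
elim: n => [|n [gam [gam0 IH]]].
  exists 1; split=> // G _; exists 1%:M; split; first exact: unitmx1.
  by rewrite big_ord0 det_mx00.
(* One factor 2 for each of the n entries [D2 i i], coming from [Dv] below. *)
exists (2 ^+ n * gam); split=> [|G Gp]; first by rewrite mulr_gt0 ?exprn_gt0.
rewrite -[n.+1]/(1 + n)%N in G Gp *.
pose P k := `[< exists U : 'M[int]_(1 + n), U \in unitmx /\ (U *m G *m U^T) 0 0 = k%:Z >].
have exP : exists k, P k.
  exists (absz (G 0 0)); apply/asboolP; exists 1%:M; rewrite unitmx1 mul1mx trmx1 mulmx1.
  by rewrite gez0_abs// ltW// posdef_diag.
case: (ex_minnP exP) => m /asboolP[U0 [U0U mE]] minm.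
set G1 := U0 *m G *m U0^T in mE.
have G1p : posdef_int G1 by apply: posdef_conj.
have G1d : \det G1 = \det G by apply: det_conj.
(* A transposition of the basis moves the i-th diagonal entry into the corner, so the minimality of
   m bounds every diagonal entry of every equivalent matrix. *)
have minG W i : W \in unitmx -> m%:Z <= (W *m G1 *m W^T) i i.
  move=> WU; have Wp := posdef_conj WU G1p.
  have := posdef_diag i Wp; rewrite -(gez0_abs (ltW (posdef_diag i Wp))) => _.
  rewrite lez_nat; apply: minm; apply/asboolP.
  exists (perm_mx (tperm 0 i) *m W *m U0); split.
    by rewrite !unitmx_mul unitmx_perm WU.
  rewrite gez0_abs ?(ltW (posdef_diag i Wp))//.
  have -> : perm_mx (tperm 0 i) *m W *m U0 *m G *m (perm_mx (tperm 0 i) *m W *m U0)^T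
    = perm_mx (tperm 0 i) *m (W *m G1 *m W^T) *m perm_mx (tperm 0 i)^-1%g.
    by rewrite !trmx_mul tr_perm_mx /G1 !mulmxA.
  by rewrite -row_permE -col_permE mxE mxE tpermL.
set a := m%:Z in mE minG.
have a0 : 0 < a by rewrite -mE posdef_diag.
pose b := ursubmx G1; pose D := drsubmx G1.
have G1E : G1 = block_mx a%:M b b^T D.
  rewrite -[LHS]submxK -/b -/D [ulsubmx _]mx11_scalar; congr block_mx.
    congr (_%:M); rewrite -mE [LHS]mxE [LHS]mxE; congr (fun_of_matrix G1 _ _); exact: val_inj.
  by rewrite /b trmx_ursub G1p.1.
have Ds : D^T = D by rewrite /D trmx_drsub G1p.1.
(* The Gram matrix of the projection orthogonal to the first basis vector, multiplied by a so that
   it stays integral. *)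
pose G' := a *: D - b^T *m b.
have G'p : posdef_int G'.
  split; first by rewrite /G' linearB /= linearZ /= Ds trmx_mul trmxK.
  move=> x x0; pose be := (x *m b^T) 0 0.
  have be1 : x *m b^T = be%:M by rewrite [LHS]mx11_scalar.
  have be2 : b *m x^T = be%:M by rewrite -[RHS]tr_scalar_mx -be1 trmx_mul trmxK.
  (* The vector a x - [be] e, with e the first basis vector, is orthogonal to e, and its norm is a
     times the value of [G'] at x. *)
  have y0 : row_mx (- be)%:M (a *: x) != 0 :> 'rV_(1 + n).
    apply: contraNneq x0 => /(congr1 rsubmx); rewrite row_mxKr linear0 => /rowP ax.
    apply/eqP/rowP => i; have := ax i; rewrite !mxE => /eqP.
    by rewrite mulf_eq0 gt_eqF//= => /eqP.
  have := G1p.2 _ y0; rewrite G1E mul_row_block tr_row_mx mul_row_col.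
  rewrite -scalemxAl be1 -[a *: be%:M]mul_scalar_mx -!scalar_mxM -raddfD /= mulNr (mulrC be).
  rewrite addNr mul_scalar_mx scale0r add0r linearZ /= mulmxDl -!scalemxAr -!scalemxAl.
  rewrite mul_scalar_mx -scalemxAl be2 => H.
  rewrite -(pmulr_rgt0 _ a0); apply: (lt_le_trans H).
  have e1 : x *m (b^T *m b) *m x^T = (be * be)%:M.
    by rewrite mulmxA be1 -mulmxA be2 -scalar_mxM.
  rewrite /G' mulmxBr mulmxBl e1 -scalemxAr -scalemxAl.
  rewrite le_eqVlt; apply/orP; left; apply/eqP.
  rewrite !mxE /= !mulr1n.
  set q := \sum__ _; ring.
have G'd : a ^+ n * \det G1 = a * \det G'.
  have : block_mx (1%:M : 'M_1) 0 (- b^T) (a%:M : 'M_n) *m G1 = block_mx a%:M b 0 G'.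
    rewrite G1E mulmx_block !mul1mx !mul0mx !addr0 mul_scalar_mx mul_mx_scalar.
    by rewrite scalerN addNr mulNmx mul_scalar_mx addrC.
  move=> /(congr1 (fun B => \det B)).
  by rewrite det_mulmx det_lblock det_ublock det1 mul1r !det_scalar.
have [V [VU HV]] := IH G' G'p.
pose e := b *m V^T.
have [s Hs] : exists s : 'cV[int]_n, forall i, `|2 * (a * s i 0 + e 0 i)| <= a.
  have /choice[f Hf] := fun i => centered_rem (e 0 i) a0.
  by exists (\col_i f i) => i; rewrite mxE.
pose W : 'M[int]_(1 + n) := block_mx 1%:M 0 s V.
have WU : W \in unitmx by rewrite unitmxE /W det_lblock det1 mul1r -unitmxE.
pose b2 := a *: s^T + e.
pose D2 := (a *: s + V *m b^T) *m s^T + (s *m b + V *m D) *m V^T.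
have b2T : b2^T = a *: s + V *m b^T.
  by rewrite /b2 /e linearD /= linearZ /= trmxK trmx_mul trmxK.
have G2E : W *m G1 *m W^T = block_mx a%:M b2 b2^T D2.
  rewrite G1E /W tr_block_mx trmx0 trmx1 !mulmx_block !mul1mx !mul0mx !mulmx0 !mulmx1 !addr0.
  rewrite mul_scalar_mx mul_mx_scalar; by rewrite b2T.
have VG : V *m G' *m V^T = a *: D2 - b2^T *m b2.
  rewrite b2T /b2 /D2 /e /G'.
  rewrite !(mulmxBr, mulmxBl, mulmxDl, mulmxDr) -?(scalemxAl, scalemxAr) !mulmxA.
  rewrite !scalerDr -?(scalemxAl, scalemxAr).
  set x1 := a *: (a *: _); set x2 := a *: _; set x3 := a *: _; set x4 := a *: _.
  by rewrite [x1 + x2 + _]addrA; apply/matrixP => i j; rewrite !mxE; ring.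
exists (W *m U0); split; first by rewrite unitmx_mul WU.
have -> : W *m U0 *m G *m (W *m U0)^T = W *m G1 *m W^T by rewrite trmx_mul /G1 !mulmxA.
rewrite big_split_ord big_ord1 /= -G1d.
have -> : \prod_(i < n) (W *m G1 *m W^T) (rshift 1 i) (rshift 1 i) = \prod_i D2 i i.
  by apply: eq_bigr => i _; rewrite G2E block_mxEdr.
have -> : (W *m G1 *m W^T) (lshift n 0) (lshift n 0) = a.
  by rewrite G2E block_mxEul mxE mulr1n.
have Da i : a <= D2 i i.
  by have := minG W (rshift 1 i) WU; rewrite G2E block_mxEdr.
(* Since |2 [b2] i| <= a <= [D2 i i], the square of [b2] i is at most a quarter of a * [D2 i i].
   This would even give the constant 4/3, which is rounded up to 2. *)
have Dv i : a * D2 i i <= 2 * (V *m G' *m V^T) i i.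
  have BE (X Y : 'M[int]_n) : (a *: X - Y) i i = a * X i i - Y i i by rewrite !mxE.
  have -> : (V *m G' *m V^T) i i = a * D2 i i - b2 0 i * b2 0 i.
    rewrite VG BE; congr (_ - _).
    by rewrite mxE big_ord1 [b2^T _ _]mxE.
  have := Hs i; rewrite (_ : a * s i 0 + e 0 i = b2 0 i); last by rewrite !mxE.
  have := Da i; set d := D2 i i; set be := b2 0 i => ad.
  rewrite normrM (_ : `|2| = 2 :> int)// => nb.
  have nb2 : (2 * `|be|) ^+ 2 <= a ^+ 2 by rewrite ler_sqr ?nnegrE ?mulr_ge0// ltW.
  have : a ^+ 2 <= a * d by rewrite expr2 ler_pM2l.
  move: nb2; rewrite exprMn real_normK ?num_real//; nia.
have HD : a ^+ n * \prod_i D2 i i <= 2 ^+ n * (gam * \det G').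
  rewrite -{1}(card_ord n) -prodr_const -big_split /=.
  apply: (@le_trans _ _ (\prod_i (2 * (V *m G' *m V^T) i i))).
    apply: ler_prod => i _; rewrite Dv andbT mulr_ge0 ?(ltW a0)//.
    exact: le_trans (ltW a0) (Da i).
  by rewrite big_split /= prodr_const card_ord ler_pM2l ?exprn_gt0.
rewrite -(ler_pM2l (exprn_gt0 n a0)).
rewrite [leRHS](_ : _ = a * (2 ^+ n * (gam * \det G'))).
  by rewrite mulrCA ler_pM2l.
transitivity (2 ^+ n * gam * (a ^+ n * \det G1)); first by ring.
by rewrite G'd; ring.
Qed.

(** The diagonal entries are positive integers, so each is at most their product. Off the diagonal,
    positivity at e_i + e_j and e_i - e_j gives 2 |G_ij| < G_ii + G_jj. *)
Lemma posdef_bound n (G : 'M[int]_n) (B : int) : posdef_int G ->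
  \prod_i G i i <= B -> forall i j, `|G i j| <= B.
Proof.
move=> Gp GB.
have Gd i : G i i <= B.
  apply: le_trans GB; rewrite (bigD1 i)//= ler_peMr ?(ltW (posdef_diag i Gp))//.
  by elim/big_rec: _ => // k x _ x1; rewrite mulr_ege1// -gtz0_ge1 posdef_diag.
move=> i j; have [->|ij] := eqVneq i j.
  by rewrite gtr0_norm ?posdef_diag.
have Gs : G j i = G i j by rewrite -{1}Gp.1 mxE.
have H (t : int) : t = 1 \/ t = -1 -> 0 < G i i + G j j + 2 * t * G i j.
  move=> t1; have t2 : t * t = 1 by case: t1 => ->.
  have x0 : delta_mx 0 i + t *: delta_mx 0 j != 0 :> 'rV[int]_n.
    apply/eqP => /matrixP /(_ 0 i); rewrite !mxE !eqxx (negPf ij).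
    by rewrite mulr0 addr0.
  have := Gp.2 _ x0; rewrite mulmxDl -scalemxAl -!rowE linearD /= linearZ /= !trmx_delta.
  rewrite mulmxDr -scalemxAr -!colE !mxE Gs; set x := G i i; set y := G j j; set z := G i j.
  suff -> : x + t * z + t * (z + t * y) = x + y + 2 * t * z by [].
  by transitivity (x + t * t * y + 2 * t * z); [ring|rewrite t2 mul1r].
have := H 1 (or_introl erefl); have := H (-1) (or_intror erefl).
have := Gd i; have := Gd j; rewrite ler_norml; lia.
Qed.

End IntReduction.

(** * Finiteness of automorphism groups and class numbers *)

Section Maps.
Variables (F : fieldType) (n : nat).
Implicit Types (X Y Z : set 'rV[F]_n) (g h : 'M[F]_n).

Lemma maps_onto1 X : maps_onto X X 1%:M.
Proof.
by rewrite /maps_onto /=; apply/seteqP; split=> [_ [x Xx <-]|x Xx]; rewrite ?mulmx1//; exists x; rewrite ?mulmx1.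
Qed.
Lemma maps_ontoM X Y Z g h : maps_onto X Y g -> maps_onto Y Z h -> maps_onto X Z (g *m h).
Proof.
move=> <- <-; rewrite /maps_onto /=; apply/seteqP; split=> [_ [x Xx <-]|_ [_ [x Xx <-] <-]].
  by exists (x *m g); [exists x|rewrite mulmxA].
by exists x; rewrite ?mulmxA.
Qed.
Lemma maps_ontoV X Y g : g \in unitmx -> maps_onto X Y g -> maps_onto Y X (invmx g).
Proof.
move=> gU <-; rewrite /maps_onto /=; apply/seteqP; split=> [_ [_ [x Xx <-] <-]|x Xx].
  by rewrite mulmxK.
by exists (x *m g); [exists x|rewrite mulmxK].
Qed.
End Maps.

Notation Zint := [set z : rat | z \is a Num.int].

Lemma Zint_subring : subring Zint.
Proof.
by split=> [|a b /= ? ?|a b /= ? ?]; rewrite /= ?rpred1 ?rpredB ?rpredM.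
Qed.
#[global] Hint Resolve Zint_subring Zp_subring : core.

Lemma finite_intmx m n (b : nat) :
  finite_set [set B : 'M[rat]_(m, n) |
    forall i j, B i j \is a Num.int /\ `|B i j| <= b%:R].
Proof.
pose f (N : 'M['I_(b + b).+1]_(m, n)) : 'M[rat]_(m, n) :=
  \matrix_(i, j) ((N i j : nat)%:R - b%:R).
apply: (@sub_finite_set _ _ (f @` setT)); last exact/finite_image/finite_finset.
move=> B /= HB; exists (\matrix_(i, j) inord (absz (Num.floor (B i j) + b%:Z))) => //.
apply/matrixP => i j; rewrite !mxE.
have [/intrP[z zE]] := HB i j; rewrite zE intrKfloor => zb.
have zb' : `|z| <= b%:Z by move: zb; rewrite -intr_norm -(ler_int rat).
have z0 : 0 <= z + b%:Z by move: zb'; rewrite ler_norml; lia.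
rewrite inordK; last by move: zb' z0; rewrite ler_norml; lia.
by rewrite pmulrn gez0_abs// intrD -pmulrn addrK.
Qed.

Lemma map_intr_inj m n : injective (map_mx intr : 'M[int]_(m, n) -> 'M[rat]_(m, n)).
Proof.
move=> B C /matrixP BC; apply/matrixP => i j; apply: (@intr_inj rat).
by have := BC i j; rewrite !mxE.
Qed.

Section PosDef.
Variables (n : nat) (A : 'M[rat]_n).
Hypothesis A_pos : pos_def A.
Implicit Types (S T : shifted_lattice n) (K L : zlattice n) (g h : 'M[rat]_n).

Let two0 : (2 : rat) != 0. Proof. by []. Qed.
Let Asym : A^T = A. Proof. exact: A_pos.1. Qed.

Lemma pos_def_unit : A \in unitmx.
Proof.
rewrite unitmxE unitfE; apply/negP => /det0P[v v0 vA].
by have := A_pos.2 v v0; rewrite /quad vA mul0mx mxE ltxx.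
Qed.

Lemma quad_ge0 x : 0 <= quad A x.
Proof.
have [->|/A_pos.2/ltW//] := eqVneq x 0.
by rewrite /quad !mul0mx mxE.
Qed.

Lemma cauchy_schwarz x y : bil A x y ^+ 2 <= quad A x * quad A y.
Proof.
have [->|y0] := eqVneq y 0.
  by rewrite bilC// bil0l expr0n mulr_ge0 ?quad_ge0.
have := quad_ge0 (quad A y *: x - bil A x y *: y).
have qy := A_pos.2 y y0.
rewrite quadE bilBl !bilBr !bilZl !bilZr (bilC Asym y x) -!quadE.
set q := quad A y in qy *; set r := quad A x; set b := bil A x y => H.
rewrite -subr_ge0 -(pmulr_rge0 _ qy); apply: le_trans H _.
by rewrite le_eqVlt; apply/orP; left; apply/eqP; ring.
Qed.

Lemma mem_zsub K : zsubmod (mem_lattice K).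
Proof. exact: row_span_zsub Zint_subring. Qed.

Lemma shifted_mapsP S T g : g \in unitmx ->
  maps_onto (mem_shifted S) (mem_shifted T) g <->
  (forall x, mem_lattice S.1 x <-> mem_lattice T.1 (x *m g)) /\
  mem_lattice T.1 (S.2 *m g - T.2).
Proof. by move=> gU; apply: maps_translate => //; apply: mem_zsub. Qed.

(** In the basis M an automorphism has integer entries. The vectors [y] form the dual basis, so the
    entries are pairings of images of basis vectors with [y], and Cauchy-Schwarz bounds them because
    norms are preserved. *)
Lemma orth_group_finite S : finite_set (orth_group A S).
Proof.
pose M := val S.1; have MU : M \in unitmx := valP S.1.
pose y j := (col j (invmx M))^T *m invmx A.
have yE x j : (x *m invmx M) 0 j = bil A x (y j).
  rewrite /bil /y trmx_mul trmxK trmx_inv Asym -!mulmxA [A *m _]mulmxA.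
  by rewrite mulmxV ?pos_def_unit// mul1mx colE mulmxA -colE [RHS]mxE.
pose B := \sum_i \sum_j quad A (row i M) * quad A (y j).
have [b Bb] : exists b : nat, B <= b%:R.
  have B0 : 0 <= B by do 2!apply: sumr_ge0 => ? _; rewrite mulr_ge0 ?quad_ge0.
  by exists (Num.trunc B).+1; rewrite ltW// truncnS_gt.
pose f (U : 'M[rat]_n) := invmx M *m U *m M.
apply: (@sub_finite_set _ _ (f @` _)); last exact/finite_image/(finite_intmx n n b).
move=> g [gi /(shifted_mapsP _ _ gi.1)[gS _]].
have [H _] := (row_span_maps Zint_subring MU MU gi.1).1 gS.
exists (M *m g *m invmx M); last by rewrite /f !mulmxA mulVmx// mul1mx mulmxKV.
move=> i j; split; first exact: H.
have : (M *m g *m invmx M) i j ^+ 2 <= b%:R.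
  have -> : (M *m g *m invmx M) i j = bil A (row i M *m g) (y j).
    by rewrite -yE -!row_mul [RHS]mxE.
  apply: le_trans (cauchy_schwarz _ _) _; rewrite gi.2; apply: le_trans Bb.
  have pos k l : 0 <= quad A (row k M) * quad A (y l) by rewrite mulr_ge0 ?quad_ge0.
  rewrite /B (bigD1 i)//= (bigD1 j)//= -addrA lerDl addr_ge0 ?sumr_ge0// => k _.
  exact: sumr_ge0.
have /intrP[z ->] := H i j.
rewrite -intr_norm [b%:R]pmulrn -rmorphXn /= !ler_int => zb.
apply: le_trans zb; rewrite -real_normK ?num_real//.
have [->|z0] := eqVneq z 0; first by rewrite normr0 expr0n.
by rewrite expr2 ler_peMl// -gtz0_ge1 normr_gt0.
Qed.

Lemma sorth_group_finite S : finite_set (sorth_group A S).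
Proof. by apply: sub_finite_set (orth_group_finite S) => g [[? _] ?]. Qed.

Lemma in_proper_class_refl S : in_proper_class A S S.
Proof. by exists 1%:M; split; [exact: proper_isom1|exact: maps_onto1]. Qed.
Lemma in_class_refl S : in_class A S S.
Proof. by exists 1%:M; split; [exact: isom1|exact: maps_onto1]. Qed.
Lemma in_proper_class_eq S T :
  in_proper_class A S T -> in_proper_class A S = in_proper_class A T.
Proof.
move=> [g [gi gm]]; apply/seteqP; split=> X [h [hi hm]].
  exists (invmx g *m h); split; first by apply: proper_isomM => //; apply: proper_isomV.
  exact: maps_ontoM (maps_ontoV gi.1.1 gm) hm.
by exists (g *m h); split; [exact: proper_isomM|exact: maps_ontoM gm hm].
Qed.
Lemma in_class_eq S T : in_class A S T -> in_class A S = in_class A T.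
Proof.
move=> [g [gi gm]]; apply/seteqP; split=> X [h [hi hm]].
  exists (invmx g *m h); split; first by apply: isomM => //; apply: isomV.
  exact: maps_ontoM (maps_ontoV gi.1 gm) hm.
by exists (g *m h); split; [exact: isomM|exact: maps_ontoM gm hm].
Qed.

Lemma row_span_unimodular (U : 'M[int]_n) (M : 'M[rat]_n) :
  U \in unitmx -> M \in unitmx ->
  row_span Zint (map_mx intr U *m M) = row_span Zint M.
Proof.
move=> UU MU; have zi m k (B : 'M[int]_(m, k)) i j : Zint ((map_mx intr B) i j).
  by rewrite mxE /= intr_int.
apply/seteqP; split=> _ [a /= ai <-].
  exists (a *m map_mx intr U); last by rewrite mulmxA.
  by move=> i; apply: (sub_mulmx Zint_subring) => // k l; rewrite (ord1 k); apply: ai.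
exists (a *m map_mx intr (invmx U)).
  by move=> i; apply: (sub_mulmx Zint_subring) => // k l; rewrite (ord1 k); apply: ai.
by rewrite !mulmxA -[_ *m _ *m map_mx _ U]mulmxA -map_mxM mulVmx// map_mx1 mulmx1.
Qed.

(* The Gram matrix of a Hermite-reduced basis, the sign of its determinant and
   the coordinates modulo c of c times the shift determine the proper class. *)
Lemma proper_classes_finite (delta : rat) (c : nat) : (0 < c)%N ->
  finite_set [set in_proper_class A T | T in [set T | [/\
    integral_lattice A T.1,
    \det (val T.1) = delta \/ \det (val T.1) = - delta &
    mem_lattice T.1 (c%:R *: T.2)]]].
Proof.
move=> c0; have cr : (c%:R : rat) != 0 by rewrite pnatr_eq0 -lt0n.
have [gam [gam0 red]] := hermite_reduction n.
have [b Bb] : exists b : nat, gam%:~R * (delta ^+ 2 * \det A) <= b%:R.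
  exists (Num.trunc `|gam%:~R * (delta ^+ 2 * \det A)|).+1.
  by apply: le_trans (ler_norm _) _; rewrite ltW// truncnS_gt.
pose R (d : 'M[rat]_n * bool * 'rV[rat]_n) T := exists M : 'M[rat]_n, [/\ M \in unitmx,
  row_span Zint M = mem_lattice T.1, M *m A *m M^T = d.1.1,
  \det M = (-1) ^+ d.1.2 * delta &
  mem_lattice T.1 (T.2 - c%:R^-1 *: (d.2 *m M))].
have RR d T T' : R d T -> R d T' -> in_proper_class A T T'.
  move=> [M [MU ML MG Md Mw]] [M' [M'U M'L M'G M'd M'w]].
  have gE : M *m (invmx M *m M') = M' by rewrite mulKVmx.
  have gU : invmx M *m M' \in unitmx by rewrite unitmx_mul unitmx_inv MU.
  exists (invmx M *m M'); split.
    split; last first.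
      by rewrite /= det_mulmx det_inv Md M'd -Md mulVf// -unitfE -unitmxE.
    apply: mx_isom => //; rewrite trmx_mul !mulmxA -[_ *m M' *m A]mulmxA.
    rewrite -[_ *m (M' *m A) *m _]mulmxA M'G -MG !mulmxA mulVmx// mul1mx -mulmxA.
    by rewrite trmx_inv mulmxV ?unitmx_tr// mulmx1.
  have E x : mem_lattice T.1 x <-> mem_lattice T'.1 (x *m (invmx M *m M')).
    rewrite -ML -M'L; split=> [[a Sa <-]|[a Sa aE]].
      by exists a => //; rewrite -mulmxA gE.
    exists a => //; apply: (can_inj (mulmxK gU)); rewrite -aE -mulmxA gE//.
  apply/shifted_mapsP => //; split=> //.
  move: Mw => /E; rewrite mulmxBl -scalemxAl -mulmxA gE => Mw.
  have := (mem_zsub T'.1).2 _ _ Mw M'w.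
  by rewrite opprB addrA subrK.
pose X1 := [set B : 'M[rat]_n | forall i j, B i j \is a Num.int /\ `|B i j| <= b%:R].
pose X2 := [set B : 'rV[rat]_n | forall i j, B i j \is a Num.int /\ `|B i j| <= c%:R].
(* By [RR] this set is either empty or a single proper class. *)
pose cl d := [set T' | exists2 T, R d T & in_proper_class A T T'].
apply: (@sub_finite_set _ _ (cl @` ((X1 `*` [set: bool]) `*` X2))); last first.
  apply/finite_image/finite_setX; last exact: finite_intmx.
  by apply: finite_setX; [exact: finite_intmx|exact: finite_finset].
move=> _ [T [Tint Tdet Tw] <-].
pose M := val T.1; have MU : M \in unitmx := valP T.1.
have Gi i j : (M *m A *m M^T) i j \is a Num.int.
  by rewrite -gramE// mxE; apply: Tint; apply: row_span_row.
have [G GE] : exists G : 'M[int]_n, map_mx intr G = M *m A *m M^T.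
  exists (\matrix_(i, j) Num.floor ((M *m A *m M^T) i j)); apply/matrixP => i j.
  by rewrite [LHS]mxE [X in X%:~R]mxE floorK.
have Gpd : posdef_int G.
  split.
    apply: map_intr_inj; rewrite -map_trmx GE.
    by rewrite !trmx_mul trmxK Asym mulmxA.
  move=> x x0; rewrite -(ltr_int rat).
  have -> : ((x *m G *m x^T) 0 0)%:~R = quad A (map_mx intr x *m M).
    have -> : ((x *m G *m x^T) 0 0)%:~R = map_mx (intr : int -> rat) (x *m G *m x^T) 0 0.
      by rewrite [RHS]mxE.
    by rewrite !map_mxM -map_trmx /quad trmx_mul !mulmxA -!(mulmxA (map_mx _ x)) -GE.
  apply: A_pos.2; apply: contraNneq x0 => /(congr1 (mulmx^~ (invmx M))).
  rewrite mulmxK// mul0mx => x0; apply/eqP.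
  by apply: map_intr_inj; rewrite x0 map_mx0.
have [U [UU Ub]] := red G Gpd.
pose M' := map_mx intr U *m M.
have M'U : M' \in unitmx.
  by rewrite unitmx_mul MU andbT unitmxE det_map_mx rmorph_unit// -unitmxE.
have dU : \det U = 1 \/ \det U = -1.
  move: UU; rewrite unitmxE => /unitrP[y [_ /(congr1 absz)/eqP]].
  by rewrite abszM muln_eq1 => /andP[+ _]; case: (\det U) => -[|[|k]] // _; [left|right].
have [s sE] : exists s : bool, \det M' = (-1) ^+ s * delta.
  rewrite /M' det_mulmx det_map_mx.
  by case: dU => ->; case: Tdet => ->;
    [exists false|exists true|exists true|exists false];
    rewrite ?expr0 ?expr1 ?rmorph1 ?rmorphN1 ?mul1r ?mulN1r ?opprK.
have M'L : row_span Zint M' = mem_lattice T.1 by apply: row_span_unimodular.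
have G2b i j : `|(U *m G *m U^T) i j| <= b%:Z.
  apply: posdef_bound => //; first exact: posdef_conj.
  apply: le_trans Ub _; rewrite -(ler_int rat) rmorphM /= -det_map_mx GE.
  apply: le_trans Bb; rewrite !det_mulmx det_tr ler_pM2l ?ltr0z//.
  rewrite mulrAC -expr2 le_eqVlt; apply/orP; left; apply/eqP; congr (_ * _).
  by case: Tdet => ->; rewrite ?sqrrN.
have [a0 a0i a0E] : row_span Zint M' (c%:R *: T.2) by rewrite M'L.
pose a : 'rV[rat]_n := \row_i ((Num.floor (a0 0%R i) %% c)%Z)%:~R.
have RT : R (map_mx intr (U *m G *m U^T), s, a) T.
  exists M'; split=> //=.
    by rewrite !map_mxM GE -map_trmx /M' trmx_mul !mulmxA.
  have -> : T.2 - c%:R^-1 *: (a *m M') = (c%:R^-1 *: (a0 - a)) *m M'.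
    by rewrite -scalemxAl mulmxBl a0E scalerBr scalerA mulVf// scale1r.
  rewrite -M'L; exists (c%:R^-1 *: (a0 - a)) => // i.
  rewrite /= !mxE -[a0 0 i]floorK//; last exact: a0i.
  rewrite -intrB {1}(divz_eq (Num.floor (a0 0 i)) c) intrKfloor addrK intrM.
  by rewrite [X in _^-1 * (_ * X)]/(c%:R) mulrC mulfK.
exists (map_mx intr (U *m G *m U^T), s, a); last first.
  rewrite /cl; apply/seteqP; split=> T' /=.
    move=> [T1 RT1 T1T']; have := RR _ _ _ RT RT1.
    by move=> /in_proper_class_eq ->.
  by move=> TT'; exists T.
split; first split => //=.
  move=> i j; rewrite mxE; split; first exact: intr_int.
  by rewrite -intr_norm [b%:R]pmulrn ler_int.
move=> i j; rewrite (ord1 i) mxE; split; first exact: intr_int.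
rewrite -intr_norm [c%:R]pmulrn ler_int.
have c0' : (c%:Z != 0) by rewrite eqz_nat -lt0n.
rewrite ger0_norm ?modz_ge0// ltW// ltz_pmod//.
Qed.

End PosDef.

(** * Localization *)

Lemma bil_map (F K : fieldType) (f : {rmorphism F -> K}) n (A M : 'M[F]_n)
    (a b : 'rV[K]_n) :
  bil (map_mx f A) (a *m map_mx f M) (b *m map_mx f M) =
  (a *m map_mx f (M *m A *m M^T) *m b^T) 0 0.
Proof. by rewrite /bil !map_mxM -map_trmx trmx_mul !mulmxA. Qed.

Section Localization.
Variables (n : nat) (A : 'M[rat]_n).
Hypothesis A_pos : pos_def A.
Implicit Types (S T : shifted_lattice n) (K L : zlattice n) (g h : 'M[rat]_n).
Implicit Types (p : prime_nat).

Let Asym : A^T = A. Proof. exact: A_pos.1. Qed.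
Local Notation mxp p := (map_mx (locq p)).

Lemma locE p x : loc p x = mxp p x :> 'rV[padic p]_n. Proof. by []. Qed.
Lemma loc_formE p : loc_form p A = mxp p A. Proof. by []. Qed.

Lemma loc_unitmx p g : g \in unitmx -> mxp p g \in unitmx.
Proof. by move=> gU; rewrite map_unitmx. Qed.
Lemma det_loc_div p (M N : 'M[rat]_n) :
  locq p (\det M / \det N) = \det (mxp p M) / \det (mxp p N).
Proof. by rewrite fmorph_div -(det_map_mx (locq p) M) -(det_map_mx (locq p) N). Qed.
Lemma loc_basis_unit p K : mxp p (val K) \in unitmx.
Proof. exact: loc_unitmx (valP K). Qed.
Lemma loc_form_unit p : loc_form p A \in unitmx.
Proof. exact: loc_unitmx (pos_def_unit A_pos). Qed.
Lemma loc_form_sym p : (loc_form p A)^T = loc_form p A.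
Proof. by rewrite loc_formE map_trmx Asym. Qed.
Lemma loc_latticeE p K : loc_lattice p K = row_span (Zp_in p) (mxp p (val K)).
Proof. by []. Qed.

Lemma locB p x y : loc p (x - y) = loc p x - loc p y :> 'rV[padic p]_n.
Proof. by rewrite !locE map_mxB. Qed.
Lemma locZ p t x : loc p (t *: x) = locq p t *: loc p x :> 'rV[padic p]_n.
Proof. by rewrite !locE map_mxZ. Qed.
Lemma locM p x g : loc p (x *m g) = loc p x *m mxp p g :> 'rV[padic p]_n.
Proof. by rewrite !locE map_mxM. Qed.

Lemma loc_zsub p K : zsubmod (loc_lattice p K).
Proof. exact: row_span_zsub. Qed.

Lemma loc_latticeP p K x :
  loc_lattice p K x <-> forall i, Zp_in p ((x *m invmx (mxp p (val K))) 0 i).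
Proof. exact: row_spanP (loc_basis_unit p K). Qed.

Lemma mem_lattice_local K x :
  mem_lattice K x <-> forall p, loc_lattice p K (loc p x).
Proof.
have E p i : (loc p x *m invmx (mxp p (val K))) 0 i = locq p ((x *m invmx (val K)) 0 i).
  by rewrite locE -map_invmx -map_mxM mxE.
split.
  move=> /(row_spanP _ _ (valP K)) H p; apply/loc_latticeP => i; rewrite E.
  exact/locq_int/H.
move=> H; apply/(row_spanP _ _ (valP K)) => i; apply/rat_int_local => p.
by rewrite -E; have /loc_latticeP := H p; apply.
Qed.

Lemma loc_mem p K x : mem_lattice K x -> loc_lattice p K (loc p x).
Proof. by move=> /mem_lattice_local. Qed.

Lemma loc_bil p x y : bil (loc_form p A) (loc p x) (loc p y) = locq p (bil A x y).
Proof. by rewrite /bil !locE loc_formE map_trmx -!map_mxM mxE. Qed.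
Lemma loc_quad p x : quad (loc_form p A) (loc p x) = locq p (quad A x).
Proof. exact: loc_bil. Qed.

Lemma loc_isom p g : isometries A g -> isometries (loc_form p A) (mxp p g).
Proof.
move=> gi; apply: mx_isom; last by apply: loc_unitmx gi.1.
by rewrite loc_formE map_trmx -!map_mxM isom_mx.
Qed.
Lemma loc_proper_isom p g :
  proper_isometries A g -> proper_isometries (loc_form p A) (mxp p g).
Proof.
move=> [gi /= gd]; split; first exact: loc_isom.
by rewrite /= det_map_mx gd rmorph1.
Qed.

Lemma loc_shifted_mapsP p S T (g : 'M[padic p]_n) : g \in unitmx ->
  maps_onto (loc_shifted p S) (loc_shifted p T) g <->
  (forall x, loc_lattice p S.1 x <-> loc_lattice p T.1 (x *m g)) /\
  loc_lattice p T.1 (loc p S.2 *m g - loc p T.2).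
Proof. by move=> gU; apply: maps_translate => //; apply: loc_zsub. Qed.

Lemma loc_maps p S T g : g \in unitmx ->
  maps_onto (mem_shifted S) (mem_shifted T) g ->
  maps_onto (loc_shifted p S) (loc_shifted p T) (mxp p g).
Proof.
move=> gU /(shifted_mapsP _ _ gU)[H H0].
apply/loc_shifted_mapsP; first exact: loc_unitmx.
split; last by rewrite -locM -locB; apply: loc_mem.
move: H; rewrite /mem_lattice => /(row_span_maps Zint_subring (valP S.1) (valP T.1) gU)[H1 H2].
apply/(row_span_maps (Zp_subring p) (loc_basis_unit p S.1) (loc_basis_unit p T.1)
  (loc_unitmx p gU)).
split=> i j.
  by rewrite -map_invmx -!map_mxM mxE; exact: locq_int (H1 i j).
by rewrite -!map_invmx -!map_mxM mxE; exact: locq_int (H2 i j).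
Qed.

Lemma genus_class S T T' : genus A S T -> in_class A T T' -> genus A S T'.
Proof.
move=> ST [g [gi gm]] p; have [h [hi hm]] := ST p.
exists (h *m mxp p g); split; first exact: isomM hi (loc_isom p gi).
exact: maps_ontoM hm (loc_maps p gi.1 gm).
Qed.
Lemma proper_genus_class S T T' :
  proper_genus A S T -> in_proper_class A T T' -> proper_genus A S T'.
Proof.
move=> ST [g [gi gm]] p; have [h [hi hm]] := ST p.
exists (h *m mxp p g); split; first exact: proper_isomM hi (loc_proper_isom p gi).
exact: maps_ontoM hm (loc_maps p gi.1.1 gm).
Qed.
Lemma proper_genus_refl S : proper_genus A S S.
Proof. by move=> p; exists 1%:M; split; [exact: proper_isom1|exact: maps_onto1]. Qed.
Lemma proper_genus_sub S : proper_genus A S `<=` genus A S.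
Proof. by move=> T H p; have [h [[? _] ?]] := H p; exists h. Qed.
Lemma proper_class_sub S : in_proper_class A S `<=` in_class A S.
Proof. by move=> T [h [[? _] ?]]; exists h. Qed.

Lemma loc_integral p L x y : integral_lattice A L ->
  loc_lattice p L x -> loc_lattice p L y -> Zp_in p (bil (loc_form p A) x y).
Proof.
rewrite !loc_latticeE loc_formE => Lint [a /= Za <-] [b /= Zb <-].
have Gi i j : (val L *m A *m (val L)^T) i j \is a Num.int.
  by rewrite -gramE// mxE; apply: Lint; apply: row_span_row.
rewrite bil_map; apply: (sub_mulmx (Zp_subring p)) => [i j|i j].
  rewrite (ord1 i); apply: (sub_mulmx (Zp_subring p)) => k l; first by rewrite (ord1 k).
  by rewrite mxE; apply: locq_int.
by rewrite mxE (ord1 j); exact: Zb.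
Qed.

Lemma int_pm1 (t : rat) : t != 0 -> t \is a Num.int -> t^-1 \is a Num.int ->
  t = 1 \/ t = -1.
Proof.
move=> t0 /intrP[z zE] /intrP[y yE]; have : z * y = 1.
  by apply: (@intr_inj rat); rewrite intrM -zE -yE mulfV.
move=> /(congr1 absz)/eqP; rewrite abszM muln_eq1 => /andP[+ _]; rewrite zE.
by case: z {zE} => -[|[|k]] // _; [left|right].
Qed.

(** The three conclusions are the conditions of [proper_classes_finite], and each is local. For the
    determinants, their ratio and its inverse lie in every Z_p, hence the ratio is 1 or -1. *)
Lemma genus_bounded (c : nat) S T : integral_lattice A S.1 ->
  mem_lattice S.1 (c%:R *: S.2) -> genus A S T ->
  [/\ integral_lattice A T.1,
    \det (val T.1) = \det (val S.1) \/ \det (val T.1) = - \det (val S.1) &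
    mem_lattice T.1 (c%:R *: T.2)].
Proof.
move=> Sint Sw ST; split.
- move=> x y Kx Ky; rewrite half_polar//; apply/rat_int_local => p.
  have [g [gi /(loc_shifted_mapsP _ _ gi.1)[H _]]] := ST p.
  rewrite -loc_bil -(mulmxKV gi.1 (loc p x)) -(mulmxKV gi.1 (loc p y)).
  rewrite (isom_bil (loc_form_sym p) (padic_two_neq0 p) _ _ gi).
  by apply: loc_integral Sint _ _; apply/H; rewrite mulmxKV ?gi.1//; apply: loc_mem.
- have dS : \det (val S.1) != 0 by rewrite -unitfE -unitmxE (valP S.1).
  have dT : \det (val T.1) != 0 by rewrite -unitfE -unitmxE (valP T.1).
  set t := \det (val T.1) / \det (val S.1).
  have t0 : t != 0 by rewrite mulf_neq0 ?invr_eq0.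
  have H p : Zp_in p (locq p t) /\ Zp_in p (locq p t^-1).
    have [g [gi /(loc_shifted_mapsP _ _ gi.1)[H _]]] := ST p.
    have pm := isom_det (loc_form_sym p) (padic_two_neq0 p) (loc_form_unit p) gi.
    have := row_span_maps_det (Zp_subring p) (loc_basis_unit p S.1)
      (loc_basis_unit p T.1) gi.1 pm H.
    by rewrite -!det_loc_div /t invf_div => -[].
  have [] : t = 1 \/ t = -1.
    by apply: int_pm1 => //; apply/rat_int_local => p; have [] := H p.
    by move=> e; left; rewrite -[LHS](divfK dS) -/t e mul1r.
  by move=> e; right; rewrite -[LHS](divfK dS) -/t e mulN1r.
- apply/mem_lattice_local => p.
  have [g [gi /(loc_shifted_mapsP _ _ gi.1)[H H0]]] := ST p.
  have -> : loc p (c%:R *: T.2) =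
    loc p (c%:R *: S.2) *m g - locq p c%:R *: (loc p S.2 *m g - loc p T.2).
    by rewrite !locZ scalerBr -scalemxAl opprB addrC subrK.
  apply: (loc_zsub p T.1).2; first by apply/H; apply: loc_mem.
  by apply: row_spanZ => //; rewrite rmorph_nat; apply: sub_nat.
Qed.

Lemma genus_proper_classes_finite (c : nat) S X : (0 < c)%N -> integral_lattice A S.1 ->
  mem_lattice S.1 (c%:R *: S.2) -> X `<=` genus A S ->
  finite_set [set in_proper_class A T | T in X].
Proof.
move=> c0 Sint Sw XS.
apply: sub_finite_set (proper_classes_finite A_pos (\det (val S.1)) c0).
by move=> _ [T XT <-]; exists T => //=; apply: genus_bounded Sint Sw (XS _ XT).
Qed.

(** A class is determined by any proper class inside it, so finiteness is inherited from the proper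
    classes. *)
Lemma genus_classes_finite (c : nat) S : (0 < c)%N -> integral_lattice A S.1 ->
  mem_lattice S.1 (c%:R *: S.2) ->
  finite_set [set in_class A T | T in genus A S].
Proof.
move=> c0 Sint Sw.
have := genus_proper_classes_finite c0 Sint Sw (fun _ => id).
move=> /(finite_image (fun C => [set T' | exists2 T, C T & in_class A T T'])).
apply: sub_finite_set => _ [T GT <-]; exists (in_proper_class A T); first by exists T.
apply/seteqP; split=> T' /=.
  by move=> [T1 /proper_class_sub/in_class_eq ->].
by move=> TT'; exists T => //; apply: in_proper_class_refl.
Qed.

End Localization.

(** * Lattices over a henselian ring *)

Section HenselianRings.
Variables (F : fieldType) (O : set F) (pi : F).

Definition mults (k : nat) : set F := [set pi ^+ k * z | z in O].
Definition nonmults : set F := [set z | O z /\ ~ mults 1 z].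

(* The nonzero multiples of [pi] being the nonunits of [O], the last clause is
   Hensel's lemma for quadratic polynomials with a simple root modulo [pi]. *)
Record henselian : Prop := Henselian {
  hl_sub : subring O;
  hl_pi : O pi;
  hl_inv : forall z, nonmults z -> O z^-1;
  hl_root : forall a q t, nonmults a -> mults 1 q -> O t ->
    exists2 s, O s & a * s + q * s ^+ 2 = t }.

Hypothesis hO : henselian.
Let sO := hl_sub hO.
Implicit Types x y z : F.

Lemma hl_piX k : O (pi ^+ k). Proof. exact: sub_X sO (hl_pi hO). Qed.
Lemma mults_in k z : mults k z -> O z.
Proof. by move=> [a Oa <-]; apply: (sub_M sO) Oa; apply: hl_piX. Qed.
Lemma mults1P z : mults 1 z <-> exists2 a, O a & z = pi * a.
Proof. by split=> [[a Oa <-]|[a Oa ->]]; exists a; rewrite ?expr1. Qed.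
Lemma multsB k x y : mults k x -> mults k y -> mults k (x - y).
Proof.
by move=> [a Oa <-] [c Oc <-]; exists (a - c); [exact: (sub_B sO)|rewrite mulrBr].
Qed.
Lemma multsD k x y : mults k x -> mults k y -> mults k (x + y).
Proof.
by move=> [a Oa <-] [c Oc <-]; exists (a + c); [exact: (sub_D sO)|rewrite mulrDr].
Qed.
Lemma multsMl k x y : O x -> mults k y -> mults k (x * y).
Proof. by move=> Ox [a Oa <-]; exists (x * a); [exact: (sub_M sO)|rewrite mulrCA]. Qed.
Lemma multsS k x : mults k.+1 x -> mults 1 x.
Proof.
move=> [a Oa <-]; apply/mults1P; exists (pi ^+ k * a); last by rewrite exprS mulrA.
by apply: (sub_M sO) => //; apply: hl_piX.
Qed.
Lemma nonmults_in z : nonmults z -> O z. Proof. by case. Qed.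
Lemma nonmults_neq0 z : nonmults z -> z != 0.
Proof.
move=> [_ H]; apply/eqP => z0; apply: H; apply/mults1P; exists 0; first exact: sub_0.
by rewrite z0 mulr0.
Qed.
Lemma nonmults_dich z : O z -> nonmults z \/ mults 1 z.
Proof. by move=> Oz; have [?|?] := pselect (mults 1 z); [right|left]. Qed.
Lemma nonmultsM x y : nonmults x -> nonmults y -> nonmults (x * y).
Proof.
move=> Ux Uy; split; first exact: (sub_M sO) Ux.1 Uy.1.
move=> xy; apply: Ux.2; rewrite -(mulfK (nonmults_neq0 Uy) x) mulrC.
by apply: multsMl => //; apply: (hl_inv hO).
Qed.
Lemma nonmults_addmult x y : nonmults x -> mults 1 y -> nonmults (x + y).
Proof.
move=> [Ox Nx] My; split; first exact: (sub_D sO) Ox (mults_in My).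
by move=> H; apply: Nx; rewrite -(addrK y x); apply: multsB.
Qed.
Lemma nonmultsN x : nonmults x -> nonmults (- x).
Proof.
move=> [Ox Nx]; split; first exact: sub_N.
move=> H; apply: Nx; rewrite -[x]opprK -mulN1r; apply: multsMl => //.
exact/(sub_N sO)/(sub_1 sO).
Qed.

End HenselianRings.

(** * Transitivity of local isometry groups *)

Section LocalOrbits.
Variables (F : fieldType) (O : set F) (pi : F) (n : nat) (B M : 'M[F]_n).
Local Notation LL := (row_span O M).
Local Notation U := (nonmults O pi).
Local Notation pm := (mults O pi 1).
Local Notation b := (bil B).
Local Notation Q := (quad B).
Hypothesis hO : henselian O pi.
Hypothesis Bsym : B^T = B.
Hypothesis MU : M \in unitmx.
Hypothesis Lint : forall x y, LL x -> LL y -> O (b x y).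
Hypothesis two_unit : U 2.
Implicit Types (x y z u v : 'rV[F]_n) (g h : 'M[F]_n).

Let two0 : (2 : F) != 0 := nonmults_neq0 hO two_unit.
Let sZ := hl_sub hO.
Let LB x y : LL x -> LL y -> LL (x - y) := @row_spanB _ _ _ _ _ _ sZ.
Let LD x y : LL x -> LL y -> LL (x + y) := @row_spanD _ _ _ _ _ _ sZ.
Let LZ t x : O t -> LL x -> LL (t *: x) := @row_spanZ _ _ _ _ _ _ sZ.

Definition lat_isom g := isometries B g /\ forall x, LL x <-> LL (x *m g).

Lemma lat_isomM g h : lat_isom g -> lat_isom h -> lat_isom (g *m h).
Proof.
move=> [gi gL] [hi hL]; split; first exact: isomM gi hi.
by move=> x; rewrite mulmxA -hL -gL.
Qed.
Lemma lat_isomV g : lat_isom g -> lat_isom (invmx g).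
Proof.
move=> [gi gL]; split; first exact: isomV gi.
by move=> x; rewrite (gL (x *m invmx g)) (mulmxKV gi.1).
Qed.

Lemma lat_reflection v : Q v != 0 -> LL v ->
  (forall x, LL x -> O (2 * b x v / Q v)) -> lat_isom (reflection B v).
Proof.
move=> v0 Lv H; split; first exact: (reflection_isom Bsym v0).
have S x : LL x -> LL (x *m reflection B v).
  by move=> Lx; rewrite reflectionE; apply: LB => //; apply: LZ Lv; apply: H.
move=> x; split; first exact: S.
by move=> /S; rewrite -mulmxA (reflectionK v0) mulmx1.
Qed.

Lemma lat_reflection_unit v : LL v -> U (Q v) -> lat_isom (reflection B v).
Proof.
move=> Lv Qv; apply: (lat_reflection (nonmults_neq0 hO Qv) Lv) => x Lx.
apply: (sub_M sZ); last exact: (hl_inv hO).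
by apply: (sub_M sZ); [exact: (sub_nat 2 sZ)|exact: Lint].
Qed.

(** For vectors of equal norm, 2 b(x, x - y) = Q(x - y), so the reflection subtracts exactly x -
    y. *)
Lemma reflection_swap x y : Q x = Q y -> Q (x - y) != 0 ->
  x *m reflection B (x - y) = y.
Proof.
move=> Qxy d0; rewrite reflectionE.
have -> : 2 * b x (x - y) = Q (x - y).
  by move: Qxy; rewrite !quadE bilBr bilBl !bilBr (bilC Bsym y x) => <-; ring.
by rewrite (mulfV d0) scale1r opprB addrCA subrr addr0.
Qed.

(** Since Q(x - y) + Q(x + y) = 4 Q(x) is a unit, one of the two summands is. In the first case one
    reflection takes x to y; in the second, x goes to -y by the reflection in x + y and then to y by
    the reflection in y. *)
Lemma transitive_unit x y : LL x -> LL y -> Q x = Q y -> U (Q x) ->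
  exists2 g, lat_isom g & x *m g = y.
Proof.
move=> Lx Ly Qxy Qx.
have [H|H] := nonmults_dich pi (Lint (LB Lx Ly) (LB Lx Ly)).
  exists (reflection B (x - y)); first exact: lat_reflection_unit (LB Lx Ly) H.
  exact: reflection_swap Qxy (nonmults_neq0 hO H).
have H' : U (Q (x + y)).
  have [//|H'] := nonmults_dich pi (Lint (LD Lx Ly) (LD Lx Ly)).
  have : U (2 * (2 * Q x)) by apply: (nonmultsM hO) => //; apply: (nonmultsM hO).
  case=> _ []; rewrite (_ : _ * _ = b (x - y) (x - y) + b (x + y) (x + y)).
    exact: (multsD hO).
  move: Qxy; rewrite !quadE bilBl !bilBr bilDl !bilDr => ->; ring.
have Ny : y *m reflection B y = - y.
  rewrite reflectionE -quadE mulfK -?Qxy ?(nonmults_neq0 hO Qx)//.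
  by rewrite scaler_nat mulr2n opprD addrA subrr sub0r.
exists (reflection B (x + y) *m reflection B y).
  apply: lat_isomM; apply: lat_reflection_unit => //; last by rewrite -Qxy.
  exact: LD.
have QN : Q x = Q (- y) by rewrite Qxy -[in RHS]scaleN1r quadZ sqrrN expr1n mul1r.
have E : x + y = x - (- y) by rewrite opprK.
by rewrite mulmxA E (reflection_swap QN) -?E ?(nonmults_neq0 hO H')// mulNmx Ny opprK.
Qed.

(** Here Q(x - y) = 2 Q(x) - 2 b(x, y) is a unit, so a single reflection suffices. *)
Lemma transitive_paired x y : LL x -> LL y -> Q x = Q y -> pm (Q x) ->
  U (b x y) -> exists2 g, lat_isom g & x *m g = y.
Proof.
move=> Lx Ly Qxy Qx bxy.
have U : U (Q (x - y)).
  rewrite (_ : Q _ = - (2 : F) * b x y + 2 * Q x).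
    apply: (nonmults_addmult hO); last by apply: (multsMl hO) => //; exact: nonmults_in two_unit.
    by apply: (nonmultsM hO) => //; apply: nonmultsN.
  move: Qxy; rewrite !quadE bilBl !bilBr (bilC Bsym y x) => <-; ring.
exists (reflection B (x - y)); first exact: lat_reflection_unit (LB Lx Ly) U.
exact: reflection_swap Qxy (nonmults_neq0 hO U).
Qed.

(** If neither of the given partners serves both vectors, their sum does. *)
Lemma common_partner x y : LL x -> LL y ->
  (exists2 z, LL z & U (b x z)) -> (exists2 z, LL z & U (b y z)) ->
  exists z, [/\ LL z, U (b x z) & U (b y z)].
Proof.
move=> Lx Ly [z Lz xz] [t Lt yt].
have [yz|yz] := nonmults_dich pi (Lint Ly Lz); first by exists z.
have [xt|xt] := nonmults_dich pi (Lint Lx Lt); first by exists t.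
exists (z + t); split; first exact: LD.
  by rewrite bilDr; apply: (nonmults_addmult hO).
by rewrite bilDr addrC; apply: (nonmults_addmult hO).
Qed.

(* When B(x, y) is not a unit, x is moved to y through a third vector z of the
   same norm pairing to units with both. *)
Lemma transitive_primitive x y : LL x -> LL y -> Q x = Q y -> pm (Q x) ->
  (exists2 z, LL z & U (b x z)) -> (exists2 z, LL z & U (b y z)) ->
  exists2 g, lat_isom g & x *m g = y.
Proof.
move=> Lx Ly Qxy Qx xp yp.
have [bxy|bxy] := nonmults_dich pi (Lint Lx Ly); first exact: transitive_paired Qx bxy.
have [z [Lz xz yz]] := common_partner Lx Ly xp yp.
(* The root s gives z + s x the norm Q(x). The correction s x changes the pairings with x and y by
   multiples of pi, so they remain units. *)
have [|s Zs sE] := hl_root hO (nonmultsM hO two_unit xz) Qx (_ : O (Q x - Q z)).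
  by apply: (sub_B sZ); apply: Lint.
pose z' := z + s *: x.
have Lz' : LL z' by apply: LD => //; apply: LZ.
have Qz' : Q z' = Q x.
  rewrite /z' (quadD Bsym) quadZ bilZr (bilC Bsym z x) -[RHS](subrK (Q z)) -sE; ring.
have xz' : U (b x z').
  rewrite /z' bilDr bilZr; apply: (nonmults_addmult hO) => //; exact: (multsMl hO).
have yz' : U (b z' y).
  rewrite (bilC Bsym) /z' bilDr bilZr (bilC Bsym y x); apply: (nonmults_addmult hO) => //.
  exact: (multsMl hO).
have [g gi gE] := transitive_paired Lx Lz' (esym Qz') Qx xz'.
have [|h hi hE] := transitive_paired Lz' Ly (etrans Qz' Qxy) _ yz'; first by rewrite Qz'.
by exists (g *m h); [exact: lat_isomM|rewrite mulmxA gE].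
Qed.

(** The vector x is moved along q y, with q = pi^(k + 1). After division by q, the equation for the
    norm has linear coefficient 2 b(x, y), a unit, and quadratic coefficient q Q(y), a multiple of
    pi since the exponent is positive. *)
Lemma lift_norm x y t k : LL x -> LL y -> U (b x y) ->
  mults O pi k.+1 (Q x - t) ->
  exists z, [/\ LL z, Q z = t & exists2 v, LL v & z - x = pi ^+ k.+1 *: v].
Proof.
move=> Lx Ly xy [r Zr rE]; set q := pi ^+ k.+1 in rE *.
have Zq : O (q * Q y).
  by apply: (sub_M sZ); [exact: (hl_piX hO)|exact: Lint].
have Mq : pm (q * Q y).
  by apply: (@multsS _ _ _ hO k); exists (Q y) => //; apply: Lint.
have [s Zs sE] := hl_root hO (nonmultsM hO two_unit xy) Mq (sub_N sZ Zr).
exists (x + (q * s) *: y); split.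
- apply: LD => //; apply: LZ => //; apply: (sub_M sZ) => //; exact: (hl_piX hO).
- rewrite (quadD Bsym) quadZ bilZr -[RHS](subKr (Q x)) -rE.
  rewrite (_ : r = - (2 * b x y * s + q * Q y * s ^+ 2)); last by rewrite sE opprK.
  ring.
- by exists (s *: y); [exact: LZ|rewrite addrC addKr scalerA].
Qed.

Variables (u : 'rV[F]_n) (k : nat).
Hypothesis Lu : LL u.
Hypothesis u_prim : ~ scale_set pi LL u.
Hypothesis u_good : U (Q u) \/
  pm (Q u) /\ (forall x, LL x -> ~ scale_set pi LL x ->
               exists2 y, LL y & U (b x y)).
Local Notation q := (pi ^+ k.+1).

Lemma transitive_mod x : LL x -> ~ scale_set pi LL x ->
  mults O pi k.+1 (Q x - Q u) ->
  exists2 g, lat_isom g & scale_set q LL (u *m g - x).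
Proof.
move=> Lx xprim Qxu.
have P1 : exists2 y, LL y & U (b x y).
  case: u_good => [Qu|[_ H]]; last exact: H.
  (* When Q(u) is a unit, x is its own partner, because Q(x) is congruent to Q(u). *)
  exists x => //; rewrite -quadE -(subrK (Q u) (Q x)) addrC.
  exact: (nonmults_addmult hO) (multsS hO Qxu).
have [y Ly xy] := P1.
have [z [Lz Qz [v Lv vE]]] := lift_norm Lx Ly xy Qxu.
suff [g gi gE] : exists2 g, lat_isom g & u *m g = z.
  by exists g => //; rewrite gE vE; exists v.
case: u_good => [Qu|[Qu H]]; first exact: transitive_unit (esym Qz) Qu.
apply: transitive_primitive (esym Qz) Qu _ _ => //; first exact: H.
exists y => //; have -> : z = x + q *: v by rewrite -vE addrC subrK.
rewrite bilDl bilZl; apply: (nonmults_addmult hO) => //.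
by apply: (@multsS _ _ _ hO k); exists (b v y) => //; apply: Lint.
Qed.

End LocalOrbits.

(** * Cardinalities of finite sets *)

Section CardSet.
Implicit Types T U : choiceType.

Lemma card_set_sub T (X Y : set T) : finite_set Y -> X `<=` Y ->
  (card_set X <= card_set Y)%N.
Proof.
move=> Yf XY; have Xf := sub_finite_set XY Yf.
by apply: fsubset_leq_card; rewrite -fset_set_sub.
Qed.
Lemma card_set_image T U (f : T -> U) (X : set T) : finite_set X ->
  (card_set (f @` X) <= card_set X)%N.
Proof. by move=> Xf; rewrite /card_set fset_set_image//; apply: leq_imfset_card. Qed.
Lemma card_set_inj T U (f : T -> U) (X : set T) : finite_set X -> {in X &, injective f} ->
  card_set (f @` X) = card_set X.
Proof.
move=> Xf fi; rewrite /card_set fset_set_image//; apply: card_in_imfset => x y.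
by rewrite !in_fset_set//; apply: fi.
Qed.
Lemma card_setU T (X Y : set T) : finite_set X -> finite_set Y ->
  (card_set (X `|` Y) <= card_set X + card_set Y)%N.
Proof. by move=> Xf Yf; rewrite /card_set fset_setU// cardfsU leq_subr. Qed.
Lemma card_set_fin (T : finType) (P : {set T}) : card_set [set` P] = #|P|.
Proof.
rewrite [RHS]cardE; apply: (@perm_size _ (fset_set [set` P]) (enum P)).
apply: uniq_perm; [exact: fset_uniq|exact: enum_uniq|move=> x].
by rewrite mem_enum (in_fset_set (@finite_finset T _)); apply/idP/idP; rewrite inE.
Qed.
End CardSet.

(** * Proper orbits modulo a power of the uniformizer *)

Section LatticeOrbits.
Variables (F : fieldType) (O : set F) (pi : F) (n : nat) (B M : 'M[F]_n).
Local Notation LL := (row_span O M).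
Local Notation U := (nonmults O pi).
Local Notation pm := (mults O pi 1).
Local Notation b := (bil B).
Local Notation Q := (quad B).
Hypothesis hO : henselian O pi.
Hypothesis Bsym : B^T = B.
Hypothesis BU : B \in unitmx.
Hypothesis MU : M \in unitmx.
Hypothesis Lint : forall x y, LL x -> LL y -> O (b x y).
Hypothesis two0 : (2 : F) != 0.
Implicit Types (x y z u v : 'rV[F]_n) (g h : 'M[F]_n).

Let sZ := hl_sub hO.
Let LB x y : LL x -> LL y -> LL (x - y) := @row_spanB _ _ _ _ _ _ sZ.
Let LD x y : LL x -> LL y -> LL (x + y) := @row_spanD _ _ _ _ _ _ sZ.
Let LZ t x : O t -> LL x -> LL (t *: x) := @row_spanZ _ _ _ _ _ _ sZ.

Lemma scale_zsub t : zsubmod (scale_set t LL).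
Proof.
split; first by exists 0; rewrite ?scaler0//; apply: row_span0.
by move=> _ _ [x Lx <-] [y Ly <-]; exists (x - y); rewrite ?scalerBr//; apply: LB.
Qed.

Lemma translate_eq (X : set 'rV[F]_n) x y : zsubmod X ->
  translate X x = translate X y <-> X (x - y).
Proof.
move=> zX; split=> [e|H].
  have : translate X y x by rewrite -e; exists 0; [exact: zX.1|rewrite add0r].
  by move=> [z Xz <-]; rewrite addrK.
apply/seteqP; split=> _ [z Xz <-].
  by exists (z + (x - y)); [exact: zsubmodD|rewrite addrA subrK].
by exists (z - (x - y)); [exact: zX.2|rewrite opprB addrA subrK].
Qed.

Lemma lat_scale g t x : lat_isom O B M g ->
  scale_set t LL x <-> scale_set t LL (x *m g).
Proof.
move=> [gi gL]; split=> [[y Ly <-]|[y Ly e]].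
  by exists (y *m g); [exact: (gL y).1 Ly|rewrite scalemxAl].
exists (y *m invmx g); first by apply/(gL _).2; rewrite (mulmxKV gi.1).
by rewrite scalemxAl e (mulmxK gi.1).
Qed.

Variables (u : 'rV[F]_n) (k : nat).
Local Notation q := (pi ^+ k.+1).
Local Notation coset := (translate (scale_set q LL)).

Definition norm_cosets := [set coset x | x in
  [set x | [/\ LL x, ~ scale_set pi LL x & mults O pi k.+1 (Q x - Q u)]]].
Definition sorbit_cosets := [set coset (u *m g) | g in
  [set g | lat_isom O B M g /\ \det g = 1]].

Hypothesis Lu : LL u.
Hypothesis u_prim : ~ scale_set pi LL u.
Hypothesis two_unit : U 2.
Hypothesis u_good : U (Q u) \/
  pm (Q u) /\ (forall x, LL x -> ~ scale_set pi LL x ->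
               exists2 y, LL y & U (b x y)).

(** Without improper isometries of the lattice the proper orbit is the whole orbit. Otherwise fix an
    improper h: a vector u g with g improper is the image under h of u g h^-1, a member of the
    proper orbit, so two copies of that orbit cover everything. *)
Lemma norm_cosets_orbit : finite_set sorbit_cosets ->
  (card_set norm_cosets <= 2 * card_set sorbit_cosets)%N.
Proof.
move=> fS; have zq := scale_zsub q.
have E x : LL x -> ~ scale_set pi LL x -> mults O pi k.+1 (Q x - Q u) ->
    exists2 g, lat_isom O B M g & coset x = coset (u *m g).
  move=> Lx xp Qx; have [g gi gE] := transitive_mod hO Bsym Lint two_unit Lu u_prim u_good Lx xp Qx.
  by exists g => //; apply/esym/translate_eq.
have pm1 g : lat_isom O B M g -> \det g = 1 \/ \det g = -1.
  by move=> [gi _]; apply: isom_det gi.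
have [[h hi hd]|noh] := pselect (exists2 h, lat_isom O B M h & \det h = -1); last first.
  apply: (@leq_trans (card_set sorbit_cosets)); last by rewrite leq_pmull.
  apply: card_set_sub => // _ [x [Lx xp Qx] <-].
  have [g gi ->] := E x Lx xp Qx; exists g => //; split=> //.
  by have [//|gd] := pm1 g gi; case: noh; exists g.
pose f (Y : set 'rV[F]_n) : set 'rV[F]_n := [set y *m h | y in Y].
have fE x : f (coset x) = coset (x *m h).
  apply/seteqP; split=> [_ [_ [y Py <-] <-]|_ [y Py <-]].
    by exists (y *m h); [exact: (lat_scale q y hi).1|rewrite mulmxDl].
  exists (y *m invmx h + x); last by rewrite mulmxDl (mulmxKV hi.1.1).
  by exists (y *m invmx h) => //; apply/(lat_scale _ _ hi).2; rewrite (mulmxKV hi.1.1).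
rewrite mul2n -addnn.
apply: (@leq_trans (card_set (sorbit_cosets `|` (f @` sorbit_cosets)))); last first.
  apply: leq_trans (card_setU fS (finite_image f fS)) _.
  by rewrite leq_add2l; apply: card_set_image.
apply: card_set_sub; first by rewrite finite_setU; split; last exact: finite_image.
move=> _ [x [Lx xp Qx] <-]; have [g gi ->] := E x Lx xp Qx.
have [gd|gd] := pm1 g gi; first by left; exists g.
right; exists (coset (u *m (g *m invmx h))); last first.
  by rewrite fE !mulmxA (mulmxKV hi.1.1).
exists (g *m invmx h) => //; split; first by apply: lat_isomM => //; apply: lat_isomV.
by rewrite det_mulmx det_inv gd hd invrN1 mulrNN mulr1.
Qed.

End LatticeOrbits.

(** * Isometries of determinant -1 *)

Section LatticeReflections.
Variables (F : fieldType) (O : set F) (pi : F) (n : nat) (B M : 'M[F]_n).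
Local Notation LL := (row_span O M).
Local Notation U := (nonmults O pi).
Local Notation pm := (mults O pi 1).
Local Notation b := (bil B).
Local Notation Q := (quad B).
Hypothesis hO : henselian O pi.
Hypothesis Bsym : B^T = B.
Hypothesis MU : M \in unitmx.
Hypothesis Lint : forall x y, LL x -> LL y -> O (b x y).
Hypothesis two0 : (2 : F) != 0.
Implicit Types (x y z u v : 'rV[F]_n) (g h : 'M[F]_n) (X : set 'rV[F]_n).

Let sZ := hl_sub hO.
Let LB x y : LL x -> LL y -> LL (x - y) := @row_spanB _ _ _ _ _ _ sZ.
Let LD x y : LL x -> LL y -> LL (x + y) := @row_spanD _ _ _ _ _ _ sZ.
Let LZ t x : O t -> LL x -> LL (t *: x) := @row_spanZ _ _ _ _ _ _ sZ.

(** If x, with coordinates a, pairs with all basis vectors into pi O, then a G = pi c with c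
    integral. As G is invertible over O, a is divisible by pi and x is not primitive. *)
Lemma unimodular_pairing x : U (\det (M *m B *m M^T)) ->
  LL x -> ~ scale_set pi LL x -> exists2 y, LL y & U (b x y).
Proof.
move=> Ud Lx; apply: contra_notP => H.
have [a Oa aE] := Lx.
set G := M *m B *m M^T in Ud.
have rowE i j : G i j = b (row i M) (row j M).
  by rewrite /G -gramE// mxE half_polar.
have GO i j : O (G i j) by rewrite rowE; apply: Lint; apply: row_span_row.
have GU : G \in unitmx by rewrite unitmxE unitfE (nonmults_neq0 hO Ud).
have GV i j : O (invmx G i j) by apply: sub_invmx => //; apply: (hl_inv hO).
have aG j : (a *m G) 0 j = b x (row j M).
  by rewrite -aE /bil /G tr_row colE !mulmxA -colE [RHS]mxE.
have /choice[c cP] : forall j, exists c, O c /\ (a *m G) 0 j = pi * c.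
  move=> j; rewrite aG; have Lj := row_span_row M j sZ.
  have [Uj|/mults1P[c Oc ->]] := nonmults_dich pi (Lint Lx Lj); last by exists c.
  by case: H; exists (row j M).
have aGc : a *m G = pi *: \row_j c j.
  by apply/rowP => j; have [_ ->] := cP j; rewrite !mxE.
exists ((\row_j c j) *m invmx G *m M).
  exists ((\row_j c j) *m invmx G) => // i; apply: sub_mulmx => // k l.
  by rewrite mxE; have [] := cP l.
by rewrite -aE -[in RHS](mulmxK GU a) aGc -!scalemxAl.
Qed.

Hypothesis dvr : forall z : F, O z -> z != 0 -> exists k e, U e /\ z = pi ^+ k * e.

(** Take v with Q(v) nonzero of minimal valuation. Then Q(v) divides all norms in X, hence also 2
    b(x, v) = Q(x + v) - Q(x) - Q(v); this is the integrality of the reflection in v. It is applied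
    to the lattice and to the orthogonal complement of u in it. *)
Lemma minimal_norm_vector X : (forall x y, X x -> X y -> X (x + y)) ->
  (forall x, X x -> O (Q x)) -> (exists2 v, X v & Q v != 0) ->
  exists v, [/\ X v, Q v != 0 & forall x, X x -> O (2 * b x v / Q v)].
Proof.
move=> XD XO [v0 Xv0 Qv0].
pose P k := `[< exists v e, [/\ X v, U e & Q v = pi ^+ k * e] >].
have exP : exists k, P k.
  have [k [e [Ue eE]]] := dvr (XO _ Xv0) Qv0.
  by exists k; apply/asboolP; exists v0, e.
case: (ex_minnP exP) => k /asboolP[v [e [Xv Ue Qv]]] kmin.
have Ov x : X x -> O (Q x / (pi ^+ k * e)).
  move=> Xx; have [->|Qx] := eqVneq (Q x) 0; first by rewrite mul0r; apply: sub_0.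
  have [j [f [Uf fE]]] := dvr (XO _ Xx) Qx.
  have kj : (k <= j)%N by apply: kmin; apply/asboolP; exists x, f.
  have pk : pi ^+ k != 0.
    by apply: contraNneq Qx => pk; rewrite fE -(subnK kj) exprD pk mulr0 mul0r.
  have -> : Q x / (pi ^+ k * e) = pi ^+ (j - k) * f / e.
    rewrite fE -(subnK kj) exprD addnK; have e0 := nonmults_neq0 hO Ue.
    by field; rewrite pk e0.
  apply: (sub_M sZ); last exact: (hl_inv hO).
  by apply: (sub_M sZ) (nonmults_in Uf); apply: hl_piX hO _.
have Qv0' : Q v != 0.
  have [j [f [Uf fE]]] := dvr (XO _ Xv0) Qv0; apply/eqP => v00; case/eqP: Qv0.
  have kj : (k <= j)%N by apply: kmin; apply/asboolP; exists v0, f.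
  move: v00; rewrite Qv fE -(subnK kj) exprD => /eqP.
  by rewrite mulf_eq0 (negPf (nonmults_neq0 hO Ue)) orbF => /eqP->; rewrite mulr0 mul0r.
exists v; split=> // x Xx.
have -> : 2 * b x v / Q v = Q (x + v) / Q v - Q x / Q v - Q v / Q v.
  by rewrite (quadD Bsym); field.
have OQ y : X y -> O (Q y / Q v) by move=> /Ov; rewrite Qv.
apply: (sub_B sZ) (OQ v Xv); apply: (sub_B sZ) (OQ x Xx).
exact: OQ (XD _ _ Xx Xv).
Qed.

Lemma improper_lat_isom : (exists2 v, LL v & Q v != 0) ->
  exists2 g, lat_isom O B M g & \det g = -1.
Proof.
move=> ex; have [|v [Lv Qv H]] := minimal_norm_vector LD _ ex.
  by move=> x Lx; apply: Lint.
exists (reflection B v); first exact: (lat_reflection hO Bsym Qv Lv H).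
exact: det_reflection.
Qed.

(** As Q(u) is a unit, the lattice splits as O u plus the complement of u. The reflection in a
    vector of minimal norm of the complement preserves the complement and fixes u. *)
Lemma improper_stabilizer_unit u : LL u -> U (Q u) ->
  (exists v, [/\ LL v, b v u = 0 & Q v != 0]) ->
  exists g, [/\ lat_isom O B M g, \det g = -1 & u *m g = u].
Proof.
move=> Lu Qu [v0 [Lv0 v0u Qv0]].
have Qu0 := nonmults_neq0 hO Qu.
pose X := [set x | LL x /\ b x u = 0].
have [|||v [[Lv vu] Qv H]] := @minimal_norm_vector X.
- move=> x y [Lx xu] [Ly yu]; split; first exact: LD.
  by rewrite bilDl xu yu addr0.
- by move=> x [Lx _]; apply: Lint.
- by exists v0.
have uv : b u v = 0 by rewrite (bilC Bsym).
exists (reflection B v); split; last 2 first.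
- exact: det_reflection.
- by rewrite reflectionE uv mulr0 mul0r scale0r subr0.
apply: (lat_reflection hO Bsym Qv Lv) => x Lx.
have : X (x - (b x u / Q u) *: u).
  split; last by rewrite bilBl bilZl -quadE divfK// subrr.
  apply: LB => //; apply: LZ => //; apply: (sub_M sZ); first exact: Lint.
  exact: (hl_inv hO).
by move=> /H; rewrite bilBl bilZl uv mulr0 subr0.
Qed.

Hypothesis total : forall z : F, O z \/ O z^-1.
Hypothesis two_unit : U 2.

(** Divide by a coordinate of minimal valuation, found by comparing coordinates one at a time
    through [total]. The result has integral coordinates, one of which is 1. *)
Lemma primitive_multiple x : x != 0 ->
  exists t, LL (t *: x) /\ ~ scale_set pi LL (t *: x).
Proof.
move=> x0; pose a := x *m invmx M.
have a0 : exists i, a 0 i != 0.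
  apply: contrapT => H; case/eqP: x0; rewrite -(mulmxKV MU x) -/a.
  rewrite (_ : a = 0) ?mul0mx//; apply/rowP => i; rewrite [RHS]mxE.
  by apply/eqP/negPn/negP => ai; apply: H; exists i.
have [i [ai ia]] : exists i, a 0 i != 0 /\ forall j, O (a 0 j / a 0 i).
  suff H (s : seq 'I_n) : (exists2 i, i \in s & a 0 i != 0) ->
      exists i, a 0 i != 0 /\ forall j, j \in s -> O (a 0 j / a 0 i).
    have [i ai] := a0; have [|j [aj H']] := H (enum 'I_n).
      by exists i; rewrite ?mem_enum.
    by exists j; split=> // l; apply: H'; rewrite mem_enum.
  elim: s => [[]//|j s IH] [i]; rewrite inE => ijs ai.
  have [[l ls al]|nos] := pselect (exists2 i, i \in s & a 0 i != 0).
    have [|m [am H]] := IH; first by exists l.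
    have [Oj|Oj] := total (a 0 j / a 0 m).
      by exists m; split=> // r; rewrite inE => /orP[/eqP->//|]; apply: H.
    have [aj|aj] := eqVneq (a 0 j) 0.
      exists m; split=> // r; rewrite inE => /orP[/eqP->|]; last exact: H.
      by rewrite aj mul0r; apply: sub_0.
    exists j; split=> // r; rewrite inE => /orP[/eqP->|rs].
      by rewrite mulfV//; apply: sub_1.
    rewrite (_ : _ / _ = (a 0 r / a 0 m) * (a 0 j / a 0 m)^-1).
      by apply: (sub_M sZ) => //; apply: H.
    by rewrite invf_div mulrA divfK.
  exists i; split=> // r; rewrite inE => rjs.
  have [->|ar] := eqVneq (a 0 r) 0; first by rewrite mul0r; apply: sub_0.
  have -> : r = i; last by rewrite mulfV//; apply: sub_1.
  case/orP: ijs => [/eqP ij|is']; last by case: nos; exists i.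
  by case/orP: rjs => [/eqP ->|rs]; [rewrite ij|case: nos; exists r].
have aE : ((a 0 i)^-1 *: x) *m invmx M = (a 0 i)^-1 *: a by rewrite -scalemxAl.
exists (a 0 i)^-1; split.
  by apply/(row_spanP _ _ MU) => j; rewrite aE mxE mulrC.
move=> [y /(row_spanP _ _ MU)/(_ i) Oy yE].
have : 1 = pi * (y *m invmx M) 0 i.
  have := congr1 (fun v : 'rV_n => v 0 i) aE.
  by rewrite -yE -scalemxAl [LHS]mxE [RHS]mxE mulVf.
(* The equation makes pi invertible in O, which is impossible because 2 is not a multiple of pi. *)
move=> e; case: two_unit => O2; apply; apply/mults1P.
exists (2 * (y *m invmx M) 0 i); first by apply: (sub_M sZ).
by rewrite mulrCA -e mulr1.
Qed.

(* In rank at least 3 a primitive vector orthogonal to the hyperbolic-type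
   plane spanned by u and a partner u' leads to a unit-norm vector of u^perp. *)
Lemma improper_stabilizer_unimodular u : (2 < n)%N -> LL u ->
  ~ scale_set pi LL u -> U (\det (M *m B *m M^T)) ->
  exists g, [/\ lat_isom O B M g, \det g = -1 & u *m g = u].
Proof.
move=> n3 Lu up Ud; have [u' Lu' uu'] := unimodular_pairing Ud Lu up.
have [x x0 [xu xu']] : exists2 x, x != 0 & b x u = 0 /\ b x u' = 0.
  pose C : 'M[F]_(n, 1 + 1) := row_mx (B *m u^T) (B *m u'^T).
  have : kermx C != 0.
    rewrite kermx_eq0 /row_free neq_ltn; apply/orP; left.
    exact: leq_ltn_trans (rank_leq_col _) n3.
  move=> /rowV0Pn[x /sub_kermxP]; rewrite mul_mx_row -row_mx0 => /eq_row_mx[e1 e2] x0.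
  by exists x => //; rewrite /bil -!mulmxA e1 e2 !mxE.
have [t [Ltx tp]] := primitive_multiple x0.
set z := t *: x in Ltx tp.
have zu : b z u = 0 by rewrite bilZl xu mulr0.
have zu' : b z u' = 0 by rewrite bilZl xu' mulr0.
have [y Ly zy] := unimodular_pairing Ud Ltx tp.
(* Subtracting a multiple of u' makes the vector orthogonal to u and keeps its pairing with z, which
   is orthogonal to u'. *)
pose y' := y - (b u y / b u u') *: u'.
have uu0 := nonmults_neq0 hO uu'.
have Ly' : LL y'.
  apply: LB => //; apply: LZ => //; apply: (sub_M sZ); first exact: Lint.
  exact: (hl_inv hO).
have y'u : b y' u = 0.
  by rewrite (bilC Bsym) bilBr bilZr divfK// subrr.
have zy' : U (b z y') by rewrite bilBr bilZr zu' mulr0 subr0.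
suff [v [Lv vu Qv]] : exists v, [/\ LL v, b v u = 0 & U (Q v)].
  have v0 := nonmults_neq0 hO Qv.
  exists (reflection B v); split.
  - exact: (lat_reflection_unit hO Bsym Lint Lv Qv).
  - exact: det_reflection.
  - by rewrite reflectionE (bilC Bsym u) vu mulr0 mul0r scale0r subr0.
(* If neither z nor y' has unit norm, then z + y' does: its norm is 2 b(z, y') up to a multiple of
   pi. *)
have [Uz|Mz] := nonmults_dich pi (Lint Ltx Ltx); first by exists z.
have [Uy|My] := nonmults_dich pi (Lint Ly' Ly'); first by exists y'.
exists (z + y'); split; first exact: LD.
  by rewrite bilDl zu y'u addr0.
rewrite (quadD Bsym) addrC; apply: (nonmults_addmult hO).
  exact: (nonmultsM hO).
exact: (multsD hO).
Qed.

End LatticeReflections.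

(** * Counting shifts *)

Section ResidueCount.
Variable n : nat.
Implicit Types (P : ('I_n -> nat) -> Prop).

(** The predicate is on vectors of natural numbers, so that one P can be read modulo several q;
    [periodic] says that it depends on residues alone. *)
Definition residues q P : {set {ffun 'I_n -> 'I_q}} :=
  finset (fun a : {ffun 'I_n -> 'I_q} => `[< P (fun i => a i : nat) >]).

Definition periodic q P := forall f f' : 'I_n -> nat,
  (forall i, f i = f' i %[mod q]) -> P f -> P f'.

Lemma residuesP q P (a : {ffun 'I_n -> 'I_q}) :
  a \in residues q P <-> P (fun i => a i : nat).
Proof. by rewrite inE; split=> /asboolP. Qed.

Lemma residues_mul q1 q2 P1 P2 : (0 < q1)%N -> (0 < q2)%N -> coprime q1 q2 ->
  periodic q1 P1 -> periodic q2 P2 ->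
  (#|residues q1 P1| * #|residues q2 P2| <=
   #|residues (q1 * q2) (fun f => P1 f /\ P2 f)|)%N.
Proof.
move=> q10 q20 cop per1 per2; rewrite -cardsX.
have q0 : (0 < q1 * q2)%N by rewrite muln_gt0 q10.
pose h (ab : {ffun 'I_n -> 'I_q1} * {ffun 'I_n -> 'I_q2}) : {ffun 'I_n -> 'I_(q1 * q2)} :=
  [ffun i => Ordinal (ltn_pmod (chinese q1 q2 (ab.1 i) (ab.2 i)) q0)].
have h1 ab i : (h ab i = ab.1 i %[mod q1])%N.
  by rewrite ffunE /= modn_dvdm ?dvdn_mulr// chinese_modl.
have h2 ab i : (h ab i = ab.2 i %[mod q2])%N.
  by rewrite ffunE /= modn_dvdm ?dvdn_mull// chinese_modr.
have hinj : injective h.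
  move=> [a b] [a' b'] e; congr (_, _); apply/ffunP => i; apply/val_inj => /=.
    by rewrite -(modn_small (ltn_ord (a i))) -(modn_small (ltn_ord (a' i)))
      -[LHS](h1 (a, b)) -[RHS](h1 (a', b')) e.
  by rewrite -(modn_small (ltn_ord (b i))) -(modn_small (ltn_ord (b' i)))
      -[LHS](h2 (a, b)) -[RHS](h2 (a', b')) e.
rewrite -(card_imset _ hinj); apply/subset_leq_card/fintype.subsetP => _ /imsetP[[a b] + ->].
rewrite finset.in_setX => /andP[/residuesP Pa /residuesP Pb]; apply/residuesP; split.
  by apply: per1 Pa => i; rewrite h1.
by apply: per2 Pb => i; rewrite h2.
Qed.

Lemma residues_prod (c : nat) (s : seq prime_nat) (P : prime_nat -> ('I_n -> nat) -> Prop) :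
  uniq s -> (forall p, p \in s -> periodic (p ^ logn p c) (P p)) ->
  (\prod_(p <- s) #|residues (p ^ logn p c) (P p)| <=
   #|residues (\prod_(p <- s) p ^ logn p c) (fun f => forall p, p \in s -> P p f)|)%N.
Proof.
elim: s => [|p s IH] /=.
  move=> _ _; rewrite !big_nil; apply/card_gt0P; exists [ffun=> ord0].
  by apply/residuesP.
move=> /andP[ps us] per; rewrite !big_cons.
have per' r : r \in s -> periodic (r ^ logn r c) (P r).
  by move=> rs; apply: per; rewrite inE rs orbT.
have pos (r : seq prime_nat) : (0 < \prod_(p <- r) p ^ logn p c)%N.
  by rewrite prodn_gt0// => i; rewrite expn_gt0 prime_nat_gt0.
apply: leq_trans (_ : (_ <= #|residues (p ^ logn p c) (P p)| *
    #|residues (\prod_(p <- s) p ^ logn p c) (fun f => forall p, p \in s -> P p f)|)%N) _.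
  by rewrite leq_mul2l IH ?orbT.
have pp : (0 < p ^ logn p c)%N by rewrite expn_gt0 prime_nat_gt0.
have cop : coprime (p ^ logn p c) (\prod_(p <- s) p ^ logn p c).
  rewrite big_seq; elim/big_rec: _ => [|r m rs IHm]; first exact: coprimen1.
  rewrite coprimeMr IHm andbT.
  apply: coprimeXl; apply: coprimeXr; rewrite prime_coprime ?prime_valP//.
  rewrite dvdn_prime2 ?prime_valP//; apply: contraNneq ps => e.
  by rewrite (_ : p = r)//; apply: val_inj.
have perp : periodic (p ^ logn p c) (P p) by apply: per; rewrite inE eqxx.
have pers : periodic (\prod_(p <- s) p ^ logn p c)
    (fun f => forall p, p \in s -> P p f).
  move=> f f' ff Pf r rs; apply: (per' _ rs) (Pf r rs) => i.
  have rd : (r ^ logn r c %| \prod_(p <- s) p ^ logn p c)%N.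
    by rewrite (big_rem r rs) /= dvdn_mulr.
  by rewrite -(modn_dvdm _ rd) ff modn_dvdm.
apply: leq_trans (residues_mul pp (pos s) cop perp pers) _.
apply/subset_leq_card/fintype.subsetP => a /residuesP[Pp Ps]; apply/residuesP => r.
by rewrite inE => /orP[/eqP->//|]; apply: Ps.
Qed.

End ResidueCount.

Lemma prime_divisorsE c : map prime_val (prime_divisors c) = primes c.
Proof.
rewrite /prime_divisors -[map _ _]/(map val _) (pmap_filter (insubK prime_nat)).
by apply/all_filterP/allP => q; rewrite mem_primes => /andP[pq _]; rewrite insubT.
Qed.
Lemma prime_divisors_uniq c : uniq (prime_divisors c).
Proof. by rewrite -(map_inj_uniq val_inj) prime_divisorsE primes_uniq. Qed.
Lemma mem_prime_divisors c p : (0 < c)%N -> (p \in prime_divisors c) = (p %| c)%N.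
Proof.
move=> c0; rewrite -(mem_map val_inj) -[map val _]/(map prime_val _) prime_divisorsE.
by rewrite mem_primes prime_valP c0.
Qed.
Lemma prime_divisors_prod c : (0 < c)%N ->
  (\prod_(p <- prime_divisors c) p ^ logn p c = c)%N.
Proof.
move=> c0; rewrite -(big_map prime_val xpredT (fun p => p ^ logn p c)%N) prime_divisorsE.
by rewrite [RHS](prod_prime_decomp c0) prime_decompE big_map.
Qed.

(** * Z_p as a henselian discrete valuation ring *)

Section ZpHensel.
Variable p : prime_nat.
Local Notation K := (padic p).

Lemma Zp_nonmults (z : K) : nonmults (Zp_in p) p%:R z <-> Zp_unit p z.
Proof. by rewrite Zp_unitP. Qed.

Lemma Zp_henselian : henselian (Zp_in p) (p%:R : K).
Proof.
split; [exact: Zp_subring|exact: sub_nat (Zp_subring p)| |].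
  by move=> z /Zp_nonmults; apply: Zp_unitV.
by move=> a q t /Zp_nonmults ua; apply: Zp_hensel.
Qed.

Lemma Zp_dvr (z : K) : Zp_in p z -> z != 0 ->
  exists k e, nonmults (Zp_in p) p%:R e /\ z = p%:R ^+ k * e.
Proof.
move=> [a _ <-] a0; have [|k [e [eU ae]]] := @padic_val p a.
  by apply: contraNneq a0 => ->; rewrite tofrac0.
exists k, (FracField.tofrac e); split; first by apply/Zp_nonmults; exists e.
by rewrite ae tofracM tofracXn (rmorph_nat (@FracField.tofrac (padic_int p))).
Qed.

End ZpHensel.

(** * Orbits read as residues in the basis of another lattice *)

Section OrbitResidues.
Variables (F : fieldType) (O : set F) (pi : F) (n : nat) (B M N g0 : 'M[F]_n).
Variables (u : 'rV[F]_n) (k m : nat).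
Hypothesis hO : henselian O pi.
Hypothesis g0i : proper_isometries B g0.
Hypothesis g0L : forall x, row_span O M x <-> row_span O N (x *m g0).
Hypothesis Lu : row_span O M u.
Hypothesis approx : forall z : F, O z -> exists i, (i < m)%N /\ mults O pi k.+1 (z - i%:R).
Local Notation q := (pi ^+ k.+1).

Definition orbit_residues : set {ffun 'I_n -> 'I_m} :=
  [set a : {ffun 'I_n -> 'I_m} | exists g,
  [/\ proper_isometries B g, forall x, row_span O M x <-> row_span O N (x *m g) &
   scale_set q (row_span O N) (u *m g - (\row_i (a i : nat)%:R) *m N)]].

(** The fixed isometry [g0] carries the orbit of u from the lattice of M to that of N, where
    coordinates are approximated by integers in [0, m). The map [phi] goes back from residues to
    cosets and covers the orbit. *)
Lemma sorbit_cosets_residues :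
  finite_set (sorbit_cosets O pi B M u k) /\
  (card_set (sorbit_cosets O pi B M u k) <= card_set orbit_residues)%N.
Proof.
have sO := hl_sub hO; have g0U := g0i.1.1.
pose phi (a : {ffun 'I_n -> 'I_m}) := translate (scale_set q (row_span O M))
  ((\row_i (a i : nat)%:R) *m N *m invmx g0).
have sub : sorbit_cosets O pi B M u k `<=` phi @` orbit_residues.
  move=> _ [g [[gi gL] gd] <-].
  have [al Oal alE] : row_span O N (u *m g *m g0) := (g0L _).1 ((gL u).1 Lu).
  have /choice[f Hf] : forall i, exists j : 'I_m, mults O pi k.+1 (al 0 i - (j : nat)%:R).
    by move=> i; have [j [jm Hj]] := approx (Oal i); exists (Ordinal jm).
  have /choice[d Hd] : forall i, exists d, O d /\ q * d = al 0 i - (f i : nat)%:R.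
    by move=> i; have [d Od dE] := Hf i; exists d.
  pose a : {ffun 'I_n -> 'I_m} := finfun f.
  have E : u *m g *m g0 - (\row_i (a i : nat)%:R) *m N =
      q *: ((\row_i d i) *m N).
    rewrite -alE -mulmxBl scalemxAl; congr (_ *m _); apply/rowP => i.
    by rewrite !mxE ffunE; have [_ ->] := Hd i.
  have Ld : row_span O N ((\row_i d i) *m N).
    by exists (\row_i d i) => // i; rewrite mxE; have [] := Hd i.
  exists a.
    exists (g *m g0); split.
    - exact: proper_isomM (conj gi gd) g0i.
    - by move=> x; rewrite mulmxA -g0L -gL.
    - by rewrite mulmxA E; exists ((\row_i d i) *m N).
  apply/esym/(translate_eq _ _ (scale_zsub M hO q)).
  exists ((\row_i d i) *m N *m invmx g0); first by apply/(g0L _).2; rewrite mulmxKV.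
  by rewrite scalemxAl -E mulmxBl mulmxK.
have Cf : finite_set orbit_residues by exact: finite_finset.
split; first exact: sub_finite_set sub (finite_image phi Cf).
exact: leq_trans (card_set_sub (finite_image phi Cf) sub) (card_set_image phi Cf).
Qed.

End OrbitResidues.

(** * Shifts by a/c of the lattices in the proper genus of L *)

Section ShiftedGenus.
Variables (n : nat) (A : 'M[rat]_n) (L : zlattice n) (u : 'rV[rat]_n) (c : nat).
Hypothesis A_pos : pos_def A.
Hypothesis L_int : integral_lattice A L.
Hypothesis u_prim : primitive L u.
Hypothesis c_gt0 : (0 < c)%N.
Implicit Types (p : prime_nat) (K : zlattice n).
Local Notation mxp p := (map_mx (locq p)).
Local Notation S := ((L, c%:R^-1 *: u) : shifted_lattice n).

Definition vecn (f : 'I_n -> nat) : 'rV[rat]_n := \row_i (f i)%:R.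
Definition residue_shift K f : shifted_lattice n := (K, c%:R^-1 *: (vecn f *m val K)).

Definition local_shift_isom K p (f : 'I_n -> nat) :=
  proper_isometries (loc_form p A)
  `&` maps_onto (loc_shifted p S) (loc_shifted p (residue_shift K f)) !=set0.

(** The cofactor of p^(c_p) in c is a p-adic unit. *)
Lemma Zp_divc p z : Zp_multiples p (logn p c) z -> Zp_in p (locq p c%:R^-1 * z).
Proof.
have [m pm cE] := pfactor_coprime (prime_valP p) c_gt0.
have pk0 : (p%:R : padic p) ^+ logn p c != 0 := expf_neq0 _ (padic_p_neq0 p).
have cK : locq p c%:R^-1 = m%:R^-1 / p%:R ^+ logn p c.
  by rewrite fmorphV rmorph_nat {1}cE natrM natrX invfM.
move=> [a Za <-]; rewrite cK -mulrA (mulKf pk0).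
apply: (sub_M (Zp_subring p)) Za; apply: Zp_unitV; apply: Zp_nat_unit.
by rewrite -prime_coprime ?prime_valP.
Qed.

Lemma lat_divc p K x : scale_set (p%:R ^+ logn p c) (loc_lattice p K) x ->
  loc_lattice p K (locq p c%:R^-1 *: x).
Proof.
move=> [y Ly <-]; rewrite scalerA; apply: row_spanZ (Zp_subring p) _ Ly.
by apply: Zp_divc; exists 1; [exact: sub_1 (Zp_subring p)|rewrite mulr1].
Qed.

Lemma local_shift_isomP K p f : local_shift_isom K p f <->
  exists g, [/\ proper_isometries (loc_form p A) g,
    forall x, loc_lattice p L x <-> loc_lattice p K (x *m g) &
    loc_lattice p K (locq p c%:R^-1 *:
      (loc p u *m g - (\row_i (f i)%:R) *m mxp p (val K)))].
Proof.
have E : loc p (c%:R^-1 *: (vecn f *m val K)) =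
    locq p c%:R^-1 *: ((\row_i (f i)%:R) *m mxp p (val K)).
  rewrite locZ locM; congr (_ *: (_ *m _)); apply/rowP => i.
  by rewrite [LHS]mxE [X in ratr X]mxE [RHS]mxE; exact: ratr_nat.
have G (g : 'M[padic p]_n) : loc p (c%:R^-1 *: u) *m g -
      loc p (c%:R^-1 *: (vecn f *m val K)) =
    locq p c%:R^-1 *: (loc p u *m g - (\row_i (f i)%:R) *m mxp p (val K)).
  by rewrite E locZ scalerBr -scalemxAl.
split=> [[g [gi /(loc_shifted_mapsP _ _ gi.1.1)[H H0]]]|[g [gi H H0]]]; exists g; split=> //.
  by rewrite -G.
by apply/(loc_shifted_mapsP _ _ gi.1.1); split=> //=; rewrite G.
Qed.

Lemma local_shift_isom_periodic K p : periodic (p ^ logn p c) (local_shift_isom K p).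
Proof.
move=> f f' ff /local_shift_isomP[g [gi H H0]]; apply/local_shift_isomP.
exists g; split; [exact: gi|exact: H|].
pose w : 'rV[padic p]_n := (\row_i (f i)%:R - \row_i (f' i)%:R) *m mxp p (val K).
have -> : loc p u *m g - (\row_i (f' i)%:R) *m mxp p (val K) =
    (loc p u *m g - (\row_i (f i)%:R) *m mxp p (val K)) + w.
  by rewrite /w mulmxBl addrA subrK.
rewrite scalerDr; apply: (row_spanD (Zp_subring p)) H0 _; rewrite /w scalemxAl.
exists (locq p c%:R^-1 *: (\row_i (f i)%:R - \row_i (f' i)%:R)); last by [].
move=> i; rewrite mxE; apply: Zp_divc.
have -> : (\row_i (f i)%:R - \row_i (f' i)%:R : 'rV[padic p]_n) 0 i =
    (f i %/ p ^ logn p c * p ^ logn p c)%:R - (f' i %/ p ^ logn p c * p ^ logn p c)%:R.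
  rewrite !mxE {1}(divn_eq (f i) (p ^ logn p c)) {1}(divn_eq (f' i) (p ^ logn p c)) ff.
  by rewrite !natrD; ring.
by apply: Zp_multB; apply/Zp_nat_mult; apply: dvdn_mull.
Qed.

(** At a prime not dividing c both shifts lie in the local lattices, so a proper isometry from L_p
    to K_p already suffices. *)
Lemma proper_genus_residue K f : proper_genus A (L, 0) (K, 0) ->
  (forall p, (p %| c)%N -> local_shift_isom K p f) ->
  proper_genus A S (residue_shift K f).
Proof.
move=> LK H p; have [pc|pc] := boolP (p %| c)%N; first exact: H.
apply/local_shift_isomP; have [g [gi /(loc_shifted_mapsP _ _ gi.1.1)[gL _]]] := LK p.
exists g; split; [exact: gi|exact: gL|].
have k0 : logn p c = 0%N by apply/eqP; rewrite -leqn0 leqNgt logn_gt0 mem_primes prime_valP c_gt0.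
apply: lat_divc; rewrite k0 expr0; eexists; last exact: scale1r.
apply: (row_spanB (Zp_subring p)); first exact: (gL _).1 (loc_mem p u_prim.1).
by eexists; [|reflexivity]; move=> i; rewrite mxE; apply: sub_nat (Zp_subring p).
Qed.

(** If u were in p L_p, then u/p would lie in L_p, and in L_r for every other prime r because p is a
    unit there; hence u/p would lie in L. *)
Lemma loc_primitive p : ~ scale_set p%:R (loc_lattice p L) (loc p u).
Proof.
move=> [y Ly yE]; have p0 : (p%:R : rat) != 0 by rewrite pnatr_eq0 -lt0n prime_nat_gt0.
apply: (u_prim.2 p); exists (p%:R^-1 *: u); last by rewrite scalerA mulfV// scale1r.
apply/mem_lattice_local => r; rewrite locZ fmorphV rmorph_nat.
have [->|rp] := eqVneq r p.
  by rewrite -yE scalerA (mulVf (padic_p_neq0 p)) scale1r.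
apply: row_spanZ (Zp_subring r) _ (loc_mem r u_prim.1).
apply: Zp_unitV; apply: Zp_nat_unit; rewrite dvdn_prime2 ?prime_valP//.
Qed.

Lemma quad_u_int : quad A u \is a Num.int.
Proof. by rewrite quadE -half_polar ?(A_pos.1)//; apply: L_int u_prim.1 u_prim.1. Qed.

Hypothesis c_odd : odd c.
Hypothesis c_good : ~ exists p : prime_nat,
  [/\ (p %| c)%N, ~ unimodular_at p A L & Zp_multiples p 1 (ratr (quad A u))].

Lemma two_nonmult p : (p %| c)%N -> nonmults (Zp_in p) p%:R 2.
Proof. by move=> pc; apply/Zp_nonmults/Zp_two_unit; apply: dvdn_odd pc c_odd. Qed.

Lemma unimodular_gram p : unimodular_at p A L ->
  nonmults (Zp_in p) p%:R
    (\det (mxp p (val L) *m loc_form p A *m (mxp p (val L))^T)).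
Proof.
move=> H; apply/Zp_nonmults; rewrite -(gramE (loc_form_sym A_pos p) (padic_two_neq0 p)).
exact: H.
Qed.

Lemma quad_u_cases p : (p %| c)%N ->
  nonmults (Zp_in p) p%:R (quad (loc_form p A) (loc p u)) \/
  Zp_multiples p 1 (quad (loc_form p A) (loc p u)) /\ unimodular_at p A L.
Proof.
move=> pc; rewrite loc_quad.
have [?|M1] := nonmults_dich p%:R (locq_int p quad_u_int); [by left|right; split=> //].
by apply: contrapT => H; apply: c_good; exists p; split.
Qed.

(** A residue vector congruent to an image of u modulo p^(c_p) K_p gives, after division by c, a
    shift of K locally properly isometric to that of L. The factor 2 is that of
    [norm_cosets_orbit]. *)
Lemma rep_count_residues p K : (p %| c)%N -> proper_genus A (L, 0) (K, 0) ->
  (rep_count p A L u (logn p c) <=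
   2 * #|residues (p ^ logn p c) (local_shift_isom K p)|)%N.
Proof.
move=> pc LK; have [g0 [g0i /(loc_shifted_mapsP _ _ g0i.1.1)[g0L _]]] := LK p.
have lp : (0 < logn p c)%N by rewrite logn_gt0 mem_primes prime_valP c_gt0.
have [k kE] : exists k, logn p c = k.+1 by exists (logn p c).-1; rewrite prednK.
have hO := Zp_henselian p; have Bs := loc_form_sym A_pos p.
have t0 := padic_two_neq0 p.
have Li := fun x y => @loc_integral n A A_pos p L x y L_int.
have Lu := loc_mem p u_prim.1.
have ap (z : padic p) : Zp_in p z -> exists i, (i < p ^ logn p c)%N /\
    mults (Zp_in p) p%:R k.+1 (z - i%:R).
  by rewrite kE; apply: Zp_approx.
have [fS cS] := sorbit_cosets_residues hO g0i g0L Lu ap.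
have ug : nonmults (Zp_in p) p%:R (quad (loc_form p A) (loc p u)) \/
  mults (Zp_in p) p%:R 1 (quad (loc_form p A) (loc p u)) /\
  (forall x, loc_lattice p L x -> ~ scale_set p%:R (loc_lattice p L) x ->
     exists2 y, loc_lattice p L y & nonmults (Zp_in p) p%:R (bil (loc_form p A) x y)).
  have [H|[H1 H2]] := quad_u_cases pc; [by left|right; split; first exact: H1].
  by move=> x; apply: (unimodular_pairing hO Bs Li t0 (unimodular_gram H2)).
have := norm_cosets_orbit hO Bs (loc_form_unit A_pos p) Li t0 Lu (loc_primitive (p := p))
  (two_nonmult pc) ug fS.
rewrite {1}kE => /leq_trans; apply; rewrite leq_mul2l; apply/orP; right.
apply: leq_trans cS _; rewrite -card_set_fin; apply: card_set_sub.
  exact: finite_finset.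
move=> a [g [gi gL aE]] /=; apply/residuesP; apply/local_shift_isomP.
exists g; split; [exact: gi|exact: gL|].
by apply: lat_divc; rewrite -kE in aE.
Qed.

Lemma residues_lower_bound K : proper_genus A (L, 0) (K, 0) ->
  \prod_(p <- prime_divisors c) ((rep_count p A L u (logn p c))%:R / 2) <=
  (#|residues c (fun f => proper_genus A S (residue_shift K f))|)%:R :> rat.
Proof.
move=> LK; pose s := prime_divisors c.
apply: (@le_trans _ _ (\prod_(p <- s) #|residues (p ^ logn p c) (local_shift_isom K p)|%:R)).
  rewrite big_seq [leRHS]big_seq; apply: ler_prod => p.
  rewrite mem_prime_divisors// => pc; rewrite divr_ge0 ?ler0n//= ler_pdivrMr//.
  by rewrite mulrC -natrM ler_nat; apply: rep_count_residues.
rewrite -natr_prod ler_nat.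
have us : uniq s := prime_divisors_uniq c.
apply: leq_trans (residues_prod us (fun p _ => @local_shift_isom_periodic K p)) _.
rewrite prime_divisors_prod//; apply/subset_leq_card/fintype.subsetP => a /residuesP H.
apply/residuesP; apply: proper_genus_residue => // p pc; apply: H.
by rewrite mem_prime_divisors.
Qed.

Hypothesis Qu_neq0 : quad A u != 0.

(* This is where the exceptional ranks 1 and 2 of the equality come from. *)
Lemma improper_shift_isom p : (n = 1%N -> c = 1%N) ->
  (n = 2%N -> ~ exists p : prime_nat,
     (p %| c)%N /\ Zp_multiples p 1 (ratr (quad A u))) ->
  exists h, [/\ isometries (loc_form p A) h, \det h = -1 &
    maps_onto (loc_shifted p S) (loc_shifted p S) h].
Proof.
move=> n1 n2.
have hO := Zp_henselian p; have Bs := loc_form_sym A_pos p.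
have t0 := padic_two_neq0 p; have dvr := @Zp_dvr p.
have Li := fun x y => @loc_integral n A A_pos p L x y L_int.
have Lu := loc_mem p u_prim.1.
have MpU := loc_basis_unit p L.
have lq0 (x : 'rV[rat]_n) : x != 0 -> quad (loc_form p A) (loc p x) != 0.
  by move=> x0; rewrite loc_quad fmorph_eq0 gt_eqF ?A_pos.2.
have u0 : u != 0 by apply: contraNneq Qu_neq0 => ->; rewrite quadE bil0l.
have Sh (h : 'M[padic p]_n) : loc p S.2 *m h - loc p S.2 =
    locq p c%:R^-1 *: (loc p u *m h - loc p u).
  by rewrite [loc p S.2]locZ scalerBr -scalemxAl.
(* When p does not divide c, the shift u/c lies in L_p, and any improper isometry of L_p preserves
   the coset. *)
have [pc|pc] := boolP (p %| c)%N; last first.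
  have [h hi hd] : exists2 h, lat_isom (Zp_in p) (loc_form p A) (mxp p (val L)) h & \det h = -1.
    by apply: (improper_lat_isom hO Bs Li dvr); exists (loc p u); [exact: Lu|exact: lq0].
  exists h; split; [exact: hi.1|exact: hd|].
  apply/(loc_shifted_mapsP _ _ hi.1.1); split; first exact: hi.2.
  rewrite Sh; apply: lat_divc.
  have -> : logn p c = 0%N by apply/eqP; rewrite -leqn0 leqNgt logn_gt0 mem_primes prime_valP c_gt0.
  rewrite expr0; eexists; last exact: scale1r.
  exact: (row_spanB (Zp_subring p)) ((hi.2 _).1 Lu) Lu.
(* When p | c the isometry is made to fix u itself. If Q(u) is a unit, this takes a nonzero vector
   orthogonal to u, hence rank at least 2; otherwise the unimodular construction takes rank at least
   3. *)
suff [h [hi hd hu]] : exists h, [/\ lat_isom (Zp_in p) (loc_form p A) (mxp p (val L)) h,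
    \det h = -1 & loc p u *m h = loc p u].
  exists h; split; [exact: hi.1|exact: hd|].
  apply/(loc_shifted_mapsP _ _ hi.1.1); split; first exact: hi.2.
  by rewrite Sh hu subrr scaler0; apply: row_span0 (Zp_subring p).
have c1 : c <> 1%N.
  by move=> c1; move: pc; rewrite c1 dvdn1 gtn_eqF ?prime_nat_gt1.
have n0 : (0 < n)%N.
  rewrite lt0n; apply/eqP => nz; case/eqP: u0; apply/rowP => i.
  by have := ltn_ord i; rewrite {2}nz.
have n_gt1 : (1 < n)%N by rewrite ltn_neqAle n0 andbT eq_sym; apply/eqP => /n1.
have tot := @Zp_total p; have two := two_nonmult pc.
have [Qu|[Qu Lum]] := quad_u_cases pc.
  apply: (improper_stabilizer_unit hO Bs Li dvr Lu Qu).
  have [x x0 xu] : exists2 x : 'rV[rat]_n, x != 0 & bil A x u = 0.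
    have : kermx (A *m u^T) != 0.
      rewrite kermx_eq0 /row_free neq_ltn; apply/orP; left.
      exact: leq_ltn_trans (rank_leq_col _) n_gt1.
    move=> /rowV0Pn[x /sub_kermxP e x0]; exists x => //.
    by rewrite /bil -mulmxA e mxE.
  have lx0 : loc p x != 0 by apply: contraNneq x0 => /eqP; rewrite locE map_mx_eq0.
  have [t [Lt tp]] := primitive_multiple hO MpU tot two lx0.
  have t_neq0 : t != 0.
    apply/negP => /eqP tz; apply: tp; rewrite tz scale0r; exists 0.
      exact: row_span0 (Zp_subring p).
    exact: scaler0.
  exists (t *: loc p x); split; first exact: Lt.
    by rewrite bilZl loc_bil xu rmorph0 mulr0.
  by rewrite quadZ mulf_neq0 ?expf_neq0 ?lq0.
have n3 : (2 < n)%N.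
  rewrite ltn_neqAle n_gt1 andbT eq_sym; apply/eqP => /n2; apply; exists p; split=> //.
  by move: Qu; rewrite loc_quad.
exact: (improper_stabilizer_unimodular hO Bs MpU Li t0 tot two n3 Lu (loc_primitive (p := p))
  (unimodular_gram Lum)).
Qed.

Lemma genus_proper : (n = 1%N -> c = 1%N) ->
  (n = 2%N -> ~ exists p : prime_nat,
     (p %| c)%N /\ Zp_multiples p 1 (ratr (quad A u))) ->
  genus A S = proper_genus A S.
Proof.
move=> n1 n2; apply/seteqP; split; last exact: proper_genus_sub.
move=> T ST p; have [g [gi gm]] := ST p.
have [gd|gd] := isom_det (loc_form_sym A_pos p) (padic_two_neq0 p) (loc_form_unit A_pos p) gi.
  by exists g; split; [exact: (conj gi gd)|exact: gm].
have [h [hi hd hm]] := improper_shift_isom p n1 n2.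
exists (h *m g); split; last exact: maps_ontoM hm gm.
split; first exact: isomM hi gi.
by rewrite /= det_mulmx hd gd mulrNN mulr1.
Qed.

End ShiftedGenus.

(** * Comparison of masses *)

Section Counting.
Implicit Types T : eqType.

Lemma count_le1 T (s : seq T) (P : pred T) : uniq s ->
  (forall x y, x \in s -> y \in s -> P x -> P y -> x = y) -> (count P s <= 1)%N.
Proof.
move=> us H; rewrite -size_filter.
have := filter_uniq P us; case E : (filter P s) => [|x [|y r]] //= /andP[].
rewrite inE negb_or => /andP[/eqP xy _] _; exfalso; apply: xy.
have := mem_filter P x s; have := mem_filter P y s.
by rewrite E !inE !eqxx ?orbT /= => /esym/andP[Py ys] /esym/andP[Px xs]; apply: H.
Qed.

Lemma card_setX (T U : choiceType) (X : set T) (Y : set U) :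
  finite_set X -> finite_set Y -> card_set (X `*` Y) = (card_set X * card_set Y)%N.
Proof.
move=> Xf Yf; rewrite /card_set fset_setX// -(size_allpairs pair).
apply: perm_size; apply: uniq_perm; first exact: fset_uniq.
  by apply: allpairs_uniq; rewrite ?fset_uniq// => -[x y] [x' y'] _ _.
move=> [x y]; rewrite in_fsetM; apply/andP/allpairsP => [[/= xX yY]|[[a b] /= [aX bY [-> ->]]]].
  by exists (x, y).
by [].
Qed.

End Counting.

(** * Automorphism groups and fibers of the map that forgets the shift *)

Section Masses.
Variables (n : nat) (A : 'M[rat]_n).
Hypothesis A_pos : pos_def A.
Implicit Types (S T : shifted_lattice n) (K : zlattice n) (g h : 'M[rat]_n).
Let Asym : A^T = A. Proof. exact: A_pos.1. Qed.
Let two0 : (2 : rat) != 0. Proof. by []. Qed.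
Let AU := pos_def_unit A_pos.

Lemma in_class_sym S T : in_class A S T -> in_class A T S.
Proof. by move=> /in_class_eq <-; apply: in_class_refl. Qed.

Lemma card_orth_le S T : in_class A S T ->
  (card_set (orth_group A S) <= card_set (orth_group A T))%N /\
  (card_set (sorth_group A S) <= card_set (sorth_group A T))%N.
Proof.
move=> [g [gi gm]]; have gU := gi.1.
pose f h := invmx g *m h *m g.
have fi (X : set 'M[rat]_n) : {in X &, injective f}.
  move=> h h' _ _ /(congr1 (fun B => g *m B *m invmx g)).
  by rewrite /f !mulmxA mulmxV// !mul1mx !mulmxK.
have fO h : orth_group A S h -> orth_group A T (f h).
  move=> [hi hm]; split; first by do 2!apply: isomM => //; apply: isomV.
  exact: maps_ontoM (maps_ontoM (maps_ontoV gU gm) hm) gm.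
split.
  rewrite -(card_set_inj (orth_group_finite A_pos S) (fi _)).
  by apply: card_set_sub (orth_group_finite A_pos T) _ => _ [h hO <-]; apply: fO.
rewrite -(card_set_inj (sorth_group_finite A_pos S) (fi _)).
apply: card_set_sub (sorth_group_finite A_pos T) _ => _ [h [[hi hd] hm] <-].
have [fi' fm] := fO h (conj hi hm); split=> //; split=> //=.
rewrite /f !det_mulmx det_inv mulrAC mulVf ?mul1r//.
Qed.

Lemma card_orth_class S T : in_class A S T ->
  card_set (orth_group A S) = card_set (orth_group A T) /\
  card_set (sorth_group A S) = card_set (sorth_group A T).
Proof.
move=> ST; have [a1 a2] := card_orth_le ST; have [b1 b2] := card_orth_le (in_class_sym ST).
by split; apply/eqP; rewrite eqn_leq ?a1 ?a2.
Qed.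

Lemma card_set_gt0 (U : choiceType) (X : set U) x : finite_set X -> X x -> (0 < card_set X)%N.
Proof.
move=> Xf Xx; rewrite /card_set cardfs_gt0; apply/fset0Pn; exists x.
by rewrite in_fset_set// inE.
Qed.

Lemma card_sorth_gt0 S : (0 < card_set (sorth_group A S))%N.
Proof.
apply: (card_set_gt0 (sorth_group_finite A_pos S) (x := 1%:M)).
by split; [exact: proper_isom1|exact: maps_onto1].
Qed.

Lemma xget_proper_class S T : in_proper_class A S = in_proper_class A (xget T (in_proper_class A S)).
Proof.
by apply: in_proper_class_eq; apply: xgetI (in_proper_class_refl A S).
Qed.
Lemma xget_class S T : in_class A S = in_class A (xget T (in_class A S)).
Proof. by apply: in_class_eq; apply: xgetI (in_class_refl A S). Qed.

Section Fibers.
Variable c : nat.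
Hypothesis c_gt0 : (0 < c)%N.

Definition class_residues T K :=
  residues c (fun f => in_proper_class A T (residue_shift c K f)).

(* Orbit-stabilizer: composing automorphisms of T with fixed isometries between
   T and the K + a/c in its class injects into the automorphisms of K. *)
Lemma class_residues_bound T K :
  (#|class_residues T K| * card_set (sorth_group A T) <= card_set (sorth_group A (K, 0%R)))%N.
Proof.
have [a0 a0E|noE] := pickP (mem (class_residues T K)); last first.
  by rewrite (eq_card0 noE).
have /choice[g Hg] : forall a : {ffun 'I_n -> 'I_c}, exists g, a \in class_residues T K ->
    (proper_isometries A `&` maps_onto (mem_shifted T) (mem_shifted (residue_shift c K (fun i => a i : nat)))) g.
  move=> a; have [aE|aE] := boolP (a \in class_residues T K); last by exists 0.
  by move: aE => /residuesP[g Hg]; exists g.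
have [g0i g0m] := Hg _ a0E.
pose h (as_ : {ffun 'I_n -> 'I_c} * 'M[rat]_n) := invmx (g a0) *m as_.2 *m g as_.1.
pose X : set ({ffun 'I_n -> 'I_c} * 'M[rat]_n) :=
  [set` class_residues T K] `*` sorth_group A T.
have fE : finite_set [set` class_residues T K] by exact: finite_finset.
have fX : finite_set X by exact: finite_setX fE (sorth_group_finite A_pos T).
rewrite -card_set_fin -(card_setX fE (sorth_group_finite A_pos T)).
have hm a s : X (a, s) -> maps_onto (mem_shifted (residue_shift c K (fun i => a0 i : nat)))
    (mem_shifted (residue_shift c K (fun i => a i : nat))) (h (a, s)).
  move=> [/= aE [si sm]]; have [gai gam] := Hg a aE.
  exact: maps_ontoM (maps_ontoM (maps_ontoV g0i.1.1 g0m) sm) gam.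
have hi a s : X (a, s) -> proper_isometries A (h (a, s)).
  move=> [/= aE [si sm]]; have [gai gam] := Hg a aE.
  by apply: proper_isomM gai; apply: proper_isomM si; apply: proper_isomV.
have hinj : {in X &, injective h}.
  move=> [a s] [b t]; rewrite !inE => Xa Xb e.
  have [_ m1] := (shifted_mapsP _ _ (hi _ _ Xa).1.1).1 (hm _ _ Xa).
  have [_ m2] := (shifted_mapsP _ _ (hi _ _ Xb).1.1).1 (hm _ _ Xb).
  (* The isometry [h (a, s)] maps K + a0/c onto K + a/c, so it determines a modulo c, and the
     entries of a are less than c. *)
  have ab : a = b.
    have sub3 (X1 Y Z : 'rV[rat]_n) : X1 - Y - (X1 - Z) = Z - Y.
      by apply/rowP => i; rewrite !mxE; ring.
    have := (mem_zsub K).2 _ _ m2 m1; rewrite e /= sub3.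
    rewrite -scalerBr -mulmxBl scalemxAl => /(row_spanP _ _ (valP K)).
    rewrite mulmxK ?(valP K)// => H; apply/ffunP => i; apply/val_inj => /=.
    have := H i; rewrite !mxE /= => /intrP[z zE].
    have cr : (c%:R : rat) != 0 by rewrite pnatr_eq0 -lt0n.
    have {}zE : (a i : nat)%:Z - (b i : nat)%:Z = c%:Z * z.
      apply: (@intr_inj rat); rewrite intrB intrM -zE.
      by rewrite -!pmulrn mulrA mulfV// mul1r.
    have z0 : z = 0.
      have := ltn_ord (a i); have := ltn_ord (b i); move: zE.
      move: (a i : nat) (b i : nat) => x y zE yc xc.
      have cz : 0 < c%:Z by rewrite ltz_nat.
      have [z1|z1|//] := ltgtP z 0.
        have : c%:Z * z <= c%:Z * -1 by rewrite ler_pM2l//; lia.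
        rewrite mulrN1; move: zE yc xc; set w := c%:Z * z; lia.
      have : c%:Z * 1 <= c%:Z * z by rewrite ler_pM2l//; lia.
      rewrite mulr1; move: zE yc xc; set w := c%:Z * z; lia.
    by move: zE; rewrite z0 mulr0; lia.
  rewrite -ab in e *; congr (_, _).
  have gaU := (Hg a Xa.1).1.1.1.
  have := congr1 (fun B => g a0 *m B *m invmx (g a)) e.
  by rewrite /h /= !mulmxA mulmxV ?g0i.1.1// !mul1mx !mulmxK.
rewrite -(card_set_inj fX hinj); apply: card_set_sub.
  exact: sorth_group_finite A_pos _.
move=> _ [[a s] Xas <-]; split; first exact: hi.
apply/shifted_mapsP; first exact: (hi _ _ Xas).1.1.
have [H _] := (shifted_mapsP _ _ (hi _ _ Xas).1.1).1 (hm _ _ Xas).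
by split=> //=; rewrite mul0mx subrr; apply: (mem_zsub K).1.
Qed.

End Fibers.

End Masses.

Section MassComparison.
Variables (n : nat) (A : 'M[rat]_n).
Hypothesis A_pos : pos_def A.
Implicit Types (S T : shifted_lattice n) (K : zlattice n) (g h : 'M[rat]_n).
Let Asym : A^T = A. Proof. exact: A_pos.1. Qed.
Let two0 : (2 : rat) != 0. Proof. by []. Qed.

Lemma sum_nat_pred (I : Type) (s : seq I) (P : pred I) (w : rat) :
  \sum_(x <- s) (P x)%:R * w = (count P s)%:R * w.
Proof.
rewrite -mulr_suml; congr (_ * _); elim: s => [|x s IH]; first by rewrite big_nil.
by rewrite big_cons IH /= natrD.
Qed.

(** * The lower bound for the proper mass *)

Section LowerBound.
Variables (L : zlattice n) (w : 'rV[rat]_n) (c : nat).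
Hypothesis c_gt0 : (0 < c)%N.
Local Notation S := ((L, w) : shifted_lattice n).
Hypothesis L_int : integral_lattice A L.
Hypothesis cw : mem_lattice L (c%:R *: w).

Local Notation DS := [set in_proper_class A T | T in proper_genus A (L, 0)].
Local Notation CS := [set in_proper_class A T | T in proper_genus A S].
Local Notation rep0 D := (xget ((L, 0) : shifted_lattice n) D).
Local Notation rep C := (xget S C).

Lemma DS_finite : finite_set DS.
Proof.
apply: (@genus_proper_classes_finite n A A_pos 1 (L, 0)) => //=.
  by rewrite scaler0; apply: (mem_zsub L).1.
exact: proper_genus_sub.
Qed.

Lemma CS_finite : finite_set CS.
Proof.
apply: (@genus_proper_classes_finite n A A_pos c S) => //=.
exact: proper_genus_sub.
Qed.

Lemma proper_massE S' (X : set (set (shifted_lattice n))) :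
  X = [set in_proper_class A T | T in proper_genus A S'] -> finite_set X ->
  proper_mass A S' = \sum_(C <- fset_set X) (card_set (sorth_group A (xget S' C)))%:R^-1.
Proof. by move=> -> Xf; rewrite /proper_mass fsbig_finite. Qed.

(** The representative picked by [xget] may carry a nonzero shift. By [genus_bounded] with c = 1
    that shift lies in the lattice, so replacing it by 0 changes neither the set nor its
    automorphisms. *)
Lemma rep0P D : DS D -> [/\ proper_genus A (L, 0) ((rep0 D).1, 0),
  in_proper_class A ((rep0 D).1, 0) = D &
  sorth_group A ((rep0 D).1, 0) = sorth_group A (rep0 D)].
Proof.
move=> [T GT TD]; have DE : in_proper_class A (rep0 D) = D.
  by rewrite -TD -xget_proper_class.
set R := rep0 D in DE *.
have RT : in_proper_class A T R by rewrite TD -DE; apply: in_proper_class_refl.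
have GR : proper_genus A (L, 0) R := proper_genus_class A_pos GT RT.
have L0 : mem_lattice L (1%:R *: 0) by rewrite scaler0; apply: (mem_zsub L).1.
have [_ _ R2] := @genus_bounded n A A_pos 1 (L, 0) R L_int L0 (proper_genus_sub GR).
have mE : mem_shifted (R.1, 0) = mem_shifted R.
  apply/(translate_eq _ _ (mem_zsub R.1)); rewrite sub0r /=.
  by apply: zsubmodN (mem_zsub R.1) _; move: R2; rewrite scale1r.
have R0 : in_proper_class A R (R.1, 0).
  exists 1%:M; split; first exact: proper_isom1.
  by rewrite -mE; apply: maps_onto1.
split; first exact: proper_genus_class GR R0.
  by rewrite -(in_proper_class_eq R0).
by rewrite /sorth_group mE.
Qed.

Lemma proper_mass0_gt0 : 0 < proper_mass A (L, 0).
Proof.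
rewrite (proper_massE erefl DS_finite).
have D0 : in_proper_class A (L, 0) \in fset_set DS.
  by rewrite in_fset_set ?inE; [exists (L, 0) => //; apply: proper_genus_refl|exact: DS_finite].
rewrite (big_rem _ D0) /= ltr_wpDr//.
  by apply: sumr_ge0 => D _; rewrite invr_ge0 ler0n.
by rewrite invr_gt0 ltr0n card_sorth_gt0.
Qed.

Lemma residues_classes K :
  (#|residues c (fun f => proper_genus A S (residue_shift c K f))| <=
   \sum_(C <- fset_set CS) #|class_residues A c (rep C) K|)%N.
Proof.
rewrite -sum1_card; under [leqRHS]eq_bigr do rewrite -sum1_card big_mkcond.
rewrite exchange_big /= big_mkcond /=; apply: leq_sum => a _; case: ifP => // /residuesP aG.
set C := in_proper_class A (residue_shift c K (fun i => a i : nat)).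
have CC : C \in fset_set CS.
  rewrite in_fset_set ?inE; last exact: CS_finite.
  by exists (residue_shift c K (fun i => a i : nat)).
rewrite (big_rem _ CC) /= ifT ?leq_addr//; apply/residuesP.
by rewrite /C -xget_proper_class; apply: in_proper_class_refl.
Qed.

(** An isometry of shifted lattices is one of the underlying lattices, so a proper class C of
    shifted lattices lies over at most one proper class of lattices. *)
Lemma class_residues_unique C (D D' : set (shifted_lattice n)) :
  DS D -> DS D' -> (0 < #|class_residues A c (rep C) (rep0 D).1|)%N ->
  (0 < #|class_residues A c (rep C) (rep0 D').1|)%N -> D = D'.
Proof.
move=> /rep0P[_ DE _] /rep0P[_ D'E _].
move=> /card_gt0P[a /residuesP[g [gi gm]]] /card_gt0P[b /residuesP[h [hi hm]]].
rewrite -DE -D'E; apply: in_proper_class_eq; exists (invmx g *m h).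
have ghi : proper_isometries A (invmx g *m h).
  by apply: proper_isomM hi; apply: proper_isomV.
split=> //.
have := maps_ontoM (maps_ontoV gi.1.1 gm) hm => /(shifted_mapsP _ _ ghi.1.1)[H _].
apply/(shifted_mapsP _ _ ghi.1.1); split; first exact: H.
by rewrite /= mul0mx subrr; apply: (mem_zsub _).1.
Qed.

(** For each class D of lattices, r / #SO(D) is at most the sum over C of [E C D] / #SO(D). By
    [class_residues_bound] every nonzero term is at most 1 / #SO(C), and by [class_residues_unique]
    each C contributes for at most one D. *)
Lemma proper_mass_lower_bound (r : rat) :
  (forall K, proper_genus A (L, 0) (K, 0) ->
    r <= #|residues c (fun f => proper_genus A S (residue_shift c K f))|%:R) ->
  r <= proper_mass A S / proper_mass A (L, 0).
Proof.
move=> rK; rewrite ler_pdivlMr ?proper_mass0_gt0//.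
rewrite (proper_massE erefl DS_finite) (proper_massE erefl CS_finite) mulr_sumr.
pose so T : rat := (card_set (sorth_group A T))%:R.
have so0 T : 0 < so T by rewrite ltr0n card_sorth_gt0.
pose E C D := #|class_residues A c (rep C) (rep0 D).1|.
have EB C D : DS D -> (E C D)%:R * so (rep C) <= so (rep0 D).
  move=> /rep0P[_ _ sE]; rewrite /so -sE -natrM ler_nat.
  exact: class_residues_bound.
apply: (@le_trans _ _ (\sum_(D <- fset_set DS) \sum_(C <- fset_set CS)
    ((0 < E C D)%N)%:R * (so (rep C))^-1)).
  rewrite big_seq [leRHS]big_seq; apply: ler_sum => D.
  rewrite in_fset_set ?inE; last exact: DS_finite.
  move=> DD; have [GK _ _] := rep0P DD.
  apply: (@le_trans _ _ (\sum_(C <- fset_set CS) (E C D)%:R / so (rep0 D))).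
    rewrite -mulr_suml ler_pM2r ?invr_gt0 ?so0//; apply: le_trans (rK _ GK) _.
    by rewrite -natr_sum ler_nat; apply: residues_classes.
  apply: ler_sum => C _; have [->|E0] := posnP (E C D); first by rewrite !mul0r.
  by rewrite mul1r ler_pdivrMr// ler_pdivlMl// mulrC; apply: EB.
rewrite exchange_big /=; apply: ler_sum => C _.
rewrite sum_nat_pred -[leRHS]mul1r ler_pM2r ?invr_gt0 ?so0// lern1.
apply: count_le1; first exact: fset_uniq.
move=> D D'; rewrite !in_fset_set ?inE; try exact: DS_finite.
exact: class_residues_unique.
Qed.

End LowerBound.

(** * The proper mass against twice the mass *)

Section Doubling.
Variable v : 'rV[rat]_n.
Hypothesis v_neq0 : quad A v != 0.
Local Notation tau := (reflection A v).

Let ti : isometries A tau. Proof. exact: reflection_isom. Qed.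
Let td : \det tau = -1. Proof. exact: det_reflection. Qed.

Lemma reflected_basis_unit K : val K *m tau \in unitmx.
Proof. by rewrite unitmx_mul (valP K) ti.1. Qed.
(** A representative of the other half of the class of T: each improper isometry of V is [tau]
    followed by a proper one. *)
Definition reflected T : shifted_lattice n :=
  (Sub (val T.1 *m tau) (reflected_basis_unit T.1), T.2 *m tau).

Lemma reflected_maps T : maps_onto (mem_shifted T) (mem_shifted (reflected T)) tau.
Proof.
apply/(shifted_mapsP _ _ ti.1); split; last by rewrite subrr; apply: (mem_zsub _).1.
move=> x; rewrite /mem_lattice /=; split=> [[a Sa <-]|[a Sa aE]].
  by exists a; rewrite ?mulmxA.
by exists a => //; apply: (can_inj (mulmxK ti.1)); rewrite -aE mulmxA.
Qed.

Definition proper_parts T : set (set (shifted_lattice n)) :=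
  [set in_proper_class A T; in_proper_class A (reflected T)].

Lemma proper_partsP T T' : in_class A T T' <-> proper_parts T (in_proper_class A T').
Proof.
split.
  move=> [g [gi gm]]; have [gd|gd] := isom_det Asym two0 (pos_def_unit A_pos) gi.
    by left; apply/esym/in_proper_class_eq; exists g; split.
  right; apply/esym/in_proper_class_eq; exists (invmx tau *m g); split.
    split; first by apply: isomM gi; apply: isomV ti.
    by rewrite /= det_mulmx det_inv td gd invrN1 mulrNN mulr1.
  exact: maps_ontoM (maps_ontoV ti.1 (reflected_maps T)) gm.
have rT : in_class A T (reflected T) by exists tau; split; [exact: ti|exact: reflected_maps].
move=> [|] e; have : in_proper_class A T' T' by apply: in_proper_class_refl.
  by rewrite e => /proper_class_sub.
by rewrite e => /proper_class_sub; rewrite (in_class_eq rT).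
Qed.

(** If T has an improper automorphism, the two proper parts coincide and #O = 2 #SO; if not, they
    are distinct and O = SO. The quotient is the same either way. *)
Lemma proper_parts_card T :
  (card_set (proper_parts T))%:R / (card_set (sorth_group A T))%:R =
  2 / (card_set (orth_group A T))%:R :> rat.
Proof.
have sf := sorth_group_finite A_pos T; have so := card_sorth_gt0 A_pos T.
have [[h [hi hm] hd]|noh] := pselect (exists2 h, orth_group A T h & \det h = -1).
  have e : in_proper_class A (reflected T) = in_proper_class A T.
    apply: in_proper_class_eq; exists (invmx tau *m h); split.
      split; first by apply: isomM hi; apply: isomV ti.
      by rewrite /= det_mulmx det_inv td hd invrN1 mulrNN mulr1.
    exact: maps_ontoM (maps_ontoV ti.1 (reflected_maps T)) hm.
  have -> : card_set (proper_parts T) = 1%N.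
    by rewrite /proper_parts e setUid /card_set fset_set1 cardfs1.
  pose f g : 'M[rat]_n := g *m h.
  have OE : orth_group A T = sorth_group A T `|` (f @` sorth_group A T).
    apply/seteqP; split=> g.
      move=> [gi gm]; have [gd|gd] := isom_det Asym two0 (pos_def_unit A_pos) gi.
        by left; split.
      right; exists (g *m invmx h); last by rewrite /f mulmxKV ?hi.1.
      split; last exact: maps_ontoM gm (maps_ontoV hi.1 hm).
      split; first by apply: isomM gi _; apply: isomV hi.
      by rewrite /= det_mulmx det_inv gd hd invrN1 mulrNN mulr1.
    move=> [[[gi _] gm]|[g' [[gi _] gm] <-]]; first by split.
    by split; [exact: isomM gi hi|exact: maps_ontoM gm hm].
  have ff : finite_set (f @` sorth_group A T) := finite_image f sf.
  have dis : (fset_set (sorth_group A T) `&` fset_set (f @` sorth_group A T))%fset = fset0.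
    rewrite -fset_setI// (_ : _ `&` _ = set0) ?fset_set0//.
    apply/seteqP; split=> // g [[[_ gd] _] [g' [[_ /= gd'] _] gE]].
    by move: gd; rewrite -gE /= det_mulmx gd' hd mul1r => /eqP; rewrite eq_sym -subr_eq0 opprK.
  have -> : card_set (orth_group A T) = (2 * card_set (sorth_group A T))%N.
    rewrite {1}/card_set OE fset_setU// cardfsU dis cardfs0 subn0.
    rewrite -/(card_set _) -/(card_set (f @` _)) card_set_inj// ?mul2n ?addnn//.
    move=> g g' _ _; exact: (can_inj (mulmxK hi.1)).
  by rewrite natrM; field; rewrite pnatr_eq0 -lt0n.
have OE : orth_group A T = sorth_group A T.
  apply/seteqP; split=> g; last by move=> [[gi _] gm]; split.
  move=> [gi gm]; have [gd|gd] := isom_det Asym two0 (pos_def_unit A_pos) gi.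
    by split.
  by case: noh; exists g.
rewrite OE; congr (_%:R / _).
rewrite /card_set /proper_parts fset_setU ?fset_set1//= cardfs2.
suff -> : in_proper_class A T != in_proper_class A (reflected T) by [].
apply/eqP => e; apply: noh.
have : in_proper_class A T (reflected T) by rewrite e; apply: in_proper_class_refl.
move=> [g [[gi /= gd] gm]]; exists (g *m invmx tau).
  split; first by apply: isomM gi _; apply: isomV ti.
  exact: maps_ontoM gm (maps_ontoV ti.1 (reflected_maps T)).
by rewrite det_mulmx det_inv gd td invrN1 mul1r.
Qed.

Variables (S : shifted_lattice n) (c : nat).
Hypothesis c_gt0 : (0 < c)%N.
Hypothesis S_int : integral_lattice A S.1.
Hypothesis Sc : mem_lattice S.1 (c%:R *: S.2).

Local Notation CS := [set in_proper_class A T | T in proper_genus A S].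
Local Notation CL := [set in_class A T | T in genus A S].

(** The sum over proper classes is regrouped by classes. A class contributes its proper parts that
    lie in the proper genus: at most the full weight 2 / #O of [proper_parts_card], and exactly that
    weight when the genus is proper. *)
Lemma proper_mass_double : proper_mass A S <= 2 * mass A S /\
  (genus A S = proper_genus A S -> proper_mass A S = 2 * mass A S).
Proof.
have CSf : finite_set CS.
  by apply: (genus_proper_classes_finite A_pos c_gt0 S_int Sc); apply: proper_genus_sub.
have CLf : finite_set CL := genus_classes_finite A_pos c_gt0 S_int Sc.
pose so T : rat := (card_set (sorth_group A T))%:R^-1.
pose P C C' := `[< proper_parts (xget S C) C' >].
have CSE C' : C' \in fset_set CS -> exists T, proper_genus A S T /\ C' = in_proper_class A T.
  by rewrite in_fset_set// inE => -[T GT <-]; exists T.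
have CLE C : C \in fset_set CL -> exists T, genus A S T /\ C = in_class A T.
  by rewrite in_fset_set// inE => -[T GT <-]; exists T.
have PE T T' : P (in_class A T) (in_proper_class A T') <-> in_class A T = in_class A T'.
  rewrite [X in _ <-> X = _](xget_class A T S) /P; split.
    by move=> /asboolP /proper_partsP /in_class_eq.
  by move=> e; apply/asboolP/proper_partsP; rewrite e; apply: in_class_refl.
have swap : proper_mass A S = \sum_(C <- fset_set CL)
    (count (P C) (fset_set CS))%:R * so (xget S C).
  rewrite (proper_massE erefl CSf).
  transitivity (\sum_(C' <- fset_set CS) \sum_(C <- fset_set CL) (P C C')%:R * so (xget S C')).
    apply: eq_big_seq => C' /CSE[T [GT ->]].
    rewrite -mulr_suml -[LHS]mul1r; congr (_ * _).
    have CT : in_class A T \in fset_set CL.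
      by rewrite in_fset_set// inE; exists T => //; apply: proper_genus_sub.
    rewrite (big_rem _ CT) /= (_ : P _ _ = true); last exact/PE.
    rewrite big_seq big1 ?addr0// => C.
    rewrite mem_rem_uniq ?fset_uniq// inE => /andP[/= Cn /CLE[T' [_ CE]]].
    rewrite (_ : P _ _ = false)//; apply/negP; rewrite CE => /PE e.
    by move: Cn; rewrite CE e eqxx.
  rewrite exchange_big; apply: eq_big_seq => C /CLE[T [_ ->]].
  rewrite -sum_nat_pred; apply: eq_big_seq => C' /CSE[T' [_ ->]].
  have [Pt|] := boolP (P _ _); last by rewrite !mul0r.
  rewrite !mul1r /so; congr (_%:R^-1).
  have := (PE _ _).1 Pt => e.
  have i1 : in_class A (xget S (in_class A T)) (xget S (in_proper_class A T')).
    rewrite -xget_class e; apply: proper_class_sub; apply: xgetI.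
    exact: in_proper_class_refl.
  by have [_ ->] := card_orth_class A_pos i1.
have mE : 2 * mass A S = \sum_(C <- fset_set CL)
    (card_set (proper_parts (xget S C)))%:R * so (xget S C).
  rewrite /mass fsbig_finite// mulr_sumr; apply: eq_bigr => C _.
  by rewrite /so proper_parts_card.
have pf T : finite_set (proper_parts T) by exact: finite_set2.
have cE C : count (P C) (fset_set CS) = card_set (CS `&` proper_parts (xget S C)).
  rewrite -size_filter /card_set fset_setI//; apply: perm_size; apply: uniq_perm.
  - by rewrite filter_uniq ?fset_uniq.
  - exact: fset_uniq.
  move=> C'; rewrite mem_filter in_fsetI andbC; congr (_ && _).
  by rewrite in_fset_set// /P; apply/asboolP/idP; rewrite inE.
rewrite swap mE; split.
  apply: ler_sum => C _; rewrite ler_wpM2r ?invr_ge0 ?ler0n// ler_nat cE.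
  by apply: card_set_sub => // C' [].
move=> Gp; apply: eq_big_seq => C /CLE[T [GT ->]]; congr (_%:R * _).
rewrite cE; congr card_set; apply/seteqP; split=> [C' []//|C' CT']; split=> //.
set R := xget S (in_class A T).
have TR : in_class A T R by apply: xgetI (in_class_refl A T).
have GR : genus A S R := genus_class A_pos GT TR.
case: CT' => [->|->]; rewrite -/R.
  by exists R => //; rewrite -Gp.
have RR : in_class A R (reflected R).
  by exists tau; split; [exact: ti|exact: reflected_maps].
have XX := genus_class A_pos GR RR.
have pR : proper_genus A S (reflected R).
  by rewrite -Gp.
by exists (reflected R).
Qed.

End Doubling.
End MassComparison.

Theorem theorem5p3 (n : nat) (A : 'M[rat]_n) (L : zlattice n)
    (u : 'rV[rat]_n) (c : nat)
    (A_pos : pos_def A) (L_int : integral_lattice A L)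
    (u_prim : primitive L u) (Qu_neq0 : quad A u != 0)
    (c_gt0 : (0 < c)%N) (c_odd : odd c)
    (c_good : ~ exists p : prime_nat,
       [/\ (p %| c)%N, ~ unimodular_at p A L &
        Zp_multiples p 1 (ratr (quad A u))]) :
  [/\ (n = 1%N -> c = 1%N) ->
      (n = 2%N -> ~ exists p : prime_nat,
         (p %| c)%N /\ Zp_multiples p 1 (ratr (quad A u))) ->
      proper_mass A (L, c%:R^-1 *: u) / proper_mass A (L, 0) =
      2 * mass A (L, c%:R^-1 *: u) / proper_mass A (L, 0),
      \prod_(p <- prime_divisors c)
         ((rep_count p A L u (logn p c))%:R / 2) <=
      2 * mass A (L, c%:R^-1 *: u) / proper_mass A (L, 0)
    & \prod_(p <- prime_divisors c)
         ((rep_count p A L u (logn p c))%:R / 2) <=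
      proper_mass A (L, c%:R^-1 *: u) / proper_mass A (L, 0)].
Proof.
pose S : shifted_lattice n := (L, c%:R^-1 *: u).
have Sc : mem_lattice S.1 (c%:R *: S.2).
  rewrite /= scalerA mulfV ?scale1r ?pnatr_eq0 -?lt0n//; exact: u_prim.1.
have [le2 eq2] := proper_mass_double A_pos Qu_neq0 c_gt0 (L_int : integral_lattice A S.1) Sc.
have lower : \prod_(p <- prime_divisors c) ((rep_count p A L u (logn p c))%:R / 2) <=
    proper_mass A S / proper_mass A (L, 0).
  apply: (proper_mass_lower_bound A_pos c_gt0 L_int Sc) => K LK.
  exact: (residues_lower_bound A_pos L_int u_prim c_gt0 c_odd c_good LK).
split=> //.
  move=> n1 n2; congr (_ / _); apply: eq2.
  exact: (genus_proper A_pos L_int u_prim c_gt0 c_odd c_good Qu_neq0 n1 n2).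
apply: le_trans lower _; rewrite ler_pM2r// invr_gt0.
exact: proper_mass0_gt0.
Qed.
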